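(* Let $n,m,l\in\mathbb{N}$, let $\Phi:\mathbb{M}_n\to\mathbb{M}_l$ and $\Psi:\mathbb{M}_m\to\mathbb{M}_l$ be strictly positive linear maps, let $0\le p,q\le1$ with $(p,q)\ne(0,0)$, and let $f$ be a non-decreasing (resp., non-increasing) function on $(0,\infty)$. If either $x\mapsto f(x^{1+p})$ or $x\mapsto f(x^{1+q})$ is concave (resp., convex) on $(0,\infty)$, then the functions $$(A,B)\in\mathbb{P}_n\times\mathbb{P}_m\longmapsto\mathrm{Tr}\, f\bigl(\Phi(A^p)^{1/2}\Psi(B^q)\Phi(A^p)^{1/2}\bigr)$$ and $$(A,B)\in\mathbb{P}_n\times\mathbb{P}_m\longmapsto\mathrm{Tr}\, f\bigl((\Phi(A^{-p})^{1/2}\Psi(B^{-q})\Phi(A^{-p})^{1/2})^{-1}\bigr)$$ are jointly concave (resp., jointly convex).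
   Context: $\mathbb{M}_n$: $n\times n$ complex matrices; $\mathbb{P}_n$: positive definite ones; $\mathrm{Tr}$: usual trace. A linear map is strictly positive if it maps positive definite matrices to positive definite matrices. *)

(* Defs.v *)
From HB Require Import structures.
From mathcomp Require Import all_boot all_order all_algebra.
From mathcomp Require Import complex.
From mathcomp Require Import boolp classical_sets reals exp.
Set Implicit Arguments. Unset Strict Implicit. Unset Printing Implicit Defensive.
Import Order.TTheory GRing.Theory Num.Theory.
Local Open Scope ring_scope.
Local Open Scope complex_scope.

Section MatrixAnalysis.
Variable R : realType.

Definition adj m n (A : 'M[R[i]]_(m, n)) : 'M[R[i]]_(n, m) :=
  (map_mx (@conjc R) A)^T.

Definition hermitian n (A : 'M[R[i]]_n) : Prop := adj A = A.

Definition posdef n (A : 'M[R[i]]_n) : Prop :=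
  hermitian A /\ forall x : 'cV[R[i]]_n, x != 0 -> 0 < (adj x *m A *m x) 0 0.

Definition unitary n (U : 'M[R[i]]_n) : Prop := U *m adj U = 1%:M.

Definition spectral_decomp n (A : 'M[R[i]]_n) (Ud : 'M[R[i]]_n * 'rV[R]_n) : Prop :=
  unitary Ud.1 /\
  A = Ud.1 *m diag_mx (map_mx (fun x : R => x%:C) Ud.2) *m adj Ud.1.

(* functional calculus f(A) for a Hermitian matrix A:
   f(A) = U diag(f(d)) U^* for a (chosen) spectral decomposition of A *)
Definition mx_fun n (f : R -> R) (A : 'M[R[i]]_n) : 'M[R[i]]_n :=
  let Ud := xget (1%:M, 0) (spectral_decomp A) in
  Ud.1 *m diag_mx (map_mx (fun x : R => (f x)%:C) Ud.2) *m adj Ud.1.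

Definition mx_pow n (p : R) (A : 'M[R[i]]_n) : 'M[R[i]]_n :=
  mx_fun (fun x => x `^ p) A.

(* Tr f(X) (real since f(X) is Hermitian) *)
Definition trf n (f : R -> R) (X : 'M[R[i]]_n) : R := complex.Re (\tr (mx_fun f X)).

Definition strictly_positive n l (Phi : 'M[R[i]]_n -> 'M[R[i]]_l) : Prop :=
  forall A, posdef A -> posdef (Phi A).

Definition nondecreasing_pos (f : R -> R) : Prop :=
  forall x y, 0 < x -> x <= y -> f x <= f y.
Definition nonincreasing_pos (f : R -> R) : Prop :=
  forall x y, 0 < x -> x <= y -> f y <= f x.

Definition concave_pos (g : R -> R) : Prop :=
  forall x y t, 0 < x -> 0 < y -> 0 <= t <= 1 ->
    (1 - t) * g x + t * g y <= g ((1 - t) * x + t * y).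
Definition convex_pos (g : R -> R) : Prop :=
  forall x y t, 0 < x -> 0 < y -> 0 <= t <= 1 ->
    g ((1 - t) * x + t * y) <= (1 - t) * g x + t * g y.

Definition jointly_concave n m (F : 'M[R[i]]_n -> 'M[R[i]]_m -> R) : Prop :=
  forall A1 A2 B1 B2 t, posdef A1 -> posdef A2 -> posdef B1 -> posdef B2 ->
    0 <= t <= 1 ->
    (1 - t) * F A1 B1 + t * F A2 B2 <=
      F ((1 - t)%:C *: A1 + t%:C *: A2) ((1 - t)%:C *: B1 + t%:C *: B2).
Definition jointly_convex n m (F : 'M[R[i]]_n -> 'M[R[i]]_m -> R) : Prop :=
  forall A1 A2 B1 B2 t, posdef A1 -> posdef A2 -> posdef B1 -> posdef B2 ->
    0 <= t <= 1 ->
    F ((1 - t)%:C *: A1 + t%:C *: A2) ((1 - t)%:C *: B1 + t%:C *: B2) <=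
      (1 - t) * F A1 B1 + t * F A2 B2.

Definition F1 n m l (Phi : 'M[R[i]]_n -> 'M[R[i]]_l) (Psi : 'M[R[i]]_m -> 'M[R[i]]_l)
  (p q : R) (f : R -> R) (A : 'M[R[i]]_n) (B : 'M[R[i]]_m) : R :=
  let S := mx_pow (2^-1) (Phi (mx_pow p A)) in
  trf f (S *m Psi (mx_pow q B) *m S).

Definition F2 n m l (Phi : 'M[R[i]]_n -> 'M[R[i]]_l) (Psi : 'M[R[i]]_m -> 'M[R[i]]_l)
  (p q : R) (f : R -> R) (A : 'M[R[i]]_n) (B : 'M[R[i]]_m) : R :=
  let S := mx_pow (2^-1) (Phi (mx_pow (- p) A)) in
  trf f (invmx (S *m Psi (mx_pow (- q) B) *m S)).

End MatrixAnalysis.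

(* Main.v *)
From HB Require Import structures.
From mathcomp Require Import all_boot all_order all_algebra.
From mathcomp Require Import perm complex spectral.
From mathcomp Require Import boolp classical_sets reals topology normedtype sequences derive exp trigo.
From mathcomp Require Import ring lra zify.
Require Import Defs.
Set Implicit Arguments. Unset Strict Implicit. Unset Printing Implicit Defensive.
Import Order.TTheory GRing.Theory Num.Theory.
Local Open Scope classical_set_scope.
Local Open Scope ring_scope.
Local Open Scope complex_scope.
Import numFieldNormedType.Exports.

(** Both functions have the form Tr f(X^(1/2) Y X^(1/2)) with X = Q(A), Y = Q'(B), where Q(A) is
    Phi(A^p) or Phi(A^(-p))^(-1).

    The core is a Lieb-type theorem: (A, Z) |-> Re Tr (v^* Q(A) v Z^(1-p)) is jointly concave.
    For dyadic p, powers are iterated square roots, which exist and are unique on matrices with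
    positive definite Hermitian part; there X^p has values in a sector of half-angle p pi/2.
    Hence chi(s) = Tr (v^* Q(s A - i H) v (s B - i K)^(1-p)) has nonnegative real part for
    Re s > 0, and by homogeneity chi(s) = s psi(-i/s) with psi the function along the real line
    (A, B) + z (H, K). A minimum principle on the half plane gives Re chi(s) >= psi(0) Re s, which
    forces the second order coefficient of psi at 0 to be nonpositive. Other exponents follow
    from e^(-1) x^p <= x^r <= e x^p for r close to p.

    Let lam_1 <= lam_2 <= ... be the eigenvalues of X Y. For a k-frame v with dual frame w
    (w^* v = 1), the matrix W = (v^* Y^(-1) v)^(-1) satisfies W <= w^* Y w and
    Tr (v^* X v W^(1-p)) + p Tr W >= (1 + p) (sum of the k smallest lam_i^(1/(1+p))), with
    equality throughout for suitable v and w. So these partial sums are jointly concave in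
    (A, B), and the Tomic-Weyl theorem applied to x |-> f(x^(1+p)) concludes. *)

(** * Positive matrices and functional calculus *)

(** The exponents p and 1 - p enter twice. They make the trace function homogeneous of degree one,
    whence the factor s in chi(s) = s psi(-i/s); and their sectors have half-angles adding up to
    pi/2, just enough for Re chi >= 0. Positive maps, congruences and inverses preserve sectors,
    which is why Phi(A^p) and Phi(A^(-p))^(-1) are treated alike.

    For s = 1/h the argument z = -ih of psi has z^2 = -h^2, so a lower bound on Re chi becomes an
    upper bound on the second order coefficient of psi.

    The obstacle is fractional powers of non-Hermitian matrices. A square root S is accessible
    through S^2 = X alone: differences of roots satisfy Sylvester equations S Y + Y T = E with S, T
    accretive, and these give uniqueness, bounds and Taylor expansions.

    The exponent 1/(1+p) arises because (1+p) x^(1/(1+p)) is the minimum of x w^(-p) + p w over w >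
    0. The factor with exponent p enters through the Lieb-type concavity, the other through operator
    concavity; exchanging X and Y covers the hypothesis on q. *)

Section Hermitian.
Variable R : realType.
Local Notation C := R[i].
Implicit Types (m n k : nat).

Lemma adjE m n (A : 'M[C]_(m, n)) i j : adj A i j = conjc (A j i).
Proof. by rewrite !mxE. Qed.
Lemma adjK m n (A : 'M[C]_(m, n)) : adj (adj A) = A.
Proof. by apply/matrixP => i j; rewrite !adjE conjcK. Qed.
Lemma adjD m n (A B : 'M[C]_(m, n)) : adj (A + B) = adj A + adj B.
Proof. by apply/matrixP => i j; rewrite [RHS]mxE !adjE [X in conjc X]mxE rmorphD. Qed.
Lemma adjN m n (A : 'M[C]_(m, n)) : adj (- A) = - adj A.
Proof. by apply/matrixP => i j; rewrite [RHS]mxE !adjE [X in conjc X]mxE rmorphN. Qed.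
Lemma adjB m n (A B : 'M[C]_(m, n)) : adj (A - B) = adj A - adj B.
Proof. by rewrite adjD adjN. Qed.
Lemma adjZ m n a (A : 'M[C]_(m, n)) : adj (a *: A) = conjc a *: adj A.
Proof. by apply/matrixP => i j; rewrite [RHS]mxE !adjE [X in conjc X]mxE rmorphM. Qed.
Lemma adj0 m n : adj (0 : 'M[C]_(m, n)) = 0.
Proof. by apply/matrixP => i j; rewrite adjE !mxE rmorph0. Qed.
Lemma adj_scalar n a : adj (a%:M : 'M[C]_n) = (conjc a)%:M.
Proof.
by apply/matrixP => i j; rewrite adjE !mxE eq_sym; case: eqP => _; rewrite ?mulr1n ?mulr0n ?rmorph0.
Qed.
Lemma adj1 n : adj (1%:M : 'M[C]_n) = 1%:M.
Proof. by rewrite adj_scalar rmorph1. Qed.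
Lemma adjM m n k (A : 'M[C]_(m, n)) (B : 'M[C]_(n, k)) :
  adj (A *m B) = adj B *m adj A.
Proof. by rewrite /adj map_mxM trmx_mul. Qed.
Lemma adj_diag n (d : 'rV[R]_n) :
  adj (diag_mx (map_mx (fun x : R => x%:C) d)) = diag_mx (map_mx (fun x : R => x%:C) d).
Proof.
apply/matrixP => i j; rewrite adjE !mxE eq_sym; case: eqP => [->|_].
  by rewrite !mulr1n conjc_real.
by rewrite !mulr0n rmorph0.
Qed.
Lemma adj_unit n (A : 'M[C]_n) : (adj A \in unitmx) = (A \in unitmx).
Proof. by rewrite /adj unitmx_tr map_unitmx. Qed.
Lemma adj_inv n (A : 'M[C]_n) : adj (invmx A) = invmx (adj A).
Proof. by rewrite /adj map_invmx trmx_inv. Qed.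

Definition rtr n (M : 'M[C]_n) : R := complex.Re (\tr M).

Lemma rtrE n (M : 'M[C]_n) : rtr M = complex.Re (\tr M). Proof. by []. Qed.

Lemma ReD (x y : C) : complex.Re (x + y) = complex.Re x + complex.Re y.
Proof. by case: x; case: y. Qed.
Lemma ReN (x : C) : complex.Re (- x) = - complex.Re x.
Proof. by case: x. Qed.
Lemma ReZ (a : R) (x : C) : complex.Re (a%:C * x) = a * complex.Re x.
Proof. by case: x => x y /=; rewrite mul0r subr0. Qed.
Lemma ImD (x y : C) : complex.Im (x + y) = complex.Im x + complex.Im y.
Proof. by case: x; case: y. Qed.
Lemma ReJ (x : C) : complex.Re (conjc x) = complex.Re x.
Proof. by case: x. Qed.
Lemma Re_sum I (r : seq I) (P : pred I) (F : I -> C) :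
  complex.Re (\sum_(i <- r | P i) F i) = \sum_(i <- r | P i) complex.Re (F i).
Proof. by elim/big_rec2: _ => //= i y1 y2 _ <-; rewrite ReD. Qed.

Lemma rtrD n (A B : 'M[C]_n) : rtr (A + B) = rtr A + rtr B.
Proof. by rewrite /rtr mxtraceD ReD. Qed.
Lemma rtrN n (A : 'M[C]_n) : rtr (- A) = - rtr A.
Proof. by rewrite /rtr raddfN ReN. Qed.
Lemma rtrB n (A B : 'M[C]_n) : rtr (A - B) = rtr A - rtr B.
Proof. by rewrite rtrD rtrN. Qed.
Lemma rtrZ n (a : R) (A : 'M[C]_n) : rtr (a%:C *: A) = a * rtr A.
Proof. by rewrite /rtr mxtraceZ ReZ. Qed.
Lemma rtrC m n (A : 'M[C]_(m, n)) (B : 'M[C]_(n, m)) : rtr (A *m B) = rtr (B *m A).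
Proof. by rewrite /rtr mxtrace_mulC. Qed.
Lemma rtrJ n (A : 'M[C]_n) : rtr (adj A) = rtr A.
Proof.
rewrite /rtr /mxtrace !Re_sum; apply: eq_bigr => i _.
by rewrite adjE ReJ.
Qed.
Lemma rtr0 n : rtr (0 : 'M[C]_n) = 0.
Proof. by rewrite /rtr mxtrace0. Qed.

(** The squared Frobenius norm. Working with squares keeps the estimates free of roots. *)
Definition fn m n (M : 'M[C]_(m, n)) : R := rtr (adj M *m M).

Lemma Re_conjM (x : C) : complex.Re (conjc x * x) = complex.Re x ^+ 2 + complex.Im x ^+ 2.
Proof. by case: x => a b /=; rewrite mulNr opprK !expr2. Qed.

Lemma fnE m n (M : 'M[C]_(m, n)) :
  fn M = \sum_j \sum_i (complex.Re (M i j) ^+ 2 + complex.Im (M i j) ^+ 2).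
Proof.
rewrite /fn /rtr /mxtrace Re_sum; apply: eq_bigr => j _; rewrite mxE Re_sum.
by apply: eq_bigr => i _; rewrite adjE Re_conjM.
Qed.
Lemma fn_ge0 m n (M : 'M[C]_(m, n)) : 0 <= fn M.
Proof.
by rewrite fnE; apply: sumr_ge0 => j _; apply: sumr_ge0 => i _; rewrite addr_ge0 ?sqr_ge0.
Qed.
Lemma fn_eq0 m n (M : 'M[C]_(m, n)) : fn M = 0 -> M = 0.
Proof.
rewrite fnE => /eqP; rewrite psumr_eq0 => [/allP h|j _]; last first.
  by apply: sumr_ge0 => i _; rewrite addr_ge0 ?sqr_ge0.
apply/matrixP => i j; have /eqP := h j (mem_index_enum _).
move/eqP; rewrite psumr_eq0 => [/allP /(_ i (mem_index_enum _))|]; last first.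
  by move=> ? _; rewrite addr_ge0 ?sqr_ge0.
rewrite /= paddr_eq0 ?sqr_ge0// !sqrf_eq0 mxE => /andP[/eqP h1 /eqP h2].
by move: h1 h2; case: (M i j) => a b /= -> ->.
Qed.
Lemma fn_gt0 m n (M : 'M[C]_(m, n)) : M != 0 -> 0 < fn M.
Proof.
move=> M0; rewrite lt_neqAle fn_ge0 andbT; apply: contra M0 => /eqP h.
by apply/eqP/fn_eq0.
Qed.

(** The real quadratic form of [A], summed over the columns of [x], so that vectors and frames are
    treated at once. *)
Definition qf m n (A : 'M[C]_m) (x : 'M[C]_(m, n)) : R := rtr (adj x *m A *m x).

Lemma qfD m n (A B : 'M[C]_m) (x : 'M[C]_(m, n)) : qf (A + B) x = qf A x + qf B x.
Proof. by rewrite /qf mulmxDr mulmxDl rtrD. Qed.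
Lemma qfN m n (A : 'M[C]_m) (x : 'M[C]_(m, n)) : qf (- A) x = - qf A x.
Proof. by rewrite /qf mulmxN mulNmx rtrN. Qed.
Lemma qfB m n (A B : 'M[C]_m) (x : 'M[C]_(m, n)) : qf (A - B) x = qf A x - qf B x.
Proof. by rewrite qfD qfN. Qed.
Lemma qfZ m n (a : R) (A : 'M[C]_m) (x : 'M[C]_(m, n)) : qf (a%:C *: A) x = a * qf A x.
Proof. by rewrite /qf -scalemxAr -scalemxAl rtrZ. Qed.
Lemma qf1 m n (x : 'M[C]_(m, n)) : qf 1%:M x = fn x.
Proof. by rewrite /qf mulmx1. Qed.
Lemma qfJ m n (A : 'M[C]_m) (x : 'M[C]_(m, n)) : qf (adj A) x = qf A x.
Proof. by rewrite /qf -rtrJ !adjM !adjK mulmxA. Qed.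
Lemma qfM m n k (A : 'M[C]_m) (K : 'M[C]_(m, n)) (x : 'M[C]_(n, k)) :
  qf (adj K *m A *m K) x = qf A (K *m x).
Proof. by rewrite /qf adjM !mulmxA. Qed.
Lemma qf0 m n (A : 'M[C]_m) : qf A (0 : 'M[C]_(m, n)) = 0.
Proof. by rewrite /qf mulmx0 rtr0. Qed.

Lemma qf_vec m (A : 'M[C]_m) (x : 'cV[C]_m) :
  qf A x = complex.Re ((adj x *m A *m x) 0 0).
Proof. by rewrite /qf /rtr /mxtrace big_ord1. Qed.

Lemma qf_cols m n (A : 'M[C]_m) (x : 'M[C]_(m, n)) : qf A x = \sum_j qf A (col j x).
Proof.
rewrite /qf /rtr [\tr (_ *m x)]/mxtrace Re_sum; apply: eq_bigr => j _; rewrite /mxtrace big_ord1.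
congr complex.Re; rewrite [LHS]mxE [RHS]mxE; apply: eq_bigr => i _; rewrite !mxE; congr (_ * _).
by apply: eq_bigr => k _; rewrite !mxE.
Qed.

Lemma posdefP m (A : 'M[C]_m) :
  posdef A <-> adj A = A /\ forall x : 'cV[C]_m, x != 0 -> 0 < qf A x.
Proof.
split=> -[hA h]; split=> // x /h.
  by rewrite qf_vec ltcE => /andP[].
rewrite qf_vec ltcE => ->; rewrite andbT; set z := (_ *m x) 0 0.
have zJ : conjc z = z.
  rewrite -[LHS](adjE (adj x *m A *m x) 0 0) !adjM adjK.
  by rewrite hA mulmxA.
by move: zJ; case: (z) => a b [] /eqP; rewrite eq_sym -subr_eq0 opprK -mulr2n mulrn_eq0.
Qed.

Definition psd m (A : 'M[C]_m) : Prop := adj A = A /\ forall x : 'cV[C]_m, 0 <= qf A x.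

Lemma psd_qf m n (A : 'M[C]_m) (x : 'M[C]_(m, n)) : psd A -> 0 <= qf A x.
Proof. by move=> [_ h]; rewrite qf_cols; apply: sumr_ge0. Qed.

Lemma posdef_herm m (A : 'M[C]_m) : posdef A -> adj A = A.
Proof. by case. Qed.
Lemma psd_herm m (A : 'M[C]_m) : psd A -> adj A = A.
Proof. by case. Qed.

Lemma posdef_psd m (A : 'M[C]_m) : posdef A -> psd A.
Proof.
move=> /posdefP[hA h]; split=> // x; have [->|/h/ltW//] := eqVneq x 0.
by rewrite qf0.
Qed.
Lemma psd0 m : psd (0 : 'M[C]_m).
Proof. by split=> [|x]; rewrite ?adj0// /qf mulmx0 mul0mx rtr0. Qed.
Lemma psdD m (A B : 'M[C]_m) : psd A -> psd B -> psd (A + B).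
Proof.
move=> [hA a] [hB b]; split=> [|x]; first by rewrite adjD hA hB.
by rewrite qfD addr_ge0.
Qed.
Lemma posdefD m (A B : 'M[C]_m) : posdef A -> psd B -> posdef (A + B).
Proof.
move=> /posdefP[hA a] [hB b]; apply/posdefP; split=> [|x x0].
  by rewrite adjD hA hB.
by rewrite qfD ltr_wpDr ?b ?a.
Qed.
Lemma psdZ m (c : R) (A : 'M[C]_m) : 0 <= c -> psd A -> psd (c%:C *: A).
Proof.
move=> c0 [hA a]; split=> [|x]; first by rewrite adjZ hA conjc_real.
by rewrite qfZ mulr_ge0.
Qed.
Lemma posdefZ m (c : R) (A : 'M[C]_m) : 0 < c -> posdef A -> posdef (c%:C *: A).
Proof.
move=> c0 /posdefP[hA a]; apply/posdefP; split=> [|x x0].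
  by rewrite adjZ hA conjc_real.
by rewrite qfZ mulr_gt0 ?a.
Qed.
Lemma posdef1 m : posdef (1%:M : 'M[C]_m).
Proof.
by apply/posdefP; split=> [|x x0]; rewrite ?adj1// qf1 fn_gt0.
Qed.
Lemma posdef_scalar m (c : R) : 0 < c -> posdef ((c%:C)%:M : 'M[C]_m).
Proof. by move=> c0; rewrite -scalemx1; apply/posdefZ/posdef1. Qed.
Lemma psd_congr m n (A : 'M[C]_m) (K : 'M[C]_(m, n)) : psd A -> psd (adj K *m A *m K).
Proof.
move=> pA; split=> [|x]; last by rewrite qfM psd_qf.
by rewrite !adjM adjK (psd_herm pA) mulmxA.
Qed.
Lemma posdef_congr m n (A : 'M[C]_m) (K : 'M[C]_(m, n)) (L : 'M[C]_(n, m)) :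
  L *m K = 1%:M -> posdef A -> posdef (adj K *m A *m K).
Proof.
move=> LK pA; have [hA a] := (posdefP A).1 pA; apply/posdefP; split=> [|x x0].
  by rewrite !adjM adjK hA mulmxA.
rewrite qfM a//; apply: contra x0 => /eqP h; rewrite -[x]mul1mx -LK -mulmxA h.
by rewrite mulmx0.
Qed.
Lemma posdef_congr_unit m (A : 'M[C]_m) (K : 'M[C]_m) :
  K \in unitmx -> posdef A -> posdef (adj K *m A *m K).
Proof. by move=> uK; apply: (posdef_congr (mulVmx uK)). Qed.

Lemma posdef_convex m (A B : 'M[C]_m) (t : R) : 0 <= t <= 1 -> posdef A -> posdef B ->
  posdef ((1 - t)%:C *: A + t%:C *: B).
Proof.
move=> /andP[t0 t1] pA pB; have [t1'|t1'] := ltP t 1.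
  apply: posdefD; first by apply: posdefZ; rewrite ?subr_gt0.
  by apply: psdZ => //; apply: posdef_psd.
have -> : t = 1 by apply/eqP; rewrite eq_le t1.
by rewrite subrr scale0r add0r scale1r.
Qed.

Lemma posdef_unit m (A : 'M[C]_m) : posdef A -> A \in unitmx.
Proof.
move=> /posdefP[hA a]; rewrite -row_free_unit -kermx_eq0; apply/eqP/row_matrixP => i.
rewrite row0; set r := row i _.
have rA : r *m A = 0 by apply/sub_kermxP/row_sub.
apply/eqP; apply: contraT => r0.
have ar0 : adj r != 0 by apply: contra r0 => /eqP h; rewrite -[r]adjK h adj0.
by have := a _ ar0; rewrite /qf adjK rA mul0mx rtr0 ltxx.
Qed.

Definition rdiag n (d : 'rV[R]_n) : 'M[C]_n := diag_mx (map_mx (fun x : R => x%:C) d).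

Lemma spectral_exists n (A : 'M[C]_n) : adj A = A ->
  exists U, exists d : 'rV[R]_n, U *m adj U = 1%:M /\ A = U *m rdiag d *m adj U.
Proof.
move=> hA; have adjt m1 m2 (M : 'M[C]_(m1, m2)) : adj M = map_mx Num.conj M^T.
  by rewrite /adj -map_trmx.
have hs : A \is hermsymmx.
  by apply/is_hermitianmxP; rewrite expr0 scale1r -adjt hA.
have /orthomx_spectralP e := hermitian_normalmx hs.
have dr := hermitian_spectral_diag_real hs.
have su := spectral_unitarymx A.
exists (adj (spectralmx A)), (map_mx (@complex.Re R) (spectral_diag A)).
have adjs : invmx (spectralmx A) = adj (spectralmx A) by rewrite invmx_unitary ?adjt.
split; first by rewrite adjK -adjs mulVmx ?spectral_unit.
rewrite adjK -adjs {1}e; congr (_ *m diag_mx _ *m _).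
apply/rowP => i; rewrite !mxE RRe_real//.
by move/mxOverP: dr; apply.
Qed.

Lemma rdiagM n (d e : 'rV[R]_n) : rdiag d *m rdiag e = rdiag (\row_i (d 0 i * e 0 i)).
Proof.
rewrite /rdiag mulmx_diag; congr diag_mx; apply/rowP => i; rewrite !mxE.
by rewrite -rmorphM.
Qed.
Lemma adj_rdiag n (d : 'rV[R]_n) : adj (rdiag d) = rdiag d.
Proof. exact: adj_diag. Qed.
Lemma rdiag_const n (c : R) : rdiag (const_mx c : 'rV[R]_n) = (c%:C)%:M.
Proof. by rewrite /rdiag map_const_mx diag_const_mx. Qed.
Lemma rtr_rdiag n (d : 'rV[R]_n) : rtr (rdiag d) = \sum_i d 0 i.
Proof.
rewrite /rtr /rdiag mxtrace_diag Re_sum; apply: eq_bigr => i _; by rewrite mxE.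
Qed.
Lemma rdiagE n (d : 'rV[R]_n) i j : rdiag d i j = (d 0 i)%:C *+ (i == j).
Proof. by rewrite !mxE. Qed.

Lemma qf_rdiag n (d : 'rV[R]_n) (x : 'cV[C]_n) :
  qf (rdiag d) x = \sum_i d 0 i * (complex.Re (x i 0) ^+ 2 + complex.Im (x i 0) ^+ 2).
Proof.
rewrite qf_vec mxE Re_sum; apply: eq_bigr => i _.
rewrite /rdiag mul_mx_diag [X in X * _]mxE [map_mx _ _ _ _]mxE adjE.
by rewrite -mulrA mulrCA ReZ Re_conjM.
Qed.

Lemma posdef_rdiag n (d : 'rV[R]_n) : posdef (rdiag d) <-> forall i, 0 < d 0 i.
Proof.
split=> [/posdefP[_ h] i|h].
  have e0 : (delta_mx i 0 : 'cV[C]_n) != 0.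
    apply/eqP => /matrixP /(_ i 0); rewrite !mxE !eqxx => /eqP.
    by rewrite oner_eq0.
  have := h _ e0; rewrite qf_rdiag (bigD1 i)//= big1 => [|j /negPf ji].
    by rewrite !mxE !eqxx /= expr1n expr0n /= !addr0 mulr1.
  by rewrite !mxE ji /= expr0n /= addr0 mulr0.
apply/posdefP; split=> [|x x0]; first exact: adj_rdiag.
have := fn_gt0 x0; rewrite fnE big_ord1 qf_rdiag => hx.
rewrite lt_neqAle; apply/andP; split; last first.
  by apply: sumr_ge0 => i _; rewrite mulr_ge0 ?addr_ge0 ?sqr_ge0// ltW.
apply: contraTneq hx => /esym/eqP; rewrite psumr_eq0 => [/allP e|i _]; last first.
  by rewrite mulr_ge0 ?addr_ge0 ?sqr_ge0// ltW.
rewrite big1 ?ltxx// => i _; have := e i (mem_index_enum _).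
by rewrite mulf_eq0 gt_eqF//= => /eqP.
Qed.

Lemma posdef_spectral n (A : 'M[C]_n) : posdef A -> exists U, exists d : 'rV[R]_n,
  [/\ U *m adj U = 1%:M, adj U *m U = 1%:M, A = U *m rdiag d *m adj U & forall i, 0 < d 0 i].
Proof.
move=> pA; have [U [d [UU e]]] := spectral_exists (posdef_herm pA).
have UU' := mulmx1C UU; exists U, d; split=> //; apply/posdef_rdiag.
have -> : rdiag d = adj U *m A *m U.
  by rewrite e !mulmxA UU' mul1mx -mulmxA UU' mulmx1.
exact: posdef_congr UU' pA.
Qed.

Lemma posdef_conj n (U : 'M[C]_n) (d : 'rV[R]_n) : U *m adj U = 1%:M ->
  (forall i, 0 < d 0 i) -> posdef (U *m rdiag d *m adj U).
Proof.
move=> UU /posdef_rdiag pd; rewrite -{1}[U]adjK.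
exact: posdef_congr UU pd.
Qed.

Lemma rdiag_delta n (d : 'rV[R]_n) i :
  rdiag d *m (delta_mx i 0 : 'cV[C]_n) = (d 0 i)%:C *: delta_mx i 0.
Proof.
apply/matrixP => j k; rewrite [k]ord1 /rdiag mul_diag_mx !mxE andbT.
by case: eqP => [->|]; rewrite ?mulr0.
Qed.

(** [W = adj V U] intertwines the two diagonals, so [W i j] vanishes unless [g 0 i = d 0 j]; hence
    it intertwines their images under [f] as well. Thus [mx_fun] does not depend on the
    decomposition chosen in it. *)
Lemma spectral_fun_unique n (f : R -> R) (U V : 'M[C]_n) (d g : 'rV[R]_n) :
  U *m adj U = 1%:M -> V *m adj V = 1%:M ->
  V *m rdiag g *m adj V = U *m rdiag d *m adj U ->
  V *m rdiag (map_mx f g) *m adj V = U *m rdiag (map_mx f d) *m adj U.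
Proof.
move=> UU VV e.
have UU' := mulmx1C UU; have VV' := mulmx1C VV.
set W := adj V *m U.
have key : rdiag g *m W = W *m rdiag d.
  have : adj V *m (V *m rdiag g *m adj V) *m U = adj V *m (U *m rdiag d *m adj U) *m U.
    by rewrite e.
  by rewrite /W !mulmxA VV' mul1mx -!mulmxA UU' mulmx1.
have key2 : rdiag (map_mx f g) *m W = W *m rdiag (map_mx f d).
  apply/matrixP => i j; move/matrixP: key => /(_ i j).
  rewrite /rdiag !mul_diag_mx !mul_mx_diag !mxE => h.
  have [->|nz] := eqVneq (\sum_j0 adj V i j0 * U j0 j) 0; first by rewrite mulr0 mul0r.
  have : (g 0 i)%:C = (d 0 j)%:C.
    by apply/(mulfI nz); rewrite mulrC h.
  by case=> ->; rewrite mulrC.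
have WW : W *m adj W = 1%:M.
  by rewrite /W adjM adjK mulmxA -[adj V *m U *m adj U]mulmxA UU mulmx1 VV'.
have UE : U = V *m W by rewrite /W mulmxA VV mul1mx.
clear key e; clearbody W; rewrite UE.
by rewrite adjM -(mulmxA V W) -key2 -!mulmxA [W *m (adj W *m _)]mulmxA WW mul1mx.
Qed.

Lemma mx_funE n (f : R -> R) (A U : 'M[C]_n) (d : 'rV[R]_n) : U *m adj U = 1%:M ->
  A = U *m rdiag d *m adj U -> mx_fun f A = U *m rdiag (map_mx f d) *m adj U.
Proof.
move=> UU e; rewrite /mx_fun.
have : spectral_decomp A (xget (1%:M, 0) (spectral_decomp A)).
  by apply: (@xgetPex _ (1%:M, 0) (spectral_decomp A)); exists (U, d).
case: xget => V g [/= VV e2].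
have -> : map_mx (fun x : R => (f x)%:C) g = map_mx (fun x : R => x%:C) (map_mx f g).
  by rewrite -map_mx_comp.
apply: spectral_fun_unique UU VV _; rewrite -e; exact: esym e2.
Qed.
End Hermitian.

(** * Entrywise trace formulas and sorted spectral decompositions *)

Section Entries.
Variable R : realType.
Local Notation C := R[i].
Implicit Types (m n k l : nat).

(** The squared modulus, as a real number. *)
Definition nz (z : C) : R := complex.Re z ^+ 2 + complex.Im z ^+ 2.
Lemma nz_ge0 z : 0 <= nz z.
Proof. by rewrite addr_ge0 ?sqr_ge0. Qed.
Lemma conj_nz z : conjc z * z = (nz z)%:C.
Proof.
by apply/eqP; case: z => a b; rewrite /nz eq_complex /=; apply/andP; split; apply/eqP; ring.
Qed.

(* Eigenvalues are indexed by [nat], so that partial sums need no casts; values at indices [>= l]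
   are irrelevant. *)
Definition dg l (lam : nat -> R) : 'M[C]_l := rdiag (\row_(i < l) lam i).

Lemma mul_dgE l m (lam : nat -> R) (A : 'M[C]_(m, l)) i j :
  (A *m dg l lam) i j = A i j * (lam j)%:C.
Proof. by rewrite mul_mx_diag !mxE. Qed.

Lemma mul_rdiagE l m (d : 'rV[R]_l) (A : 'M[C]_(m, l)) i j :
  (A *m rdiag d) i j = A i j * (d 0 j)%:C.
Proof. by rewrite mul_mx_diag !mxE. Qed.

Lemma dgM l (a b : nat -> R) : dg l a *m dg l b = dg l (fun i => a i * b i).
Proof.
rewrite /dg rdiagM; congr rdiag; apply/matrixP => i j; rewrite !mxE.
by [].
Qed.

Lemma adj_dg l (a : nat -> R) : adj (dg l a) = dg l a.
Proof. exact: adj_rdiag. Qed.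

Lemma dg1 l : dg l (fun=> 1) = 1%:M.
Proof.
rewrite /dg -(rdiag_const l 1); congr rdiag.
by apply/matrixP => i j; rewrite !mxE.
Qed.

Lemma eq_dg l (a b : nat -> R) : (forall i, a i = b i) -> dg l a = dg l b.
Proof. by move=> h; congr rdiag; apply/matrixP => i j; rewrite !mxE h. Qed.

Lemma rtr_dg l (a : nat -> R) : rtr (dg l a) = \sum_(i < l) a i.
Proof. by rewrite /dg rtr_rdiag; apply: eq_bigr => i _; rewrite mxE. Qed.

(** Traces against diagonal matrices become double sums weighted by the squared moduli of the
    entries of [q]; trace inequalities then reduce to scalar ones. *)
Lemma rtr_weights l k (q : 'M[C]_(l, k)) (lam : nat -> R) (om : 'rV[R]_k) :
  rtr (adj q *m dg l lam *m q *m rdiag om) =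
  \sum_c \sum_(i < l) nz (q i c) * lam i * om 0 c.
Proof.
rewrite rtrE /mxtrace Re_sum; apply: eq_bigr => c _.
rewrite mul_mx_diag !mxE mulrC ReZ mulrC -mulr_suml; congr (_ * _).
rewrite Re_sum; apply: eq_bigr => i _.
by rewrite mul_dgE adjE mulrAC conj_nz -rmorphM.
Qed.

Lemma Re_gram l k (q : 'M[C]_(l, k)) c :
  complex.Re ((adj q *m q) c c) = \sum_i nz (q i c).
Proof.
rewrite mxE Re_sum; apply: eq_bigr => i _.
by rewrite adjE conj_nz.
Qed.

Lemma Re_cogram l k (q : 'M[C]_(l, k)) (om : 'rV[R]_k) i :
  complex.Re ((q *m rdiag om *m adj q) i i) = \sum_c nz (q i c) * om 0 c.
Proof.
rewrite mxE Re_sum; apply: eq_bigr => c _.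
by rewrite mul_rdiagE adjE mulrAC [q i c * _]mulrC conj_nz -rmorphM.
Qed.

(** The inclusion of the first [k] coordinates; congruence by it cuts out the leading [k] by [k]
    block. *)
Definition sel l k : 'M[C]_(l, k) := \matrix_(i, j) ((i == j :> nat)%:R).

Lemma selE l k i j : sel l k i j = (i == j :> nat)%:R.
Proof. by rewrite mxE. Qed.

Lemma dgE l (d : nat -> R) i j : dg l d i j = (d i)%:C *+ (i == j).
Proof. by rewrite rdiagE mxE. Qed.

Lemma sel_dg l k (d : nat -> R) : (k <= l)%N ->
  adj (sel l k) *m dg l d *m sel l k = dg k d.
Proof.
move=> kl; apply/matrixP => i j; rewrite mxE (bigD1 (widen_ord kl j)) //= mul_dgE adjE big1 ?addr0.
  rewrite !selE dgE /= eqxx mulr1 -[i == j]val_eqE eq_sym /=.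
  by case: eqVneq => [->|_]; rewrite ?rmorph1 ?rmorph0 ?mul1r ?mul0r.
move=> c hc; rewrite !selE; case: eqVneq => h; rewrite ?mulr0//.
by move: hc; rewrite -val_eqE /= h eqxx.
Qed.

Lemma spectral_perm n (U : 'M[C]_n) (d : 'rV[R]_n) (s : 'S_n) :
  (\matrix_(i, j) U i (s j)) *m rdiag (\row_j d 0 (s j)) *m adj (\matrix_(i, j) U i (s j)) =
  U *m rdiag d *m adj U.
Proof.
apply/matrixP => i k; rewrite [LHS]mxE [RHS]mxE [RHS](reindex_inj (@perm_inj _ s)) /=.
by apply: eq_bigr => j _; rewrite !mul_rdiagE !adjE !mxE.
Qed.

Lemma sorted_spectral n (A : 'M[C]_n) : posdef A -> exists U, exists lam : nat -> R,
  [/\ U *m adj U = 1%:M, A = U *m dg n lam *m adj U, (forall i, 0 < lam i) &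
      forall i j, (i <= j < n)%N -> lam i <= lam j].
Proof.
move=> /posdef_spectral[U [d [UU _ -> d0]]].
pose t : n.-tuple R := [tuple d 0 i | i < n].
have : perm_eq (sort <=%O t) t by rewrite perm_sort.
move=> /tuple_permP[s es].
(* The default value 1 keeps [lam] positive past index [n] too. *)
pose lam i := nth 1 (sort <=%O t) i.
have el (j : 'I_n) : lam j = d 0 (s j).
  rewrite /lam es -tnth_nth.
  by rewrite !tnth_mktuple.
exists (\matrix_(i, j) U i (s j)), lam; split.
(* Unitarity of the permuted [U] is the case of unit eigenvalues. *)
- have := spectral_perm U (const_mx 1) s; rewrite rdiag_const mulmx1 UU => <-.
  have -> : \row_j (const_mx 1 : 'rV[R]_n) 0 (s j) = const_mx 1.
    by apply/matrixP => i j; rewrite !mxE.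
  by rewrite rdiag_const mulmx1.
- rewrite -(spectral_perm U d s); congr (_ *m rdiag _ *m _).
  by apply/matrixP => i j; rewrite !mxE el.
- move=> i; case: (ltnP i n) => h; first by rewrite (el (Ordinal h)) d0.
  by rewrite /lam nth_default ?ltr01// size_sort size_tuple.
- move=> i j /andP[ij jn].
  apply: (sorted_leq_nth le_trans le_refl) => //.
  + by apply: sort_sorted; exact: le_total.
  + by rewrite inE size_sort size_tuple (leq_ltn_trans ij).
  + by rewrite inE size_sort size_tuple.
Qed.

End Entries.

Opaque adj rdiag mx_pow mx_fun mulmx invmx.

(** * Powers of positive definite matrices and positivity of traces *)

Section Calculus.
Variable R : realType.
Local Notation C := R[i].
Implicit Types (m n k : nat).

Lemma trfE n (f : R -> R) (A U : 'M[C]_n) (d : 'rV[R]_n) : U *m adj U = 1%:M ->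
  A = U *m rdiag d *m adj U -> trf f A = \sum_i f (d 0 i).
Proof.
move=> UU e; rewrite /trf (mx_funE f UU e) -[complex.Re _]/(rtr _) rtrC mulmxA (mulmx1C UU) mul1mx.
by rewrite rtr_rdiag; apply: eq_bigr => i _; rewrite mxE.
Qed.

Lemma mx_pow_spec n (p : R) (U : 'M[C]_n) (d : 'rV[R]_n) : U *m adj U = 1%:M ->
  mx_pow p (U *m rdiag d *m adj U) = U *m rdiag (map_mx (fun x => x `^ p) d) *m adj U.
Proof. by move=> UU; apply: (mx_funE _ UU). Qed.

Lemma mx_pow_posdef n p (A : 'M[C]_n) : posdef A -> posdef (mx_pow p A).
Proof.
move=> /posdef_spectral[U [d [UU _ -> d0]]]; rewrite mx_pow_spec//.
by apply: posdef_conj => // i; rewrite mxE powR_gt0.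
Qed.

Lemma conj_mul n (U D E : 'M[C]_n) : adj U *m U = 1%:M ->
  (U *m D *m adj U) *m (U *m E *m adj U) = U *m (D *m E) *m adj U.
Proof. by move=> UU; rewrite !mulmxA -[_ *m adj U *m U]mulmxA UU mulmx1. Qed.

Lemma mx_powD n p q (A : 'M[C]_n) : posdef A ->
  mx_pow (p + q) A = mx_pow p A *m mx_pow q A.
Proof.
move=> /posdef_spectral[U [d [UU UU' -> d0]]]; rewrite 3!(mx_pow_spec _ _ UU) (conj_mul _ _ UU') rdiagM.
congr (_ *m rdiag _ *m _); apply/rowP => i; rewrite !mxE powRD//.
by rewrite (gt_eqF (d0 i)) implybT.
Qed.
Lemma mx_pow0 n (A : 'M[C]_n) : posdef A -> mx_pow 0 A = 1%:M.
Proof.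
move=> /posdef_spectral[U [d [UU UU' -> d0]]]; rewrite !(mx_pow_spec _ _ UU).
have -> : map_mx (fun x : R => x `^ 0) d = const_mx 1.
  by apply/rowP => i; rewrite !mxE powRr0.
by rewrite rdiag_const mulmx1.
Qed.
Lemma mx_pow1 n (A : 'M[C]_n) : posdef A -> mx_pow 1 A = A.
Proof.
move=> /posdef_spectral[U [d [UU UU' -> d0]]]; rewrite !(mx_pow_spec _ _ UU).
suff -> : map_mx (fun x : R => x `^ 1) d = d by [].
by apply/rowP => i; rewrite !mxE powRr1// ltW.
Qed.
Lemma mx_powV n p (A : 'M[C]_n) : posdef A -> invmx (mx_pow p A) = mx_pow (- p) A.
Proof.
move=> pA; have u := posdef_unit (mx_pow_posdef p pA).
by apply: (can_inj (mulKmx u)); rewrite mulmxV// -mx_powD// subrr mx_pow0.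
Qed.
Lemma mx_powM n p q (A : 'M[C]_n) : posdef A -> mx_pow q (mx_pow p A) = mx_pow (p * q) A.
Proof.
move=> /posdef_spectral[U [d [UU UU' -> d0]]]; rewrite !(mx_pow_spec _ _ UU).
suff -> : map_mx (fun x : R => x `^ q) (map_mx (fun x : R => x `^ p) d) =
  map_mx (fun x : R => x `^ (p * q)) d by [].
by apply/rowP => i; rewrite !mxE powRrM.
Qed.
Lemma posdef_inv n (A : 'M[C]_n) : posdef A -> posdef (invmx A).
Proof. by move=> pA; have := mx_pow_posdef (- 1) pA; rewrite -(mx_powV 1 pA) (mx_pow1 pA). Qed.
Lemma mx_pow_inv n p (A : 'M[C]_n) : posdef A -> mx_pow p (invmx A) = mx_pow (- p) A.
Proof.
move=> pA; have <- : mx_pow (- 1) A = invmx A by rewrite -(mx_powV 1 pA) (mx_pow1 pA).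
by rewrite (mx_powM _ _ pA) mulN1r.
Qed.

Lemma mx_sqrt_sq n (A : 'M[C]_n) : posdef A -> mx_pow 2^-1 A *m mx_pow 2^-1 A = A.
Proof.
move=> pA; rewrite -mx_powD// -[2^-1]div1r -splitr mx_pow1//.
Qed.

(** Cyclicity turns the trace into that of [P] compressed by the square root of [Q]. *)
Lemma psd_trace n (P Q : 'M[C]_n) : psd P -> posdef Q -> 0 <= rtr (P *m Q).
Proof.
move=> pP pQ; rewrite -[Q]mx_sqrt_sq// mulmxA rtrC mulmxA.
rewrite -{1}(posdef_herm (mx_pow_posdef 2^-1 pQ)).
exact: psd_qf.
Qed.

Lemma psd_perturb n (A : 'M[C]_n) : psd A <-> forall e : R, 0 < e -> posdef (A + (e%:C)%:M).
Proof.
split=> [pA e e0|h]; first by rewrite addrC; apply: posdefD => //; apply: posdef_scalar.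
split.
  have /posdef_herm := h 1 ltr01; rewrite adjD adj_scalar conjc_real.
  by move/addIr.
move=> x; have [->|x0] := eqVneq x 0; first by rewrite qf0.
rewrite leNgt; apply/negP => lt0; have fx := fn_gt0 x0.
(* The shift for which the perturbed form vanishes at [x]. *)
have e0 : 0 < - qf A x / fn x by rewrite divr_gt0// oppr_gt0.
have /posdefP[_ /(_ x x0)] := h _ e0.
by rewrite qfD -scalemx1 qfZ qf1 divfK ?gt_eqF// subrr ltxx.
Qed.

Lemma psd_trace2 n (P Q : 'M[C]_n) : psd P -> psd Q -> 0 <= rtr (P *m Q).
Proof.
move=> pP pQ; have p1 : 0 <= rtr P.
  by rewrite -[P]mulmx1; apply: psd_trace => //; apply: posdef1.
rewrite leNgt; apply/negP => lt0.
(* Shifting [Q] by this amount changes the trace [a] into [a / (b + 1)], still negative, where [b]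
   is the trace of [P]. *)
have e0 : 0 < - rtr (P *m Q) / (rtr P + 1) by rewrite divr_gt0 ?oppr_gt0// ltr_wpDl.
have := psd_trace pP ((psd_perturb Q).1 pQ _ e0).
rewrite mulmxDr rtrD mul_mx_scalar rtrZ; set a := rtr (P *m Q) in lt0 *.
set b := rtr P in p1 *; apply/negP; rewrite -ltNge.
have b1 : 0 < b + 1 by rewrite ltr_wpDl.
have -> : a + - a / (b + 1) * b = a / (b + 1) by field; rewrite gt_eqF.
by rewrite pmulr_llt0 ?invr_gt0.
Qed.
End Calculus.

Opaque rtr.

(** * Frobenius norm estimates, accretive matrices and the Sylvester equation *)

Section Accretive.
Variable R : realType.
Local Notation C := R[i].
Implicit Types (m n k : nat).

Lemma fnZ m n (a : R) (M : 'M[C]_(m, n)) : fn (a%:C *: M) = a ^+ 2 * fn M.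
Proof.
by rewrite /fn adjZ conjc_real -scalemxAl -scalemxAr !rtrZ mulrA expr2.
Qed.
Lemma fnN m n (M : 'M[C]_(m, n)) : fn (- M) = fn M.
Proof. by rewrite /fn adjN mulNmx mulmxN opprK. Qed.
Lemma fnJ m n (M : 'M[C]_(m, n)) : fn (adj M) = fn M.
Proof. by rewrite /fn adjK rtrC. Qed.
Lemma fnB_exp m n (A B : 'M[C]_(m, n)) :
  fn (A - B) = fn A - 2 * rtr (adj A *m B) + fn B.
Proof.
have e : rtr (adj B *m A) = rtr (adj A *m B) by rewrite -rtrJ adjM adjK.
have -> : fn (A - B) = rtr ((adj A *m A - adj A *m B) - (adj B *m A - adj B *m B)).
  by rewrite /fn (adjB A B) mulmxBl (mulmxBr (adj A)) (mulmxBr (adj B)).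
rewrite (rtrB (adj A *m A - adj A *m B)) (rtrB (adj A *m A)) (rtrB (adj B *m A)) e /fn.
by move: (rtr (adj A *m A)) (rtr (adj A *m B)) (rtr (adj B *m B)) => a b c; ring.
Qed.
Lemma fnD_exp m n (A B : 'M[C]_(m, n)) :
  fn (A + B) = fn A + 2 * rtr (adj A *m B) + fn B.
Proof. by have := fnB_exp A (- B); rewrite opprK fnN mulmxN rtrN mulrN opprK. Qed.
Lemma fnD_le m n (A B : 'M[C]_(m, n)) : fn (A + B) <= 2 * (fn A + fn B).
Proof.
have := fn_ge0 (A - B); rewrite fnB_exp fnD_exp.
by move: (fn A) (fn B) (rtr _) => a b c; lra.
Qed.

(** Expansion of [fn (t A - B) >= 0]; it serves in place of the Cauchy-Schwarz inequality. *)
Lemma young_rtr m n (t : R) (A B : 'M[C]_(m, n)) : 0 < t ->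
  rtr (adj A *m B) <= 2^-1 * (t * fn A + fn B / t).
Proof.
move=> t0; have := fn_ge0 (t%:C *: A - B).
rewrite fnB_exp fnZ adjZ conjc_real -scalemxAl rtrZ => h.
have t0' := lt0r_neq0 t0.
rewrite -(ler_pM2l t0) -subr_ge0.
move: (fn A) (fn B) (rtr _) h => a b c h.
have -> : t * (2^-1 * (t * a + b / t)) - t * c =
  2^-1 * (t ^+ 2 * a - 2 * (t * c) + b) by field.
by rewrite mulr_ge0// invr_ge0.
Qed.

Lemma psd_gram m n (A : 'M[C]_(m, n)) : psd (adj A *m A).
Proof.
by rewrite -[X in X *m A]mulmx1; apply/psd_congr/posdef_psd/posdef1.
Qed.

Lemma psd_spectral n (A : 'M[C]_n) : psd A -> exists U, exists d : 'rV[R]_n,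
  [/\ U *m adj U = 1%:M, adj U *m U = 1%:M, A = U *m rdiag d *m adj U & forall i, 0 <= d 0 i].
Proof.
move=> pA; have [U [d [UU e]]] := spectral_exists (psd_herm pA).
have UU' := mulmx1C UU; exists U, d; split=> // i.
have := pA.2 (U *m delta_mx i 0); rewrite -qfM.
have -> : adj U *m A *m U = rdiag d.
  by rewrite e !mulmxA UU' mul1mx -mulmxA UU' mulmx1.
rewrite qf_rdiag (bigD1 i)//= big1 => [|j /negPf ji].
  by rewrite !mxE !eqxx /= expr1n expr0n /= !addr0 mulr1.
by rewrite !mxE ji /= expr0n /= addr0 mulr0.
Qed.

Lemma psd_conj n (U : 'M[C]_n) (d : 'rV[R]_n) : (forall i, 0 <= d 0 i) ->
  psd (U *m rdiag d *m adj U).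
Proof.
move=> d0; rewrite -{1}[U]adjK; apply: psd_congr; split; first exact: adj_rdiag.
by move=> x; rewrite qf_rdiag sumr_ge0// => i _; rewrite mulr_ge0// addr_ge0// sqr_ge0.
Qed.

Lemma conj_rdiagB n (U : 'M[C]_n) (d e : 'rV[R]_n) :
  U *m rdiag d *m adj U - U *m rdiag e *m adj U = U *m rdiag (d - e) *m adj U.
Proof.
rewrite -mulmxBl -mulmxBr; congr (_ *m _ *m _).
by apply/matrixP => i j; rewrite [LHS]mxE [X in _ + X]mxE !rdiagE !mxE -mulrnBl -rmorphB.
Qed.

Lemma conj_rdiag_const n (U : 'M[C]_n) (c : R) : U *m adj U = 1%:M ->
  U *m rdiag (const_mx c) *m adj U = (c%:C)%:M.
Proof. by move=> UU; rewrite rdiag_const scalar_mxC -mulmxA UU mulmx1. Qed.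

Lemma psd_le_trace n (P : 'M[C]_n) : psd P -> psd (((rtr P)%:C)%:M - P).
Proof.
move=> /psd_spectral[U [d [UU UU' -> d0]]].
have -> : rtr (U *m rdiag d *m adj U) = \sum_i d 0 i.
  by rewrite rtrC mulmxA UU' mul1mx rtr_rdiag.
rewrite -(conj_rdiag_const _ UU) conj_rdiagB; apply: psd_conj => i.
by rewrite !mxE subr_ge0 (bigD1 i)//= lerDl sumr_ge0.
Qed.

(** The Gram matrix of [A] is at most its trace times the identity. *)
Lemma fnM_le m n k (A : 'M[C]_(m, n)) (B : 'M[C]_(n, k)) : fn (A *m B) <= fn A * fn B.
Proof.
have -> : fn (A *m B) = qf (adj A *m A) B by rewrite /fn /qf adjM !mulmxA.
have := psd_qf B (psd_le_trace (psd_gram A)).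
by rewrite qfB -scalemx1 qfZ qf1 subr_ge0.
Qed.

Lemma posdef_lb n (P : 'M[C]_n) : posdef P ->
  exists2 d : R, 0 < d & psd (P - (d%:C)%:M).
Proof.
move=> /posdef_spectral[U [d [UU UU' -> d0]]].
have s0 : 0 < 1 + \sum_i (d 0 i)^-1.
  by rewrite ltr_wpDr// sumr_ge0// => i _; rewrite invr_ge0 ltW.
(* This number is below every eigenvalue, and positive also when [n = 0]. *)
exists (1 + \sum_i (d 0 i)^-1)^-1; first by rewrite invr_gt0.
rewrite -(conj_rdiag_const _ UU) conj_rdiagB; apply: psd_conj => i.
rewrite !mxE subr_ge0 -[leRHS]invrK lef_pV2 ?posrE ?invr_gt0//.
rewrite (bigD1 i)//= addrCA lerDl addr_ge0// sumr_ge0// => j _.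
by rewrite invr_ge0 ltW.
Qed.

Lemma lb_posdef n (P : 'M[C]_n) (d : R) : 0 < d -> psd (P - (d%:C)%:M) -> posdef P.
Proof.
by move=> d0 h; rewrite -[P](subrK (d%:C)%:M) addrC; apply: posdefD h; apply: posdef_scalar.
Qed.

(** Twice the Hermitian part. [acc] below is strict accretivity: the numerical range lies in the
    open right half plane. *)
Definition hrm n (X : 'M[C]_n) := X + adj X.
Definition acc n (X : 'M[C]_n) := posdef (hrm X).

Lemma hrmE n (X : 'M[C]_n) : hrm X = X + adj X. Proof. by []. Qed.
Lemma hrm_herm n (X : 'M[C]_n) : adj (hrm X) = hrm X.
Proof. by rewrite /hrm adjD adjK addrC. Qed.
Lemma hrmD n (X Y : 'M[C]_n) : hrm (X + Y) = hrm X + hrm Y.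
Proof. by rewrite /hrm adjD addrACA. Qed.
Lemma hrmZ n (a : R) (X : 'M[C]_n) : hrm (a%:C *: X) = a%:C *: hrm X.
Proof. by rewrite /hrm adjZ conjc_real scalerDr. Qed.
Lemma hrm_congr m n (X : 'M[C]_m) (K : 'M[C]_(m, n)) :
  hrm (adj K *m X *m K) = adj K *m hrm X *m K.
Proof. by rewrite /hrm !adjM adjK mulmxDr mulmxDl mulmxA. Qed.
Lemma qf_hrm m n (X : 'M[C]_m) (K : 'M[C]_(m, n)) : qf (hrm X) K = 2 * qf X K.
Proof. by rewrite /hrm qfD qfJ; ring. Qed.
Lemma posdef_acc n (A : 'M[C]_n) : posdef A -> acc A.
Proof.
by move=> pA; rewrite /acc /hrm (posdef_herm pA); apply: posdefD => //; apply: posdef_psd.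
Qed.

Lemma acc_unit n (X : 'M[C]_n) : acc X -> X \in unitmx.
Proof.
move=> /posdefP[_ a]; rewrite -row_free_unit -kermx_eq0; apply/eqP/row_matrixP => i.
rewrite row0; set r := row i _.
have rA : r *m X = 0 by apply/sub_kermxP/row_sub.
apply/eqP; apply: contraT => r0.
have ar0 : adj r != 0 by apply: contra r0 => /eqP h; rewrite -[r]adjK h adj0.
by have := a _ ar0; rewrite qf_hrm /qf adjK rA mul0mx rtr0 mulr0 ltxx.
Qed.

(* Lyapunov: an eigenvector of G with eigenvalue mu turns the form of G W + W^* G
   into mu times that of W + W^*. *)
Lemma lyapunov n (G W : 'M[C]_n) : adj G = G -> acc W -> posdef (G *m W + adj W *m G) ->
  posdef G.
Proof.
move=> hG /posdefP[_ aW] /posdefP[_ aG].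
have [U [d [UU e]]] := spectral_exists hG; have UU' := mulmx1C UU.
rewrite e; apply: posdef_conj => // i; set x := U *m (delta_mx i 0 : 'cV[C]_n).
have x0 : x != 0.
  apply/eqP => h; have : adj U *m x = 0 by rewrite h mulmx0.
  rewrite /x mulmxA UU' mul1mx => /matrixP/(_ i 0); rewrite !mxE !eqxx => /eqP.
  by rewrite oner_eq0.
have Gx : G *m x = (d 0 i)%:C *: x.
  rewrite e /x -!mulmxA [adj U *m _]mulmxA UU' mul1mx scalemxAr; congr (_ *m _).
  exact: rdiag_delta.
have xG : adj x *m G = (d 0 i)%:C *: adj x.
  by rewrite -[adj x *m G]adjK adjM adjK hG Gx adjZ conjc_real.
move: (x) x0 Gx xG => {}x x0 Gx xG.
have := aG _ x0; rewrite qfD {1 2}/qf mulmxA xG -!scalemxAl rtrZ.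
rewrite -!mulmxA Gx -!scalemxAr rtrZ !mulmxA.
rewrite -[rtr (adj x *m W *m x)]/(qf W x) -[rtr (adj x *m adj W *m x)]/(qf (adj W) x).
rewrite -mulrDr -qfD => h; have h2 := aW _ x0.
by move: h; rewrite pmulr_lgt0.
Qed.

(** Pair the equation with [Y]: the [S] term is nonnegative and the [T] term at least
    [(d / 2) fn Y]. Young's inequality with [t = d / 2] absorbs half of the latter. *)
Lemma sylvester_bound m n (S : 'M[C]_m) (T : 'M[C]_n) (Y E : 'M[C]_(m, n)) (d : R) :
  0 < d -> psd (hrm S) -> psd (hrm T - (d%:C)%:M) -> S *m Y + Y *m T = E ->
  fn Y <= fn E * (4 / d ^+ 2).
Proof.
move=> d0 pS pT e.
have h1 : 0 <= rtr (adj Y *m S *m Y) by have := psd_qf Y pS; rewrite qf_hrm pmulr_rge0.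
have h2 : d * fn Y <= 2 * rtr (adj Y *m Y *m T).
  have := psd_qf (adj Y) pT; rewrite qfB -scalemx1 qfZ qf1 fnJ subr_ge0 qf_hrm.
  by rewrite /qf adjK rtrC mulmxA.
have h3 : rtr (adj Y *m E) = rtr (adj Y *m S *m Y) + rtr (adj Y *m Y *m T).
  by rewrite -e mulmxDr rtrD !mulmxA.
have d2 : 0 < d / 2 by rewrite divr_gt0.
have := young_rtr Y E d2; rewrite h3 => h4.
have d0' := lt0r_neq0 d0.
have h5 : d / 4 * fn Y <= fn E / d.
  move: (fn Y) (fn E) (rtr _) (rtr _) h1 h2 h4 {h3} => y c a b h1 h2 h4.
  have : 2^-1 * (d / 2 * y + c / (d / 2)) = d / 4 * y + c / d by field.
  lra.
rewrite -(ler_pM2l (_ : 0 < d / 4)) ?divr_gt0//.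
suff -> : d / 4 * (fn E * (4 / d ^+ 2)) = fn E / d by [].
by field.
Qed.

Lemma sylvester_inj m n (S : 'M[C]_m) (T : 'M[C]_n) (Y : 'M[C]_(m, n)) :
  psd (hrm S) -> acc T -> S *m Y + Y *m T = 0 -> Y = 0.
Proof.
move=> pS /posdef_lb[d d0 pT] e; apply: fn_eq0; apply/eqP; rewrite eq_le fn_ge0 andbT.
by have := sylvester_bound d0 pS pT e; rewrite {2}/fn mulmx0 rtr0 mul0r.
Qed.

(** By [sylvester_inj] the operator is injective on a finite-dimensional space, hence onto. *)
Lemma sylvester_solve m n (S : 'M[C]_m) (T : 'M[C]_n) (E : 'M[C]_(m, n)) :
  psd (hrm S) -> acc T -> exists Y, S *m Y + Y *m T = E.
Proof.
move=> pS aT; pose g := fun Y : 'M[C]_(m, n) => S *m Y + Y *m T.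
have gl : linear g.
  move=> a x y; rewrite /g mulmxDr mulmxDl -scalemxAr -scalemxAl scalerDr.
  by rewrite addrACA.
pose gL := GRing.isLinear.Build _ _ _ _ g gl.
pose gg : {linear 'M[C]_(m, n) -> 'M[C]_(m, n)} := HB.pack g gL.
pose h := linfun gg.
have hk : lker h == 0%VS.
  by apply/lker0P => x y; rewrite !lfunE /= => /eqP; rewrite -subr_eq0 => /eqP exy;
    apply/eqP; rewrite -subr_eq0; apply/eqP; apply: sylvester_inj pS aT _;
    rewrite mulmxBr mulmxBl addrACA -opprD.
exists ((h^-1)%VF E); rewrite -[LHS]/(gg _) -(lfunE gg).
by rewrite -[X in X = _]/(h _) lker0_lfunVK.
Qed.
End Accretive.

(** * Square roots of accretive matrices *)

Section Root.
Variable R : realType.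
Local Notation C := R[i].
Implicit Types (m n k : nat).

(** The difference of two roots satisfies [S (S - T) + (S - T) T = S^2 - T^2 = 0], a homogeneous
    Sylvester equation. *)
Lemma acc_root_unique n (S T : 'M[C]_n) : acc S -> acc T -> S *m S = T *m T -> S = T.
Proof.
move=> aS aT e; apply/eqP; rewrite -subr_eq0; apply/eqP.
apply: sylvester_inj (posdef_psd aS) aT _.
by rewrite mulmxBr mulmxBl e addrA subrK subrr.
Qed.

(** The two values 1 and -1 of [s] together confine the numerical range of a root to the sector of
    half-angle pi/4. For [H = hrm S] and [G = hrm (c S)] one has [G H + H G = 2 hrm (S^2) + G^2],
    which is positive definite, so [lyapunov] gives [G > 0]. *)
Lemma acc_root_sector n (S : 'M[C]_n) (s : R) : s ^+ 2 = 1 -> acc S -> acc (S *m S) ->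
  acc ((1 +i* s) *: S).
Proof.
move=> s2 aS aX; set c := 1 +i* s.
have hH := hrm_herm S; apply: (@lyapunov _ _ _ (hrm S)); first exact: hrm_herm.
  exact: (posdef_acc aS).
rewrite hH; set G := hrm (c *: S).
have hG : adj G = G by exact: hrm_herm.
suff -> : G *m hrm S + hrm S *m G = (2%:C) *: hrm (S *m S) + adj G *m G.
  by apply: posdefD; [apply: posdefZ | apply: psd_gram].
rewrite hG /G /hrm adjZ adjM; set T := adj S; set c' := conjc c.
have cc : c * c' = 2%:C.
  by rewrite /c /c' /=; apply/eqP; rewrite eq_complex /=; apply/andP; split; apply/eqP;
    [transitivity (1 + s ^+ 2); [ring | rewrite s2; ring] | ring].
have e1 : c + c' = 2%:C.
  by rewrite /c /c' /=; apply/eqP; rewrite eq_complex /=; apply/andP; split; apply/eqP; ring.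
have c2 : c * c = c *+ 2 - 2%:C.
  rewrite mulr2n /c; apply/eqP; rewrite eq_complex /=; apply/andP; split; apply/eqP; last by ring.
  by transitivity (1 - s ^+ 2); [ring | rewrite s2; ring].
have c2' : c' * c' = c' *+ 2 - 2%:C.
  rewrite mulr2n /c' /c; apply/eqP; rewrite eq_complex /=; apply/andP; split; apply/eqP; last by ring.
  by transitivity (1 - s ^+ 2); [ring | rewrite s2; ring].
have cc' : c' * c = 2%:C by rewrite mulrC.
rewrite !mulmxDl !mulmxDr -!scalemxAl -!scalemxAr !scalerA cc cc' c2 c2'.
rewrite -!e1; clear; move: (S *m S) (S *m T) (T *m S) (T *m T) c' => x1 x2 x3 x4 c'.
by apply/matrixP => i j; rewrite !mxE; ring.
Qed.

Lemma geometric_cvg (u : nat -> R) (s c : R) : 0 <= s < 1 ->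
  (forall k, (u k.+1 - u k) ^+ 2 <= s ^+ k * c) -> exists l : R, (u n @[n --> \oo] --> l)%classic.
Proof.
move=> /andP[s0 s1] h; pose q : R := Num.sqrt s.
have q0 : 0 <= q by exact: sqrtr_ge0.
have q1 : `|q| < 1.
  by rewrite ger0_norm ?sqrtr_ge0// /q -sqrtr1 ltr_sqrt.
have c0 : 0 <= c by have := le_trans (sqr_ge0 _) (h 0%N); rewrite expr0 mul1r.
have hu k : `|telescope u k| <= geometric (Num.sqrt c) q k.
  have qk : 0 <= q ^+ k by apply: exprn_ge0.
  have sc : 0 <= Num.sqrt c * q ^+ k by rewrite mulr_ge0// sqrtr_ge0.
  rewrite -ler_sqr ?nnegrE// real_normK ?num_real// exprMn sqr_sqrtr//.
  by rewrite -exprM mulnC exprM sqr_sqrtr// mulrC; exact: h.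
have : cvgn (series (telescope u)).
  apply: normed_cvg; apply: (series_le_cvg _ _ hu) => [k|k|].
  - exact: normr_ge0.
  - by rewrite mulr_ge0 ?exprn_ge0 ?sqrtr_ge0//.
  - exact: is_cvg_geometric_series.
move=> /cvg_ex[l hl]; exists (u 0%N + l).
have -> : u = fun n => u 0%N + series (telescope u) n.
  by apply/funext => k; exact: eq_sum_telescope.
rewrite /= in hl *; apply: cvgD; last exact: hl.
by rewrite /telescope /series /= big_nil addr0; exact: cvg_cst.
Qed.

Lemma mx_geometric_lim m n (Y : nat -> 'M[C]_(m, n)) (s c : R) : 0 <= s < 1 ->
  (forall k, fn (Y k.+1 - Y k) <= s ^+ k * c) ->
  exists L, forall e : R, 0 < e -> exists N, forall k, (N <= k)%N -> fn (Y k - L) <= e.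
Proof.
move=> hs h.
have entry k i j : complex.Re ((Y k.+1 - Y k) i j) ^+ 2 + complex.Im ((Y k.+1 - Y k) i j) ^+ 2
    <= s ^+ k * c.
  apply: le_trans (h k); rewrite fnE (bigD1 j)//= (bigD1 i)//= -addrA lerDl.
  by rewrite addr_ge0//; repeat (apply: sumr_ge0 => ? _); rewrite addr_ge0 ?sqr_ge0.
have cre i j : exists l : R, ((complex.Re (Y k i j)) @[k --> \oo] --> l)%classic.
  apply: (geometric_cvg hs (c := c)) => k; have := entry k i j.
  by rewrite !mxE ReD ReN; apply: le_trans; rewrite lerDl sqr_ge0.
have cim i j : exists l : R, ((complex.Im (Y k i j)) @[k --> \oo] --> l)%classic.
  apply: (geometric_cvg hs (c := c)) => k; have := entry k i j.
  have ImN (z : C) : complex.Im (- z) = - complex.Im z by case: z.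
  by rewrite !mxE ImD ImN; apply: le_trans; rewrite lerDr sqr_ge0.
pose lre i j := projT1 (cid (cre i j)); pose lim i j := projT1 (cid (cim i j)).
exists (\matrix_(i, j) (lre i j +i* lim i j)) => e e0.
(* Each of the [m n] entries contributes at most [2 d]; the successor keeps the denominator nonzero
   for empty matrices. *)
pose d : R := e / ((m * n).+1%:R * 2).
have d0 : 0 < d by rewrite divr_gt0// mulr_gt0.
have hre i j := projT2 (cid (cre i j)); have him i j := projT2 (cid (cim i j)).
have q0 : 0 < Num.sqrt d by rewrite sqrtr_gt0.
have near : \forall k \near \oo, forall ij : 'I_m * 'I_n,
    `|lre ij.1 ij.2 - complex.Re (Y k ij.1 ij.2)| <= Num.sqrt d /\
    `|lim ij.1 ij.2 - complex.Im (Y k ij.1 ij.2)| <= Num.sqrt d.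
  apply: filter_forall => -[i j]; near=> k; split.
    by near: k; move/cvgrPdist_le: (hre i j) => /(_ _ q0).
  by near: k; move/cvgrPdist_le: (him i j) => /(_ _ q0).
case: near => N _ hN; exists N => k /hN /= hk; rewrite fnE.
have : \sum_j \sum_i (complex.Re ((Y k - \matrix_(i, j) (lre i j +i* lim i j)) i j) ^+ 2 +
     complex.Im ((Y k - \matrix_(i, j) (lre i j +i* lim i j)) i j) ^+ 2) <=
    \sum_(j < n) \sum_(i < m) (d + d).
  apply: ler_sum => j _; apply: ler_sum => i _; rewrite !mxE ReD ReN ImD /=.
  have [/= h1 h2] := hk (i, j).
  have sq (a b : R) : `|b - a| <= Num.sqrt d -> (a - b) ^+ 2 <= d.
    rewrite distrC => hab; have -> : d = Num.sqrt d ^+ 2 by rewrite sqr_sqrtr ?(ltW d0).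
    by rewrite -[leLHS]real_normK ?num_real// ler_sqr ?nnegrE ?sqrtr_ge0.
  by move: (sq _ _ h1) (sq _ _ h2); apply: lerD.
move/le_trans; apply; rewrite sumr_const sumr_const !card_ord -!mulrnA /d.
set K := (m * n)%N; have -> : e / (K.+1%:R * 2) + e / (K.+1%:R * 2) = e / K.+1%:R.
  have K1 : K.+1%:R != 0 :> R by rewrite pnatr_eq0.
  by move: (K.+1%:R : R) K1 => y y0; field.
by rewrite -[_ *+ K]mulr_natr mulrAC ler_pdivrMr// ler_pM2l// ler_nat.
Unshelve. all: by end_near.
Qed.

(** [s] bounds the squared operator norm: in this norm [1 - a X] is a contraction for accretive [X]
    and small [a], in the Frobenius norm it need not be. *)
Definition opb n (s : R) (M : 'M[C]_n) := forall k (x : 'M[C]_(n, k)), fn (M *m x) <= s * fn x.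

Lemma opb_mul n (s t : R) (M N : 'M[C]_n) : 0 <= s -> opb s M -> opb t N -> opb (s * t) (M *m N).
Proof.
move=> s0 hM hN k x; rewrite -mulmxA; apply: le_trans (hM _ _) _.
by rewrite -mulrA ler_wpM2l.
Qed.

Lemma opb_half n (s t : R) (M N : 'M[C]_n) : opb s M -> opb t N ->
  opb (2^-1 * (s + t)) (2^-1%:C *: (M + N)).
Proof.
move=> hM hN k x; rewrite -scalemxAl fnZ mulmxDl.
have := fnD_le (M *m x) (N *m x); have := hM _ x; have := hN _ x.
move: (fn (M *m x)) (fn (N *m x)) (fn (_ + _)) (fn x) => a b c d; lra.
Qed.

Lemma opb_le n (s t : R) (M : 'M[C]_n) : s <= t -> opb s M -> opb t M.
Proof. by move=> st hM k x; apply: le_trans (hM _ _) _; rewrite ler_wpM2r ?fn_ge0. Qed.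

Lemma half_half (V : lmodType C) (x : V) : 2^-1%:C *: (x + x) = x.
Proof.
have h : 2^-1 + 2^-1 = 1 :> R by field.
by rewrite scalerDr -scalerDl -rmorphD h scale1r.
Qed.

(* [1 - Y] is the square root of [1 - F], with [Y] a fixed point of [Y |-> (F + Y^2) / 2]. *)
Lemma contraction_fixpoint n (F : 'M[C]_n) (s : R) : 0 <= s < 1 -> opb s F ->
  exists2 Y : 'M[C]_n, Y + Y = F + Y *m Y & acc (1%:M - Y).
Proof.
move=> s01 hF; have /andP[s0 s1] := s01.
pose Y := fix Y k := if k is k'.+1 then 2^-1%:C *: (F + Y k' *m Y k') else (0 : 'M[C]_n).
have YS k : Y k.+1 = 2^-1%:C *: (F + Y k *m Y k) by [].
have Yb k : opb s (Y k).
  elim: k => [|k ih] /=.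
    by move=> k x; rewrite /= mul0mx {1}/fn mulmx0 rtr0 mulr_ge0 ?fn_ge0.
  apply: opb_le (opb_half hF (opb_mul s0 ih ih)).
  have : s * s <= s by rewrite ler_piMr// ltW.
  by move: (s * s) => ss; lra.
have Db k : opb (s ^+ k) (Y k.+1 - Y k).
  elim: k => [|k ih].
    rewrite YS [Y 0%N]/= mul0mx addr0 subr0 expr0 => k x.
    rewrite -scalemxAl fnZ mul1r; have := hF _ x; have := fn_ge0 x.
    move: (fn _) (fn x) => a b b0 ab.
    have : s * b <= b by rewrite ler_piMl// ltW.
    lra.
  (* The difference of squares splits into two products of the last increment with an iterate of
     squared norm at most [s], hence the ratio [s]. *)
  have -> : Y k.+2 - Y k.+1 =
      2^-1%:C *: (Y k.+1 *m (Y k.+1 - Y k) + (Y k.+1 - Y k) *m Y k).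
    rewrite (YS k.+1) {2}(YS k) -scalerBr mulmxBr mulmxBl addrA subrK.
    by congr (_ *: _); rewrite opprD addrACA subrr add0r.
  have := opb_half (opb_mul s0 (Yb k.+1) ih) (opb_mul (exprn_ge0 k s0) ih (Yb k)).
  by apply: opb_le; rewrite exprS mulrC -mulrC; lra.
have [L hL] : exists L, forall e : R, 0 < e -> exists N, forall k, (N <= k)%N -> fn (Y k - L) <= e.
  apply: (mx_geometric_lim s01 (c := fn (1%:M : 'M[C]_n))) => k.
  by rewrite -[Y k.+1 - Y k]mulmx1; exact: Db.
exists L.
  apply/eqP; rewrite -subr_eq0; apply/eqP/fn_eq0; apply/eqP; rewrite eq_le fn_ge0 andbT.
  set D := _ - _; apply/ler_addgt0Pr => e e0; rewrite add0r.
  (* The constants come from three uses of [fnD_le], with [fn L] and 1 bounding the squared norms of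
     the factors [L] and [Y N]. *)
  pose K := 12 + 4 * fn L; have K0 : 0 < K by have := fn_ge0 L; rewrite /K; lra.
  have [N hN] := hL (e / K) (divr_gt0 e0 K0).
  have h1 := hN N (leqnn N); have h2 := hN N.+1 (leqnSn N).
  have YF : F = Y N.+1 + Y N.+1 - Y N *m Y N by rewrite YS -scalerDr half_half addrK.
  have -> : D = (L - Y N.+1) + (L - Y N.+1) - ((L - Y N) *m L + Y N *m (L - Y N)).
    rewrite /D YF mulmxBl mulmxBr; move: (Y N.+1) (Y N *m Y N) (L *m L) (Y N *m L) => a b c d.
    by apply/matrixP => i j; rewrite !mxE; ring.
  have h3 : fn (L - Y N.+1) <= e / K by rewrite -fnN opprB; exact: h2.
  have h4 : fn (L - Y N) <= e / K by rewrite -fnN opprB; exact: h1.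
  have := fnD_le (L - Y N.+1 + (L - Y N.+1)) (- ((L - Y N) *m L + Y N *m (L - Y N))).
  rewrite fnN; have := fnD_le (L - Y N.+1) (L - Y N.+1).
  have := fnD_le ((L - Y N) *m L) (Y N *m (L - Y N)).
  have := fnM_le (L - Y N) L; have := Yb N _ (L - Y N).
  have h5 : fn (L - Y N) * fn L <= e / K * fn L by rewrite ler_wpM2r ?fn_ge0.
  have h6 : s * fn (L - Y N) <= e / K.
    by apply: le_trans h4; rewrite ler_piMl ?fn_ge0// ltW.
  have -> : e = 12 * (e / K) + 4 * (e / K * fn L).
    by rewrite -[e in LHS](divfK (lt0r_neq0 K0)) {2}/K; ring.
  move: h3 h4 h5 h6; clear.
  move: (fn (_ *m L)) (fn (Y N *m _)) (fn (L - Y N)) (fn (L - Y N.+1)).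
  move: (fn (_ + _)) (fn (_ + _)) (fn (_ - _)) (e / K) (fn L) => a1 a2 a3 a4 a5 a6 a7 a8 a9.
  move: (a4 * a5) (s * a8) (a8 * a5) => b1 b2 b3 *.
  lra.
apply/posdefP; split; first exact: hrm_herm.
move=> x x0; have fx := fn_gt0 x0.
(* Since [s = 1 - 4 t], Young's inequality bounds the form of [Y N] by [(1 - 2 t) fn x] and that of
   [L - Y N] by [t fn x], so the form of [1 - L] is at least [t fn x]. *)
pose t : R := (1 - s) / 4; have t0 : 0 < t by rewrite divr_gt0// subr_gt0.
have [N hN] := hL (t ^+ 2) (exprn_gt0 2 t0); have h1 := hN N (leqnn N).
rewrite qf_hrm qfB qf1.
have -> : qf L x = rtr (adj x *m (Y N *m x)) + rtr (adj x *m ((L - Y N) *m x)).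
  by rewrite -rtrD -mulmxDr mulmxBl addrCA subrr addr0 /qf mulmxA.
have hA := young_rtr x (Y N *m x) ltr01; have hB := young_rtr x ((L - Y N) *m x) t0.
have hC := Yb N _ x.
have hD : fn ((L - Y N) *m x) / t <= t * fn x.
  rewrite ler_pdivrMr// mulrAC -expr2; apply: le_trans (fnM_le _ _) _.
  apply: ler_wpM2r; first exact: fn_ge0.
  by rewrite -fnN opprB; exact: h1.
have st : s = 1 - 4 * t by rewrite /t; field.
have tf : 0 < t * fn x by rewrite mulr_gt0.
rewrite st mulrBl mul1r -mulrA in hC; rewrite divr1 mul1r in hA.
move: hA hB hC hD tf; clear.
move: (rtr _) (rtr _) (fn (_ *m x)) (fn (_ *m x) / t) (t * fn x) (fn x).
by move=> a b c d g f *; lra.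
Qed.

(** For small [a > 0] accretivity makes [F = 1 - a X] a contraction:
    [fn (F x) <= (1 - a d + a^2 N) fn x], and [a = d / (2 N)] minimizes the factor. The root of
    [a X = 1 - F] is then rescaled. *)
Lemma acc_root_exists n (X : 'M[C]_n) : acc X -> exists2 S, acc S & S *m S = X.
Proof.
move=> aX; have [d d0 hd] := posdef_lb aX.
pose N := fn X + 1; have N0 : 0 < N by rewrite ltr_wpDl ?fn_ge0.
pose a := d / (2 * N); have a0 : 0 < a by rewrite divr_gt0// mulr_gt0.
pose s := Num.max 0 (1 - d * a / 2).
have s01 : 0 <= s < 1.
  rewrite le_max lexx /= gt_max ltr01 /=.
  by rewrite ltrBlDr ltrDl divr_gt0// mulr_gt0.
have hF : opb s (1%:M - a%:C *: X).
  move=> k x; apply: (@le_trans _ _ ((1 - d * a / 2) * fn x)); last first.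
    by rewrite ler_wpM2r ?fn_ge0// le_max lexx orbT.
  rewrite mulmxBl mul1mx -scalemxAl fnB_exp -scalemxAr rtrZ fnZ.
  have h1 := fnM_le X x; have := psd_qf x hd.
  rewrite qfB -scalemx1 qfZ qf1 qf_hrm /qf -mulmxA => h2.
  have h3 : a ^+ 2 * fn (X *m x) <= a ^+ 2 * (N * fn x).
    rewrite ler_wpM2l ?sqr_ge0//; apply: le_trans h1 _; rewrite ler_wpM2r ?fn_ge0//.
    by rewrite /N lerDl ler01.
  have h4 : a ^+ 2 * (N * fn x) = d * a / 2 * fn x.
    by rewrite {1}/a; have := lt0r_neq0 N0; rewrite /a => ?; field.
  have h5 : a * (d * fn x) <= a * (2 * rtr (adj x *m (X *m x))).
    by rewrite ler_pM2l// -subr_ge0.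
  rewrite h4 in h3; move: h3 h5; clear; clearbody a.
  move: (fn x) (rtr _) (a ^+ 2 * fn _) => f r g h3 h5.
  have -> : (1 - d * a / 2) * f = f - d * a / 2 * f by ring.
  have e1 : a * (2 * r) = 2 * (a * r) by ring.
  have e2 : a * (d * f) = 2 * (d * a / 2 * f) by field.
  move: h3 h5; rewrite e1 e2; move: (d * a / 2 * f) (a * r) => z y; lra.
have [Y eY aY] := contraction_fixpoint s01 hF.
have e : (1%:M - Y) *m (1%:M - Y) = a%:C *: X.
  rewrite mulmxBl !mulmxBr !mul1mx !mulmx1.
  have -> : a%:C *: X = 1%:M - (1%:M - a%:C *: X) by rewrite subKr.
  have -> : 1%:M - a%:C *: X = Y + Y - Y *m Y by rewrite eY addrK.
  by rewrite -addrA -opprD; congr (_ - _); rewrite addrA.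
have q0 : 0 < Num.sqrt a^-1 by rewrite sqrtr_gt0 invr_gt0.
exists ((Num.sqrt a^-1)%:C *: (1%:M - Y)).
  by rewrite /acc hrmZ; apply: posdefZ.
rewrite -scalemxAl -scalemxAr e !scalerA -!rmorphM /= -mulrA [_ * a]mulrC mulrCA -expr2.
by rewrite sqr_sqrtr ?invr_ge0 ?ltW// mulfV ?gt_eqF// scale1r.
Qed.
End Root.

Opaque hrm addmx oppmx scalemx map_mx trmx scalar_mx diag_mx.

(** * Iterated square roots: homogeneity and sectors *)

Section DyadicRoots.
Variable R : realType.
Local Notation C := R[i].
Implicit Types (m n k : nat).

Lemma posdef_comb n (a b : R) (P Q : 'M[C]_n) : 0 <= a -> 0 <= b -> 0 < a + b ->
  posdef P -> posdef Q -> posdef (a%:C *: P + b%:C *: Q).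
Proof.
move=> a0 b0 ab pP pQ; have [a1|a1] := ltP 0 a.
  by apply: posdefD; [apply: posdefZ | apply: psdZ => //; apply: posdef_psd].
rewrite addrC; apply: posdefD; first by apply: posdefZ => //; lra.
by apply: psdZ => //; apply: posdef_psd.
Qed.

Lemma complex_split (a b : R) : a +i* b = a%:C + b%:C * 'i.
Proof. by simpc. Qed.

(** For [b >= 0] write [a + i b = (a - b) + b (1 + i)], a combination with nonnegative coefficients;
    for [b < 0] use [1 - i] instead. *)
Lemma sector_scale n (S : 'M[C]_n) (a b : R) : acc S -> acc ((1 +i* 1) *: S) ->
  acc ((1 +i* (- 1)) *: S) -> `|b| <= a -> 0 < a -> acc ((a +i* b) *: S).
Proof.
move=> aS a1 a2 ba a0.
have e (x y : R) : hrm ((x +i* y) *: S) = x%:C *: hrm S + y%:C *: hrm ('i *: S).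
  by rewrite complex_split scalerDl hrmD hrmZ -scalerA hrmZ.
rewrite /acc in a1 a2 *; rewrite e !scale1r in a1; rewrite e scale1r in a2; rewrite e.
move: a1 a2 aS; rewrite /acc; move: (hrm S) (hrm ('i *: S)) => P Q a1 a2 aS.
have [b0|b0] := leP 0 b.
  have -> : a%:C *: P + b%:C *: Q = (a - b)%:C *: P + b%:C *: (P + Q).
    by apply/matrixP => i j; rewrite !mxE rmorphB; ring.
  rewrite (ger0_norm b0) in ba; have ab : 0 <= a - b by lra.
  have ab2 : 0 < a - b + b by lra.
  exact: posdef_comb ab b0 ab2 aS a1.
have -> : a%:C *: P + b%:C *: Q = (a + b)%:C *: P + (- b)%:C *: (P + (- 1)%:C *: Q).
  by apply/matrixP => i j; rewrite !mxE !rmorphN rmorphD rmorph1; ring.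
rewrite (ltr0_norm b0) in ba; have ab : 0 <= a + b by lra.
have nb : 0 <= - b by lra.
have ab2 : 0 < a + b + - b by lra.
exact: posdef_comb ab nb ab2 aS a2.
Qed.

Definition mx_root n (X : 'M[C]_n) : 'M[C]_n := xget 0 [set S | acc S /\ S *m S = X].

Lemma mx_root_eq n (X S : 'M[C]_n) : acc S -> S *m S = X -> mx_root X = S.
Proof.
move=> aS e; have [aT eT] : acc (mx_root X) /\ mx_root X *m mx_root X = X.
  by apply: (@xgetPex _ 0 [set S | acc S /\ S *m S = X]); exists S.
by apply: acc_root_unique => //; rewrite eT.
Qed.
Lemma mx_rootP n (X : 'M[C]_n) : acc X -> acc (mx_root X) /\ mx_root X *m mx_root X = X.
Proof. by move=> /acc_root_exists[S aS e]; rewrite (mx_root_eq aS e). Qed.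

Lemma mx_root_scale n (X : 'M[C]_n) (a b : R) : acc X -> `|b| <= a -> 0 < a ->
  acc ((a +i* b) *: mx_root X).
Proof.
move=> aX ba a0; have [aS e] := mx_rootP aX.
have aSS : acc (mx_root X *m mx_root X) by rewrite e.
have s1 : 1 ^+ 2 = 1 :> R by rewrite expr1n.
have s2 : (- 1) ^+ 2 = 1 :> R by rewrite sqrrN expr1n.
exact: sector_scale aS (acc_root_sector s1 aS aSS) (acc_root_sector s2 aS aSS) ba a0.
Qed.

(** The scalar root is read off from the root of a 1 by 1 matrix; the bound on its imaginary part is
    [mx_root_scale] for [1 + i] and [1 - i]. *)
Lemma complex_root (s : C) : 0 < complex.Re s ->
  exists2 z : C, z ^+ 2 = s & `|complex.Im z| <= complex.Re z /\ 0 < complex.Re z.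
Proof.
move=> s0; pose X : 'M[C]_1 := s%:M.
have accE (z : C) : acc (z%:M : 'M[C]_1) <-> 0 < complex.Re z.
  rewrite /acc hrmE adj_scalar -[z%:M]scalemx1 -[(conjc z)%:M]scalemx1 -scalerDl.
  have -> : z + conjc z = (2 * complex.Re z)%:C by apply/eqP; case: z => a b; rewrite eq_complex /=; apply/andP; split; apply/eqP; ring.
  split=> [/posdefP[_ /(_ 1%:M)]|z0]; last by apply: posdefZ (posdef1 _ _); rewrite mulr_gt0.
  rewrite qfZ qf1; have n0 : (1%:M : 'M[C]_1) != 0.
    by apply/eqP => /matrixP/(_ 0 0); rewrite !mxE /= => /eqP; rewrite oner_eq0.
  by move=> /(_ n0); rewrite pmulr_lgt0 ?fn_gt0// pmulr_rgt0.
have aX : acc X by apply/accE.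
have [aS e] := mx_rootP aX; set z := mx_root X 0 0.
have eS : mx_root X = z%:M by rewrite [LHS]mx11_scalar.
have h1 := mx_root_scale aX (_ : `|1| <= 1) ltr01; have h2 := mx_root_scale aX (_ : `|-1| <= 1) ltr01.
rewrite eS in e aS h1 h2; exists z.
  move: e; rewrite -scalar_mxM => /matrixP/(_ 0 0); rewrite !mxE /= !mulr1n expr2 //.
move/accE: aS => z0; split=> //.
have := h1; rewrite normr1 => /(_ (lexx _)); rewrite scale_scalar_mx => /accE.
have := h2; rewrite normrN normr1 => /(_ (lexx _)); rewrite scale_scalar_mx => /accE.
rewrite ler_norml; case: (z) => a b /=; lra.
Qed.

Definition dyroot n k (X : 'M[C]_n) := iter k (@mx_root n) X.

Lemma dyroot_acc n k (X : 'M[C]_n) : acc X -> acc (dyroot k X).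
Proof. by move=> aX; elim: k => [|k ih]; [exact: aX | exact: (mx_rootP ih).1]. Qed.

Fixpoint mxp n (S : 'M[C]_n) j := if j is j'.+1 then mxp S j' *m S else 1%:M.

Lemma mxp_sq n (S : 'M[C]_n) i : mxp S i.*2 = mxp (S *m S) i.
Proof. by elim: i => //= i ->; rewrite mulmxA. Qed.
Lemma mxpZ n (S : 'M[C]_n) a i : mxp (a *: S) i = a ^+ i *: mxp S i.
Proof.
by elim: i => [|i ih] /=; rewrite ?expr0 ?scale1r// ih -scalemxAl -scalemxAr scalerA exprSr.
Qed.

(** The scalar [z], built from successive roots of [s], is the same for matrices of all sizes; so
    one factor serves both arguments of the trace function. *)
Lemma dyroot_scale (s : C) k : 0 < complex.Re s -> exists2 z : C, z ^+ (2 ^ k) = s &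
  0 < complex.Re z /\ forall n (X : 'M[C]_n), acc X -> acc (s *: X) ->
    dyroot k (s *: X) = z *: dyroot k X.
Proof.
move=> s0; elim: k => [|k [z zs [z0 ih]]]; first by exists s.
have [y yz [yb y0]] := complex_root z0.
exists y; first by rewrite expnS exprM yz.
split=> // n X aX asX; rewrite /dyroot /= -/(dyroot k _) -/(dyroot k _) ih//.
apply: mx_root_eq.
  by have := mx_root_scale (dyroot_acc k aX) yb y0; case: (y).
by rewrite -scalemxAl -scalemxAr scalerA -expr2 yz (mx_rootP (dyroot_acc k aX)).2.
Qed.

Definition cis (a : R) : C := cos a +i* sin a.
Lemma cisD a b : cis (a + b) = cis a * cis b.
Proof. by rewrite /cis cosD sinD; simpc; congr (_ +i* _); rewrite addrC mulrC [X in _ + X]mulrC addrC. Qed.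
Lemma cisN a : cis (- a) = conjc (cis a).
Proof. by rewrite /cis cosN sinN. Qed.
Lemma cis0 : cis 0 = 1.
Proof. by rewrite /cis cos0 sin0. Qed.

Lemma cis_quarter (g : R) : `|g| <= pi / 4 -> `|sin g| <= cos g /\ 0 < cos g.
Proof.
have p0 := pi_gt0 R; wlog g0 : g / 0 <= g => [h|].
  have [/h//|/ltW g0 hg] := leP 0 g.
  by have := h (- g); rewrite oppr_ge0 normrN sinN cosN normrN; apply.
rewrite ger0_norm// => hg.
have c0 : 0 < cos g by apply: cos_gt0_pihalf; lra.
split=> //; rewrite ger0_norm; last by apply: sin_ge0_pi; lra.
have [->|gne] := eqVneq g (pi / 4).
  rewrite -cosBpihalf -[leRHS]cosN.
  by have -> : pi / 4 - pi / 2 = - (pi / 4) :> R by field.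
have gl : g < pi / 4 by rewrite lt_neqAle gne.
rewrite -cosBpihalf -cosN opprB ltW// ltr_cos ?in_itv /=; lra.
Qed.

(** Induction on [k]: [S = dyroot k.+1 X] squares to [dyroot k X], which settles even [j]. For
    [j = 2 i + 1] put [W = cis (be - gm) S] and [Z = cis gm S^j]. Then [Z W] and [adj W Z] are, the
    latter up to congruence by [S], the powers [i + 1] and [i] of [dyroot k X] rotated by [be] and
    [al], where [al + be = 2 gm]; both are controlled by induction, and [lyapunov] applies. *)
Lemma dyroot_sector n (X : 'M[C]_n) (sg : R) k j : `|sg| = 1 -> acc X -> (0 < j <= 2 ^ k)%N ->
  acc (cis (sg * ((1 - j%:R / (2 ^ k)%:R) * (pi / 2))) *: mxp (dyroot k X) j).
Proof.
move=> sg1 aX; elim: k j => [|k ih] j.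
  rewrite expn0 => hj; have -> : j = 1%N by lia.
  by rewrite divr1 subrr mul0r mulr0 cis0 scale1r /= mul1mx.
move=> hj; rewrite -(odd_double_half j); set i := j./2.
set S := dyroot k.+1 X; have [aS eS] := mx_rootP (dyroot_acc k aX).
have SE : S = mx_root (dyroot k X) by [].
rewrite -SE in aS eS.
have p0 : (2 ^ k)%:R != 0 :> R by rewrite pnatr_eq0 expn_eq0.
case oj: (odd j); last first.
  rewrite add0n mxp_sq eS.
  have -> : (i.*2)%:R / (2 ^ k.+1)%:R = i%:R / (2 ^ k)%:R :> R.
    by rewrite -muln2 expnSr !natrM; field.
  by apply: ih; move: hj; rewrite -(odd_double_half j) oj add0n expnS -/i; lia.
have hi : (i < 2 ^ k)%N by move: hj; rewrite -(odd_double_half j) oj expnS -/i; lia.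
have e1n : (true + i.*2)%:R = 2 * i%:R + 1 :> R by rewrite natrD -muln2 natrM mulrC addrC.
have e2n : (2 ^ k.+1)%:R = 2 * (2 ^ k)%:R :> R by rewrite expnS natrM.
have e3n : i.+1%:R = i%:R + 1 :> R by rewrite natr1.
set gm := sg * _; set T := mxp S _.
pose al := sg * ((1 - i%:R / (2 ^ k)%:R) * (pi / 2)).
pose be := sg * ((1 - i.+1%:R / (2 ^ k)%:R) * (pi / 2)).
have abg : al + be = gm + gm.
  by rewrite /al /be /gm e1n e2n e3n; move: p0; move: ((2 ^ k)%:R : R) => y y0; field.
have aN : acc (cis be *: mxp (dyroot k X) i.+1) by apply: ih; rewrite hi.
have pM : psd (hrm (cis al *: mxp (dyroot k X) i)).
  (* For [i = 0] the power is the identity, rotated by a right angle: its Hermitian part is zero, so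
     it is only semidefinite. *)
  have [i0|i0] := posnP i; last by apply/posdef_psd/ih; rewrite i0 ltnW.
  rewrite /al i0 mul0r subr0 mul1r /=.
  have -> : hrm (cis (sg * (pi / 2)) *: (1%:M : 'M[C]_n)) = 0; last exact: psd0.
  rewrite hrmE adjZ adj1 -scalerDl /cis.
  have -> : cos (sg * (pi / 2)) = 0.
    have [h|h] : sg = 1 \/ sg = -1 by move/eqP: sg1; rewrite eqr_norml => /andP[/orP[]/eqP->]; [left|right].
      by rewrite h mul1r cos_pihalf.
    by rewrite h mulN1r cosN cos_pihalf.
  set z := Complex _ _; have -> : z + conjc z = 0.
    by apply/eqP; rewrite eq_complex /=; apply/andP; split; apply/eqP; ring.
  by rewrite scale0r.
rewrite -eS -mxp_sq in pM; rewrite -eS -mxp_sq doubleS /= in aN.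
pose W := cis (be - gm) *: S.
have aW : acc W.
  (* The angle has modulus pi / 2^(k+2), within the pi/4 that a square root admits. *)
  have hb : `|be - gm| <= pi / 4.
    have -> : be - gm = - sg * ((2 ^ k)%:R^-1 * (pi / 4)).
      rewrite /be /gm e1n e2n e3n.
      by move: p0; move: ((2 ^ k)%:R : R) => y y0; field.
    rewrite normrM normrN sg1 mul1r ger0_norm; last first.
      by rewrite mulr_ge0 ?invr_ge0 ?ler0n// divr_ge0// pi_ge0.
    have q1 : (2 ^ k)%:R^-1 <= 1 :> R by rewrite invf_le1 ?ltr0n ?expn_gt0// ler1n expn_gt0.
    have q2 : 0 <= pi / 4 :> R by rewrite divr_ge0 ?pi_ge0.
    exact: ler_piMl q2 q1.
  have [h1 h2] := cis_quarter hb; exact: (mx_root_scale (dyroot_acc k aX) h1 h2).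
have TE : T = mxp S i.*2 *m S by rewrite /T add1n.
apply: (@lyapunov _ _ _ W); [exact: hrm_herm | exact: aW |].
have e1 : cis gm *: T *m W = cis be *: (mxp S i.*2 *m S *m S).
  by rewrite /W TE -scalemxAl -scalemxAr scalerA -cisD addrC subrK.
have e2 : adj W *m (cis gm *: T) = adj S *m (cis al *: mxp S i.*2) *m S.
  rewrite /W TE adjZ -cisN -!scalemxAl -!scalemxAr -!scalemxAl !scalerA -cisD mulmxA.
  by congr (cis _ *: _); rewrite opprB addrC addrA -abg addrK.
have q := psd_congr S pM; have := posdefD aN q; congr posdef.
apply: esym; suff -> : hrm (cis gm *: T) *m W + adj W *m hrm (cis gm *: T) =
   hrm (cis be *: (mxp S i.*2 *m S *m S)) + adj S *m hrm (cis al *: mxp S i.*2) *m S.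
  by [].
rewrite -hrm_congr -e1 -e2; move: (cis gm *: T) => Z.
rewrite !hrmE !adjM !adjK mulmxDl mulmxDr.
move: (Z *m W) (adj Z *m W) (adj W *m Z) (adj W *m adj Z) => a b c d.
by rewrite [X in _ + X]addrC addrACA [X in _ + X]addrC.
Qed.
End DyadicRoots.

(** * Finite-order expansions of products, inverses and roots *)

Section Regular.
Variable R : realType.
Local Notation C := R[i].
Implicit Types (m n k : nat).

Lemma nz0 : nz (0 : C) = 0.
Proof. by rewrite /nz /= expr0n /= addr0. Qed.
Lemma nzM (z y : C) : nz (z * y) = nz z * nz y.
Proof. by case: z => a b; case: y => c d; rewrite /nz /=; ring. Qed.
Lemma fnZc m n z (M : 'M[C]_(m, n)) : fn (z *: M) = nz z * fn M.
Proof. by rewrite /fn adjZ -scalemxAl -scalemxAr scalerA conj_nz rtrZ. Qed.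
Lemma nz_entry m n (M : 'M[C]_(m, n)) i j : nz (M i j) <= fn M.
Proof.
rewrite fnE (bigD1 j)//= (bigD1 i)//= -addrA lerDl.
by rewrite addr_ge0//; repeat (apply: sumr_ge0 => ? _); rewrite addr_ge0 ?sqr_ge0.
Qed.

Definition near0 (P : C -> Prop) := exists2 d : R, 0 < d & forall z, nz z <= d -> P z.

Lemma near0T (P : C -> Prop) : (forall z, P z) -> near0 P.
Proof. by exists 1. Qed.
Lemma near0_and P Q : near0 P -> near0 Q -> near0 (fun z => P z /\ Q z).
Proof.
move=> [d d0 h] [e e0 g]; exists (Num.min d e); first by rewrite lt_min d0.
by move=> z; rewrite le_min => /andP[/h p /g].
Qed.
Lemma near0_imp (P Q : C -> Prop) : (forall z, P z -> Q z) -> near0 P -> near0 Q.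
Proof. by move=> h [d d0 g]; exists d => // z /g /h. Qed.
Lemma near0_at0 P : near0 P -> P 0.
Proof. by move=> [d d0]; apply; rewrite nz0 ltW. Qed.

Definition bnd m n (F : C -> 'M[C]_(m, n)) := exists c : R, near0 (fun z => fn (F z) <= c).

(* Finite-order Taylor expansion at [0] with bounded remainder: a substitute for holomorphy that
   is visibly stable under products, inverses and square roots. *)
Fixpoint reg m n k (F : C -> 'M[C]_(m, n)) : Prop :=
  if k is k'.+1 then exists2 G, reg k' G & near0 (fun z => F z = F 0 + z *: G z) else bnd F.

Lemma bnd_expand m n (F G : C -> 'M[C]_(m, n)) : bnd G ->
  near0 (fun z => F z = F 0 + z *: G z) -> bnd F.
Proof.
move=> [c hc] hF; exists (2 * (fn (F 0) + `|c|)).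
have h1 : near0 (fun z => nz z <= 1) by exists 1.
apply: near0_imp (near0_and (near0_and hc hF) h1) => z [[h e] z1]; rewrite e.
apply: le_trans (fnD_le _ _) _; rewrite ler_pM2l// lerD2l fnZc.
apply: (@le_trans _ _ (fn (G z))); first by rewrite ler_piMl ?fn_ge0.
by apply: le_trans h (ler_norm _).
Qed.

Lemma reg_bnd m n k (F : C -> 'M[C]_(m, n)) : reg k F -> bnd F.
Proof. by elim: k F => //= k ih F [G /ih hG]; apply: bnd_expand. Qed.

Lemma reg_le1 m n k (F : C -> 'M[C]_(m, n)) : reg k.+1 F -> reg k F.
Proof.
elim: k F => [|k ih] F; first exact: reg_bnd.
by move=> [G hG e]; exists G => //; apply: ih.
Qed.

Lemma reg_le m n j k (F : C -> 'M[C]_(m, n)) : (j <= k)%N -> reg k F -> reg j F.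
Proof.
move=> /subnK <-; elim: (k - j)%N => //= i ih h; apply: ih.
exact: reg_le1 h.
Qed.

Lemma reg_eq m n k (F G : C -> 'M[C]_(m, n)) : near0 (fun z => F z = G z) -> reg k F -> reg k G.
Proof.
move=> e; have e0 := near0_at0 e; case: k => [|k] /=.
  by move=> [c h]; exists c; apply: near0_imp (near0_and e h) => z [<-].
move=> [H hH hF]; exists H => //.
by apply: near0_imp (near0_and e hF) => z [<-]; rewrite -e0.
Qed.

Lemma reg_const m n k (A : 'M[C]_(m, n)) : reg k (fun=> A).
Proof.
elim: k A => [|k ih] A /=; first by exists (fn A); apply: near0T.
by exists (fun=> 0) => //; apply: near0T => z; rewrite scaler0 addr0.
Qed.

Lemma reg_affine m n k (A H : 'M[C]_(m, n)) : reg k (fun z => A + z *: H).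
Proof.
apply: (@reg_le _ _ k k.+1) => //=; exists (fun=> H); first exact: reg_const.
by apply: near0T => z; rewrite scale0r addr0.
Qed.

Lemma regD m n k (F G : C -> 'M[C]_(m, n)) : reg k F -> reg k G -> reg k (fun z => F z + G z).
Proof.
elim: k F G => [|k ih] F G /=.
  move=> [c h] [d g]; exists (2 * (c + d)); apply: near0_imp (near0_and h g) => z [h1 h2].
  by apply: le_trans (fnD_le _ _) _; rewrite ler_pM2l// lerD.
move=> [F' hF eF] [G' hG eG]; exists (fun z => F' z + G' z); first exact: ih.
by apply: near0_imp (near0_and eF eG) => z [-> ->]; rewrite scalerDr addrACA.
Qed.

(** Leibniz rule [F G = F 0 G 0 + z (F 0 G' + F' G)]; the quotient contains [G] itself, used there
    at order [k] only. *)
Lemma regM m n l k (F : C -> 'M[C]_(m, n)) (G : C -> 'M[C]_(n, l)) :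
  reg k F -> reg k G -> reg k (fun z => F z *m G z).
Proof.
elim: k F G => [|k ih] F G.
  move=> [c h] [d g]; exists (`|c| * `|d|); apply: near0_imp (near0_and h g) => z [h1 h2].
  apply: le_trans (fnM_le _ _) _; apply: ler_pM; rewrite ?fn_ge0//.
    exact: le_trans h1 (ler_norm _).
  exact: le_trans h2 (ler_norm _).
move=> [F' hF eF] hG; have hG1 := reg_le1 hG; case: hG => G' hG eG.
exists (fun z => F 0 *m G' z + F' z *m G z).
  by apply: regD; apply: ih => //; exact: reg_const.
apply: near0_imp (near0_and eF eG) => z [-> e].
rewrite mulmxDl {1}e mulmxDr -scalemxAr -scalemxAl scalerDr addrA.
by [].
Qed.

Lemma fn_sum I (r : seq I) m n (F : I -> 'M[C]_(m, n)) :
  fn (\sum_(i <- r) F i) <= (2 ^ size r)%:R * \sum_(i <- r) fn (F i).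
Proof.
elim: r => [|i r ih] /=; first by rewrite !big_nil mulr0 {1}/fn mulmx0 rtr0.
rewrite !big_cons expnS natrM; apply: le_trans (fnD_le _ _) _.
rewrite -mulrA ler_pM2l// mulrDr lerD//.
by rewrite ler_peMl ?fn_ge0// ler1n expn_gt0.
Qed.

Lemma linear_bounded m n p q (L : {linear 'M[C]_(m, n) -> 'M[C]_(p, q)}) :
  exists2 c : R, 0 <= c & forall M, fn (L M) <= c * fn M.
Proof.
pose s := enum [set: 'I_m * 'I_n].
pose f (ij : 'I_m * 'I_n) := fn (L (delta_mx ij.1 ij.2)).
exists ((2 ^ size (index_enum ('I_m * 'I_n)%type))%:R * \sum_ij f ij) => [|M].
  by rewrite mulr_ge0// ?ler0n// sumr_ge0// => ij _; apply: fn_ge0.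
rewrite {1}[M]matrix_sum_delta pair_bigA /= linear_sum /=.
apply: le_trans (fn_sum _ _) _; rewrite -mulrA ler_wpM2l ?ler0n// mulr_suml.
apply: ler_sum => -[i j] _ /=; rewrite linearZ /= fnZc mulrC ler_wpM2l ?fn_ge0//.
exact: nz_entry.
Qed.

Lemma reg_linear m n p q k (L : {linear 'M[C]_(m, n) -> 'M[C]_(p, q)}) (F : C -> 'M[C]_(m, n)) :
  reg k F -> reg k (fun z => L (F z)).
Proof.
elim: k F => [|k ih] F.
  have [c c0 hc] := linear_bounded L; move=> [d h]; exists (c * d).
  by apply: near0_imp h => z h; apply: le_trans (hc _) _; rewrite ler_wpM2l.
move=> [G hG e]; exists (fun z => L (G z)); first exact: ih.
by apply: near0_imp e => z e; rewrite {1}e linearD linearZ.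
Qed.

Lemma bnd_sylvester m n (S : C -> 'M[C]_m) (T : 'M[C]_n) (E Y : C -> 'M[C]_(m, n)) :
  acc T -> near0 (fun z => psd (hrm (S z))) -> bnd E ->
  near0 (fun z => S z *m Y z + Y z *m T = E z) -> bnd Y.
Proof.
move=> /posdef_lb[d d0 hT] hS [c hE] e; exists (c * (4 / d ^+ 2)).
apply: near0_imp (near0_and (near0_and hS hE) e) => z [[pS hc] ez].
apply: le_trans (sylvester_bound d0 pS hT ez) _; apply: ler_wpM2r => //.
by rewrite divr_ge0// sqr_ge0.
Qed.

(** Subtracting the equation at 0 and dividing by [z] shows that the difference quotient of [Y]
    solves [S Y' + Y' T = E' - S' (Y 0)], with the same [S] and [T] and data one order lower;
    uniqueness identifies it. *)
Lemma reg_sylvester m n k (S : C -> 'M[C]_m) (T : 'M[C]_n) (E Y : C -> 'M[C]_(m, n)) :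
  acc T -> near0 (fun z => psd (hrm (S z))) -> reg k S -> reg k E ->
  near0 (fun z => S z *m Y z + Y z *m T = E z) -> reg k Y.
Proof.
move=> aT pS; elim: k E Y => [|k ih] E Y rS rE e; first exact: bnd_sylvester aT pS rE e.
have rS1 := reg_le1 rS; case: rS => S' rS' eS; case: rE => E' rE' eE.
have /choice[Y' hY'] : forall z, exists y : 'M[C]_(m, n), psd (hrm (S z)) ->
    S z *m y + y *m T = E' z - S' z *m Y 0.
  move=> z; have [p|np] := pselect (psd (hrm (S z))).
    by have [y hy] := sylvester_solve (E' z - S' z *m Y 0) p aT; exists y.
  by exists 0.
exists Y'.
  apply: (ih (fun z => E' z - S' z *m Y 0)); first exact: rS1.
    have -> : (fun z => E' z - S' z *m Y 0) = (fun z => E' z + S' z *m (- Y 0)).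
      by apply/funext => z; rewrite mulmxN.
    by apply: (regD rE'); apply: (regM rS'); exact: reg_const.
  by apply: near0_imp pS => z p; exact: hY'.
have e0 := near0_at0 e.
apply: near0_imp (near0_and (near0_and pS e) (near0_and eS eE)) => z [[p ez] [eSz eEz]].
apply/eqP; rewrite -subr_eq0; apply/eqP; apply: (sylvester_inj p aT).
have hz := hY' z p.
rewrite mulmxBr mulmxBl addrACA ez -opprD !mulmxDr !mulmxDl addrACA.
rewrite -scalemxAr -scalemxAl -scalerDr hz {1}eSz mulmxDl -scalemxAl eEz -e0.
rewrite scalerBr; move: (S 0 *m Y 0) (Y 0 *m T) (z *: E' z) (z *: (S' z *m Y 0)) => a b c d.
by apply/matrixP => i j; rewrite !mxE; ring.
Qed.

Lemma qf_scalar m n (d : R) (x : 'M[C]_(m, n)) : qf ((d%:C)%:M) x = d * fn x.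
Proof. by rewrite -scalemx1 qfZ qf1. Qed.

Lemma acc_perturb n (X E : 'M[C]_n) (d : R) : 0 < d -> psd (hrm X - (d%:C)%:M) ->
  fn E <= (d / 4) ^+ 2 -> psd (hrm (X + E) - ((d / 2)%:C)%:M).
Proof.
move=> d0 pX hE; split.
  by rewrite adjB hrm_herm adj_scalar conjc_real.
move=> x; have := psd_qf x pX.
rewrite 2!qfB 2!qf_scalar hrmD qfD 2!qf_hrm => h1.
have t0 : 0 < d / 4 by rewrite divr_gt0.
have := young_rtr x ((- E) *m x) t0; rewrite mulNmx fnN mulmxN rtrN mulmxA => h2.
have h3 : fn (E *m x) / (d / 4) <= d / 4 * fn x.
  rewrite ler_pdivrMr// mulrAC -expr2; apply: le_trans (fnM_le _ _) _.
  by rewrite ler_wpM2r ?fn_ge0.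
rewrite /qf -[rtr (adj x *m E *m x)]/(rtr _) in h1 *.
move: h1 h2 h3; clear.
move: (rtr _) (rtr _) (fn (_ *m x) / _) (fn x) => a b c f.
have -> : d / 4 * f = d * f / 4 by ring.
have -> : d / 2 * f = d * f / 2 by ring.
by move: (d * f) => df; lra.
Qed.

Lemma acc_near n (F : C -> 'M[C]_n) : reg 1 F -> acc (F 0) ->
  exists2 d : R, 0 < d & near0 (fun z => psd (hrm (F z) - (d%:C)%:M)).
Proof.
move=> [G [c hG] e] /posdef_lb[d d0 pd]; exists (d / 2); first by rewrite divr_gt0.
pose q := (d / 4) ^+ 2 / (`|c| + 1).
have c1 : 0 < `|c| + 1 by rewrite ltr_wpDl.
have q0 : 0 < q by rewrite divr_gt0// exprn_gt0// divr_gt0.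
have hq : near0 (fun z => nz z <= q) by exists q.
apply: near0_imp (near0_and (near0_and hG e) hq) => z [[hc ez] zq]; rewrite ez.
apply: (acc_perturb d0 pd); rewrite fnZc.
apply: (@le_trans _ _ (q * (`|c| + 1))); last by rewrite /q divfK// gt_eqF.
apply: ler_pM => //; rewrite ?nz_ge0 ?fn_ge0//; apply: le_trans hc _.
by apply: le_trans (ler_norm _) _; rewrite lerDl.
Qed.

Lemma acc_lb n (X : 'M[C]_n) (d : R) : 0 < d -> psd (hrm X - (d%:C)%:M) -> acc X.
Proof. exact: lb_posdef. Qed.

Lemma acc_near_acc n (F : C -> 'M[C]_n) : reg 1 F -> acc (F 0) -> near0 (fun z => acc (F z)).
Proof. by move=> r a; have [d d0] := acc_near r a; apply: near0_imp => z; apply: acc_lb. Qed.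

(** The inverse solves the Sylvester equation [(F - d/2) Y + Y (d/2) = 1]; a shift by [d/2] leaves a
    semidefinite Hermitian part on the left and makes the right coefficient accretive. *)
Lemma reg_inv n k (F : C -> 'M[C]_n) : reg k.+1 F -> acc (F 0) ->
  reg k.+1 (fun z => invmx (F z)).
Proof.
move=> rF aF; have rF1 : reg 1 F by apply: reg_le rF.
have [d d0 hd] := acc_near rF1 aF.
have d2 : 0 < d / 2 by rewrite divr_gt0.
apply: (@reg_sylvester _ _ _ (fun z => F z + (- (d / 2)%:C%:M)) ((d / 2)%:C%:M) (fun=> 1%:M)).
- exact: posdef_acc (posdef_scalar _ d2).
- apply: near0_imp hd => z; congr psd; rewrite hrmD; congr (_ + _).
  rewrite hrmE adjN adj_scalar conjc_real -opprD; congr (- _).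
  apply/matrixP => i j; rewrite !mxE -mulrnDl -rmorphD; congr (_%:C *+ _).
  by rewrite -splitr.
- by apply: regD => //; exact: reg_const.
- exact: reg_const.
- apply: near0_imp (acc_near_acc rF1 aF) => z az.
  rewrite mulmxDl mulmxV ?acc_unit// mulNmx scalar_mxC subrK.
  by [].
Qed.

(** The difference quotient of the root [S] solves [S(z) Y + Y S(0) = X'(z)], whose coefficient
    [S(z)] is the unknown itself: order [j] of [S] yields order [j + 1]. *)
Lemma reg_root n k (X : C -> 'M[C]_n) : reg k.+1 X -> acc (X 0) ->
  reg k.+1 (fun z => mx_root (X z)).
Proof.
move=> rX aX; have rX1 : reg 1 X by apply: reg_le rX.
have nX := acc_near_acc rX1 aX.
have [aS0 eS0] := mx_rootP aX.
have pS : near0 (fun z => psd (hrm (mx_root (X z)))).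
  by apply: near0_imp nX => z /mx_rootP[/posdef_psd].
have key z : acc (X z) -> mx_root (X z) *m (mx_root (X z) - mx_root (X 0)) +
    (mx_root (X z) - mx_root (X 0)) *m mx_root (X 0) = X z - X 0.
  by move=> /mx_rootP[_ e]; rewrite mulmxBr mulmxBl addrA subrK e eS0.
suff h j : (j <= k.+1)%N -> reg j (fun z => mx_root (X z)) by apply: h.
elim: j => [_|j ih jk].
  have bE : bnd (fun z => X z - X 0).
    by apply: (@reg_bnd _ _ 1); apply: regD => //; exact: reg_const.
  have [c hc] : bnd (fun z => mx_root (X z) - mx_root (X 0)).
    by apply: bnd_sylvester aS0 pS bE _; apply: near0_imp nX => z; exact: key.
  exists (2 * (c + fn (mx_root (X 0)))); apply: near0_imp hc => z hc.
  rewrite -[mx_root (X z)](subrK (mx_root (X 0))); apply: le_trans (fnD_le _ _) _.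
  by rewrite ler_pM2l// lerD2r.
have rj : reg j.+1 X by apply: reg_le rX.
case: rj => X' rX' eX.
have /choice[Y hY] : forall z, exists y : 'M[C]_n, psd (hrm (mx_root (X z))) ->
    mx_root (X z) *m y + y *m mx_root (X 0) = X' z.
  move=> z; have [p|np] := pselect (psd (hrm (mx_root (X z)))).
    by have [y hy] := sylvester_solve (X' z) p aS0; exists y.
  by exists 0.
exists Y.
  apply: (reg_sylvester aS0 pS (ih (ltnW jk)) rX').
  by apply: near0_imp pS => z p; exact: hY.
apply: near0_imp (near0_and (near0_and pS nX) eX) => z [[p az] ez].
apply/eqP; rewrite -subr_eq0; apply/eqP; apply: (sylvester_inj p aS0).
have dz : X z - X 0 = z *: X' z by rewrite {1}ez addrC addKr.
rewrite opprD addrA mulmxDr mulmxDl addrACA (key z az) dz.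
by rewrite mulmxN mulNmx -opprD -scalemxAr -scalemxAl -scalerDr (hY z p) subrr.
Qed.

Lemma reg_mxp n k j (F : C -> 'M[C]_n) : reg k F -> reg k (fun z => mxp (F z) j).
Proof.
by move=> rF; elim: j => [|j ih] /=; [exact: reg_const | exact: regM].
Qed.

Lemma reg_dyroot n k j (F : C -> 'M[C]_n) : reg k.+1 F -> acc (F 0) ->
  reg k.+1 (fun z => dyroot j (F z)).
Proof.
move=> rF aF; elim: j => [|j ih]; first exact: rF.
exact: (reg_root ih (dyroot_acc j aF)).
Qed.

Lemma reg3_expand m n (F : C -> 'M[C]_(m, n)) : reg 3 F -> exists F1 F2 E, exists c : R,
  near0 (fun z => F z = F 0 + z *: F1 + z ^+ 2 *: F2 + z ^+ 3 *: E z /\ fn (E z) <= c).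
Proof.
move=> [G [H [E [c hc] eH] eG] eF]; exists (G 0), (H 0), E, c.
apply: near0_imp (near0_and (near0_and hc eH) (near0_and eG eF)) => z [[h e1] [e2 e3]].
by split=> //; rewrite e3 e2 e1 !scalerDr !scalerA -!expr2 -?exprSr -?exprS !addrA.
Qed.
End Regular.

(** * Minimum principle and joint concavity for dyadic exponents *)

Section MinimumPrinciple.
Variable R : realType.
Local Notation C := R[i].

(** Order 3 gives a second order term with cubic remainder, as the comparisons with neighbouring
    points require. *)
Definition sreg (f : C -> C) := reg 3 (fun z => (f z)%:M : 'M[C]_1).

Lemma sreg_expand f : sreg f -> exists c1 c2 : C, exists E : C -> C, exists c : R,
  near0 (fun z => f z = f 0 + z * c1 + z ^+ 2 * c2 + z ^+ 3 * E z /\ nz (E z) <= c).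
Proof.
move=> /reg3_expand[F1 [F2 [E [c h]]]].
exists (F1 0 0), (F2 0 0), (fun z => E z 0 0), c; apply: near0_imp h => z [e he]; split.
  by move/matrixP: e => /(_ 0 0); rewrite !mxE /= !mulr1n.
exact: le_trans (nz_entry _ _ _) he.
Qed.

Lemma nzD (x y : C) : nz (x + y) <= 2 * (nz x + nz y).
Proof.
case: x => a b; case: y => c d; rewrite /nz /=.
have := sqr_ge0 (a - c); have := sqr_ge0 (b - d); rewrite !expr2; nra.
Qed.

Lemma Re_le_nz (x : C) (e : R) : 0 <= e -> nz x <= e ^+ 2 -> `|complex.Re x| <= e.
Proof.
move=> e0 h; rewrite -ler_sqr ?nnegrE// real_normK ?num_real//.
by apply: le_trans h; rewrite lerDl sqr_ge0.
Qed.

Lemma sreg_lipschitz f : sreg f -> exists2 K : R, 0 < K &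
  near0 (fun z => nz (f z - f 0) <= K * nz z).
Proof.
move=> /sreg_expand[c1 [c2 [E [c h]]]].
pose K : R := 2 * (2 * (nz c1 + nz c2) + `|c|) + 1.
have K0 : 0 < K by have := nz_ge0 c1; have := nz_ge0 c2; have := normr_ge0 c; rewrite /K; lra.
exists K => //; have h1 : near0 (fun z : C => nz z <= 1) by exists (1 : R).
apply: near0_imp (near0_and h h1) => z [[e hE] z1].
have -> : f z - f 0 = z * ((c1 + z * c2) + z ^+ 2 * E z) by rewrite e; ring.
rewrite nzM mulrC ler_wpM2r ?nz_ge0//.
have a1 := nzD (c1 + z * c2) (z ^+ 2 * E z); have a2 := nzD c1 (z * c2).
rewrite !nzM in a1 a2 *.
have a3 : nz z * nz c2 <= nz c2 by rewrite ler_piMl ?nz_ge0.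
have a4 : nz (z ^+ 2) * nz (E z) <= `|c|.
  apply: le_trans (le_trans hE (ler_norm _)); rewrite ler_piMl ?nz_ge0// expr2 nzM.
  by rewrite mulr_ile1 ?nz_ge0.
rewrite /K; move: a1 a2 a3 a4; rewrite expr2 nzM; lra.
Qed.

Lemma nz_real (h : R) : nz h%:C = h ^+ 2.
Proof. by rewrite /nz /= expr0n /= addr0. Qed.
Lemma nz_imag (h : R) : nz (0 +i* h) = h ^+ 2.
Proof. by rewrite /nz /= expr0n /= add0r. Qed.

(** A discrete mean value property: the first powers of [h], [-h], [i h], [-i h] sum to zero, and so
    do the second powers. *)
Lemma sreg_four_points f : sreg f -> exists2 K : R, 0 < K & exists2 d : R, 0 < d &
  forall h : R, 0 < h <= d ->
    complex.Re (f h%:C) + complex.Re (f (- h)%:C) + complex.Re (f (0 +i* h)) +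
    complex.Re (f (0 +i* (- h))) <= 4 * complex.Re (f 0) + K * h ^+ 3.
Proof.
move=> /sreg_expand[c1 [c2 [E [c [d d0 hd]]]]].
pose k : R := `|c| + 1; have k0 : 0 < k by rewrite /k ltr_wpDl.
have cE z : nz (E z) <= c -> nz (E z) <= k ^+ 2.
  move=> h; apply: le_trans h _; apply: le_trans (ler_norm c) _.
  by rewrite /k expr2; have := normr_ge0 c; nra.
exists (4 * k); first by rewrite mulr_gt0.
exists (Num.sqrt d); first by rewrite sqrtr_gt0.
move=> h /andP[h0 hh].
have h2 : h ^+ 2 <= d by rewrite -[d]sqr_sqrtr ?(ltW d0)// ler_sqr ?nnegrE ?sqrtr_ge0 ?(ltW h0).
have [|e1 b1] := hd h%:C; first by rewrite nz_real.
have [|e2 b2] := hd (- h)%:C; first by rewrite nz_real sqrrN.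
have [|e3 b3] := hd (0 +i* h); first by rewrite nz_imag.
have [|e4 b4] := hd (0 +i* (- h)); first by rewrite nz_imag sqrrN.
have := Re_le_nz (ltW k0) (cE _ b1).
have := Re_le_nz (ltW k0) (cE _ b2).
have b3' := cE _ b3; have b4' := cE _ b4.
(* At the imaginary points [z^3] is [-i h^3] or [i h^3], so the remainder enters through
   ['i * E]. *)
have m3 : nz ('i * E (0 +i* h)) <= k ^+ 2 by rewrite nzM {1}/nz /= expr0n expr1n add0r mul1r.
have m4 : nz ('i * E (0 +i* - h)) <= k ^+ 2 by rewrite nzM {1}/nz /= expr0n expr1n add0r mul1r.
have := Re_le_nz (ltW k0) m3; have := Re_le_nz (ltW k0) m4.
rewrite e1 e2 e3 e4; move: (E _) (E _) (E _) (E _) => [x1 y1] [x2 y2] [x3 y3] [x4 y4].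
case: (f 0) => f1 f2; case: c1 {e1 e2 e3 e4 hd} => a1 a2; case: c2 => a3 a4 /=.
rewrite !ler_norml => /andP[p1 p2] /andP[p3 p4] /andP[p5 p6] /andP[p7 p8].
have h3 : 0 < h ^+ 3 by rewrite exprn_gt0.
set lhs := (X in X <= _).
have -> : lhs = 4 * f1 + (x1 - x2 + y3 - y4) * h ^+ 3 by rewrite /lhs; ring.
by rewrite lerD2l ler_pM2r//; lra.
Qed.

Lemma nz_complex (a b : R) : nz (a +i* b) = a ^+ 2 + b ^+ 2.
Proof. by []. Qed.

Lemma near_Re_continuous (f : C -> C) (p : R * R) : sreg (fun z => f ((p.1 +i* p.2) + z)) ->
  {for p, continuous (fun q : R * R => complex.Re (f (q.1 +i* q.2)))}.
Proof.
move=> /sreg_lipschitz[K K0 [d d0 h]]; apply/cvgrPdist_le => /= e e0.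
pose b : R := Num.min (Num.sqrt (d / 2)) (Num.sqrt (e ^+ 2 / (2 * K))).
have d2 : 0 < d / 2 by rewrite divr_gt0.
have e2 : 0 < e ^+ 2 / (2 * K) by rewrite divr_gt0 ?exprn_gt0 ?mulr_gt0.
have b0 : 0 < b by rewrite lt_min !sqrtr_gt0 d2 e2.
exists (ball p.1 b, ball p.2 b); first by split; apply: nbhsx_ballx.
move=> q [] /=; rewrite -!ball_normE /= => q1 q2.
have sq (x c : R) : 0 < c -> `|x| < Num.sqrt c -> x ^+ 2 <= c.
  move=> c0 xc; rewrite -[c]sqr_sqrtr ?(ltW c0)// -[x ^+ 2]real_normK ?num_real//.
  by rewrite ler_sqr ?nnegrE ?sqrtr_ge0 ?(ltW xc).
pose z : C := (q.1 - p.1) +i* (q.2 - p.2).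
have bd1 : b <= Num.sqrt (d / 2) by rewrite ge_min lexx.
have bd2 : b <= Num.sqrt (e ^+ 2 / (2 * K)) by rewrite ge_min lexx orbT.
have zd : nz z <= d.
  rewrite nz_complex; have := sq _ _ d2 (lt_le_trans q1 bd1); have := sq _ _ d2 (lt_le_trans q2 bd1).
  by rewrite -![(p.1 - _) ^+ 2]sqrrN -![(p.2 - _) ^+ 2]sqrrN !opprB; lra.
have ze : K * nz z <= e ^+ 2.
  rewrite nz_complex; have := sq _ _ e2 (lt_le_trans q1 bd2); have := sq _ _ e2 (lt_le_trans q2 bd2).
  rewrite -![(p.1 - _) ^+ 2]sqrrN -![(p.2 - _) ^+ 2]sqrrN !opprB => h1 h2.
  have : K * ((q.1 - p.1) ^+ 2 + (q.2 - p.2) ^+ 2) <= K * (2 * (e ^+ 2 / (2 * K))).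
    by rewrite ler_pM2l//; lra.
  by have -> : K * (2 * (e ^+ 2 / (2 * K))) = e ^+ 2 by field; rewrite gt_eqF.
have := h z zd; rewrite addr0.
have -> : p.1 +i* p.2 + z = q.1 +i* q.2.
  by rewrite /z; apply/eqP; rewrite eq_complex /= ![_ + (_ - _)]addrC !subrK !eqxx.
move=> h1; have := Re_le_nz (ltW e0) (le_trans h1 ze).
by rewrite ReD ReN distrC.
Qed.

Lemma shift_itv (a t y M : R) : 0 < t -> t <= a - y -> t <= M - a ->
  y <= a + t <= M /\ y <= a - t <= M.
Proof. by move=> *; split; apply/andP; split; lra. Qed.

Lemma four_point_contra (d K t c0 a b g g1 g2 g3 g4 : R) : 0 < t -> 0 < d -> K * t <= d ->
  g - c0 * a - d * (a ^+ 2 + b ^+ 2) <= g1 - c0 * (a + t) - d * ((a + t) ^+ 2 + b ^+ 2) ->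
  g - c0 * a - d * (a ^+ 2 + b ^+ 2) <= g2 - c0 * (a - t) - d * ((a - t) ^+ 2 + b ^+ 2) ->
  g - c0 * a - d * (a ^+ 2 + b ^+ 2) <= g3 - c0 * a - d * (a ^+ 2 + (b + t) ^+ 2) ->
  g - c0 * a - d * (a ^+ 2 + b ^+ 2) <= g4 - c0 * a - d * (a ^+ 2 + (b - t) ^+ 2) ->
  g1 + g2 + g3 + g4 <= 4 * g + K * t ^+ 3 -> False.
Proof.
move=> t0 d0 Kt w1 w2 w3 w4 w5.
have tt : 0 < t ^+ 2 by rewrite exprn_gt0.
have fin : 4 * (d * t ^+ 2) <= K * t ^+ 3.
  have r1 : d * ((a + t) ^+ 2 + b ^+ 2) + d * ((a - t) ^+ 2 + b ^+ 2) +
    d * (a ^+ 2 + (b + t) ^+ 2) + d * (a ^+ 2 + (b - t) ^+ 2) =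
    4 * (d * (a ^+ 2 + b ^+ 2)) + 4 * (d * t ^+ 2) by ring.
  have r2 : c0 * (a + t) + c0 * (a - t) = 2 * (c0 * a) by ring.
  by lra.
have : K * t ^+ 3 <= d * t ^+ 2 by rewrite exprS mulrA ler_pM2r.
have : 0 < d * t ^+ 2 by rewrite mulr_gt0.
lra.
Qed.

(* No interior minimum of [Re f - c0 Re s - d |s|^2] exists: its mean over four neighbours at
   distance [h] differs from the centre value by [- d h^2 + O(h^3)]. *)
Lemma half_plane_minimum (f : C -> C) (c0 : R) :
  (forall s : C, 0 < complex.Re s -> sreg (fun z => f (s + z))) ->
  (forall s : C, 0 < complex.Re s -> 0 <= complex.Re (f s)) ->
  (forall e : R, 0 < e -> exists L : R, forall s : C, 0 < complex.Re s -> L <= nz s ->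
     - e <= complex.Re (f s) - c0 * complex.Re s) ->
  forall s : C, 0 < complex.Re s -> c0 * complex.Re s <= complex.Re (f s).
Proof.
move=> hreg hpos hinf s s0; rewrite -subr_ge0 leNgt; apply/negP => neg.
pose x0 : R := complex.Re s; pose y0 : R := complex.Im s.
have sE : s = x0 +i* y0 by rewrite /x0 /y0; case: (s).
have x00 : 0 < x0 := s0.
pose u (p : R * R) : R := complex.Re (f (p.1 +i* p.2)) - c0 * p.1.
have us : u (x0, y0) = complex.Re (f s) - c0 * complex.Re s by rewrite /u /= sE.
pose e : R := - u (x0, y0) / 2; have e0 : 0 < e by rewrite divr_gt0// oppr_gt0 us.
have [L hL] := hinf e e0.
pose c1 : R := `|c0| + 1; have c10 : 0 < c1 by rewrite ltr_wpDl.
(* The left side of the rectangle: there [Re f >= 0] and [c0 y <= e] give [u >= -e]. *)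
pose y : R := Num.min (x0 / 2) (e / c1).
have y00 : 0 < y by rewrite lt_min; apply/andP; split; rewrite divr_gt0.
have yx : y < x0 by rewrite gt_min; apply/orP; left; lra.
have yc : c0 * y <= e.
  apply: (@le_trans _ _ (c1 * y)); first by rewrite ler_pM2r// /c1; have := ler_norm c0; lra.
  by rewrite mulrC -ler_pdivlMr// ge_min lexx orbT.
(* The other three sides satisfy [nz s >= M^2 >= L], where [hinf] gives [u >= -e]. *)
pose M : R := `|L| + x0 + `|y0| + 1.
have n1 := normr_ge0 L; have n2 := normr_ge0 y0.
have M0 : 0 < M by rewrite /M; lra.
have xM : x0 < M by rewrite /M; lra.
have yM : `|y0| < M by rewrite /M; lra.
have ML : L <= M ^+ 2.
  have h1 := ler_norm L; have h2 : M <= M ^+ 2 by rewrite expr2 ler_peMl ?(ltW M0)// /M; lra.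
  by apply: le_trans h2; rewrite /M; lra.
have M20 : 0 < M ^+ 2 by rewrite exprn_gt0.
(* The penalty stays below [e] on the rectangle, whereas [v <= -2 e] at the given point; so [u < -e]
   at the minimum of [v], which is therefore interior. *)
pose d : R := e / (2 * M ^+ 2 + 1).
have den : 0 < 2 * M ^+ 2 + 1 by lra.
have d0 : 0 < d by rewrite divr_gt0.
have dM : d * (2 * M ^+ 2) < e.
  by rewrite /d mulrAC ltr_pdivrMr// ltr_pM2l//; lra.
clearbody d.
pose v (p : R * R) : R := u p - d * (p.1 ^+ 2 + p.2 ^+ 2).
pose A : set (R * R) := `[y, M]%classic `*` `[- M, M]%classic.
have cA : compact A by apply: compact_setX; apply: segment_compact.
have sA : A (x0, y0).
  split; rewrite /= in_itv /=; first by rewrite (ltW yx) (ltW xM).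
  by rewrite -ler_norml (ltW yM).
have A0 : A !=set0 by exists (x0, y0).
have cv : {within A, continuous v}.
  apply: continuous_in_subspaceT => p /set_mem [/= p1 p2].
  have p0 : 0 < p.1 by move: p1; rewrite in_itv /= => /andP[h _]; apply: lt_le_trans h.
  have c1' : {for p, continuous (fun q : R * R => complex.Re (f (q.1 +i* q.2)))}.
    by apply: near_Re_continuous; exact: hreg.
  have f1 : {for p, continuous (fun q : R * R => q.1)} by exact: cvg_fst.
  have f2 : {for p, continuous (fun q : R * R => q.2)} by exact: cvg_snd.
  apply: cvgB; first by apply: cvgB => //; apply: cvgM => //; exact: cvg_cst.
  apply: cvgM; first exact: cvg_cst.
  by apply: cvgD; rewrite /GRing.exp /=; apply: cvgM.
have [c cc hc] := compact_EVT_min A0 cA cv.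
have vs : v (x0, y0) <= - 2 * e.
  rewrite /v /= /e; have : 0 <= d * (x0 ^+ 2 + y0 ^+ 2) by rewrite mulr_ge0 ?(ltW d0)// addr_ge0 ?sqr_ge0.
  lra.
have vc : v c <= - 2 * e by apply: le_trans vs; apply: hc; rewrite inE.
have := cc; rewrite inE => -[/=]; rewrite !in_itv /=.
case: c {cc} hc vc => a b /= hc vc /andP[ya aM] /andP[Mb bM].
have a0 : 0 < a by apply: lt_le_trans ya.
have sqa : a ^+ 2 <= M ^+ 2 by rewrite ler_sqr ?nnegrE ?(ltW a0) ?(ltW M0).
have sqb : b ^+ 2 <= M ^+ 2.
  by rewrite -[b ^+ 2]real_normK ?num_real// ler_sqr ?nnegrE ?(ltW M0)// ler_norml Mb bM.
have uc : u (a, b) < - e.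
  have : d * (a ^+ 2 + b ^+ 2) <= d * (2 * M ^+ 2) by rewrite ler_pM2l//; lra.
  by move: vc; rewrite /v /=; lra.
have apos : 0 < complex.Re (a +i* b) by [].
have [h|h] := boolP [&& y < a, a < M, - M < b & b < M]; last first.
  have big : L <= nz (a +i* b) -> False.
    by move=> /(hL _ apos) /=; rewrite -[_ - _]/(u (a, b)); lra.
  move: h; rewrite !negb_and -!leNgt => /or4P[h|h|h|h].
  - have := hpos _ apos; have ay : a = y by apply/eqP; rewrite eq_le h ya.
    by move: uc; rewrite /u /= {2}ay; lra.
  - have aM' : a = M by apply/eqP; rewrite eq_le h aM.
    by apply: big; apply: le_trans ML _; rewrite /nz /= aM' lerDl sqr_ge0.
  - have bM' : b = - M by apply/eqP; rewrite eq_le h Mb.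
    by apply: big; apply: le_trans ML _; rewrite /nz /= bM' sqrrN lerDr sqr_ge0.
  - have bM' : b = M by apply/eqP; rewrite eq_le h bM.
    by apply: big; apply: le_trans ML _; rewrite /nz /= bM' lerDr sqr_ge0.
have /and4P[i1 i2 i3 i4] := h.
have [K K0 [r r0 four]] := sreg_four_points (hreg _ apos).
pose t : R := Num.min (Num.min (Num.min (a - y) (M - a)) (Num.min (b + M) (M - b)))
  (Num.min r (d / K)).
have t0 : 0 < t by rewrite !lt_min !subr_gt0 i1 i2 i4 r0 divr_gt0// -(opprK M) subr_gt0 i3.
have tl : [/\ t <= a - y, t <= M - a, t <= b + M, t <= M - b & (t <= r) && (t <= d / K)].
  by split; rewrite /t !ge_min ?lexx ?orbT//=.
case: tl => t1 t2 t3 t4 /andP[t5 t6].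
have := four t; rewrite t0 t5 => /(_ isT).
have inA a' b' : y <= a' <= M -> - M <= b' <= M -> v (a, b) <= v (a', b').
  by move=> h1 h2; apply: hc; rewrite inE; split; rewrite /= in_itv.
have e1 (x1 x2 z1 z2 : R) : (x1 +i* x2) + (z1 +i* z2) = (x1 + z1) +i* (x2 + z2) by [].
rewrite addr0 !e1 ?addr0.
have yaM : y <= a <= M by rewrite ya aM.
have MbM : - M <= b <= M by rewrite Mb bM.
have [s1 s2] := shift_itv t0 t1 t2.
have t3' : t <= b - - M by rewrite opprK.
have [s3 s4] := shift_itv t0 t3' t4.
have Kt : K * t <= d by rewrite mulrC -ler_pdivlMr.
move=> w5; exact: (four_point_contra t0 d0 Kt (inA _ _ s1 MbM) (inA _ _ s2 MbM)
  (inA _ _ yaM s3) (inA _ _ yaM s4) w5).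
Qed.

(* A local second-order upper bound everywhere forces concavity: adding [d t (1 - t)] to the
   difference with the chord makes an interior minimum impossible. *)
Lemma concave_of_local (g : R -> R) :
  (forall t : R, 0 <= t <= 1 -> exists a b K r : R, [/\ b <= 0, 0 < K, 0 < r &
     forall h : R, `|h| <= r -> `|g (t + h) - g t - a * h - b * h ^+ 2| <= K * `|h| ^+ 3]) ->
  forall t : R, 0 <= t <= 1 -> (1 - t) * g 0 + t * g 1 <= g t.
Proof.
move=> hg t0 /andP[t00 t01]; rewrite -subr_ge0 leNgt; apply/negP => neg.
pose v (t : R) : R := g t - ((1 - t) * g 0 + t * g 1).
have vt : v t0 < 0 by [].
(* With this [d], [w t0 <= -2 d + d < 0], while [w] vanishes at 0 and 1. *)
pose d : R := - v t0 / 2; have d0 : 0 < d by rewrite divr_gt0// oppr_gt0.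
pose w (t : R) : R := v t + d * (t * (1 - t)).
have cw : {within `[0 : R, 1], continuous w}.
  apply: continuous_in_subspaceT => t /set_mem /=; rewrite in_itv /= => ht.
  have cg : {for t, continuous g}.
    have [a [b [K [r [b0 K0 r0 hr]]]]] := hg t ht.
    apply/cvgrPdist_le => /= e e0.
    pose c : R := `|a| + `|b| + K + 1.
    have nab := normr_ge0 a; have nb := normr_ge0 b.
    have c0 : 0 < c by rewrite /c; lra.
    pose q : R := Num.min (Num.min r 1) (e / c).
    have q0 : 0 < q by rewrite !lt_min r0 ltr01 divr_gt0.
    apply/nbhs_ballP; exists q => //= x; rewrite /= distrC => hx.
    have [x1 x2 x3] : [/\ `|x - t| <= r, `|x - t| <= 1 & `|x - t| <= e / c].
      by split; apply: le_trans (ltW hx) _; rewrite !ge_min lexx ?orbT.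
    have := hr _ x1; rewrite [t + _]addrC subrK => h1.
    set h := x - t in h1 x1 x2 x3; have hn := normr_ge0 h.
    have -> : g t - g x = - ((g x - g t - a * h - b * h ^+ 2) + a * h + b * h ^+ 2) by ring.
    rewrite normrN; apply: le_trans (ler_normD _ _) _.
    have l1 := ler_normD (g x - g t - a * h - b * h ^+ 2) (a * h).
    have l2 : `|b * h ^+ 2| <= `|b| * `|h|.
      by rewrite normrM ler_wpM2l// normrX expr2 ler_piMl.
    have l3 : K * `|h| ^+ 3 <= K * `|h|.
      rewrite ler_pM2l// !exprS expr0 mulr1 ler_piMr// -expr2 expr_le1//.
    rewrite normrM in l1.
    apply: (@le_trans _ _ (c * `|h|)); last by rewrite mulrC -ler_pdivlMr.
    have -> : c * `|h| = `|a| * `|h| + `|b| * `|h| + K * `|h| + `|h| by rewrite /c; ring.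
    lra.
  have id : {for t, continuous (fun x : R => x)} by exact: cvg_id.
  have cst (z : R) : {for t, continuous (fun=> z)} by exact: cvg_cst.
  have c1t : {for t, continuous (fun x : R => 1 - x)} by exact: cvgB (cst 1) id.
  have c2t : {for t, continuous (fun x : R => (1 - x) * g 0)} by exact: cvgM c1t (cst _).
  have c3t : {for t, continuous (fun x : R => x * g 1)} by exact: cvgM id (cst _).
  have c4t : {for t, continuous (fun x : R => d * (x * (1 - x)))}.
    by apply: cvgM (cst d) _; exact: cvgM id c1t.
  have c5t : {for t, continuous (fun x : R => (1 - x) * g 0 + x * g 1)} by exact: cvgD c2t c3t.
  have c6t : {for t, continuous v} by exact: cvgB cg c5t.
  exact: cvgD c6t c4t.
have [c] := EVT_min (ler01 : 0 <= (1 : R)) cw; rewrite in_itv /= => /andP[c0 c1] hc.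
have w0 : w 0 = 0 by rewrite /w /v; ring.
have w1 : w 1 = 0 by rewrite /w /v; ring.
have wt : w t0 < 0.
  rewrite /w; have : t0 * (1 - t0) <= 1 by nra.
  move=> h; have : d * (t0 * (1 - t0)) <= d * 1 by rewrite ler_pM2l.
  by rewrite {2}/d; lra.
have wc : w c < 0 by apply: le_lt_trans wt; apply: hc; rewrite in_itv /= t00 t01.
have cne0 : c != 0 by apply: contraTneq wc => ->; rewrite w0 ltxx.
have cne1 : c != 1 by apply: contraTneq wc => ->; rewrite w1 ltxx.
have {}c0 : 0 < c by rewrite lt_neqAle eq_sym cne0.
have {}c1 : c < 1 by rewrite lt_neqAle cne1.
have [|a [b [K [r [b0 K0 r0 hr]]]]] := hg c; first by rewrite !ltW.
(* Adding the comparisons of [c] with [c + h] and [c - h] gives [d h^2 <= K h^3], against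
   [2 K h <= d]. *)
pose h : R := Num.min (Num.min c (1 - c)) (Num.min r (d / (2 * K))).
have h0 : 0 < h by rewrite !lt_min c0 subr_gt0 c1 r0 divr_gt0// mulr_gt0.
have [l1 l2 l3 l4] : [/\ h <= c, h <= 1 - c, h <= r & h <= d / (2 * K)].
  by split; rewrite !ge_min lexx ?orbT.
have i1 : w c <= w (c + h) by apply: hc; rewrite in_itv /=; apply/andP; split; lra.
have i2 : w c <= w (c - h) by apply: hc; rewrite in_itv /=; apply/andP; split; lra.
have := hr h; rewrite (gtr0_norm h0) => /(_ l3); rewrite ler_norml => /andP[_ j1].
have := hr (- h); rewrite normrN (gtr0_norm h0) => /(_ l3); rewrite ler_norml sqrrN => /andP[_ j2].
have hh : 0 < h ^+ 2 by rewrite exprn_gt0.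
have bh : b * h ^+ 2 <= 0 by rewrite mulr_le0_ge0// ltW.
have fin : d * h ^+ 2 <= K * h ^+ 3.
  move: i1 i2; rewrite /w /v => i1 i2.
  have r1 : d * ((c + h) * (1 - (c + h))) + d * ((c - h) * (1 - (c - h))) =
    2 * (d * (c * (1 - c))) - 2 * (d * h ^+ 2) by ring.
  have r2 : (1 - (c + h)) * g 0 + (c + h) * g 1 + ((1 - (c - h)) * g 0 + (c - h) * g 1) =
    2 * ((1 - c) * g 0 + c * g 1) by ring.
  have r3 : a * - h = - (a * h) by ring.
  lra.
have Kh : 2 * (K * h) <= d.
  by move: l4; rewrite ler_pdivlMr ?mulr_gt0// mulrC mulrA.
have : 2 * (K * h ^+ 3) <= d * h ^+ 2.
  have -> : 2 * (K * h ^+ 3) = 2 * (K * h) * h ^+ 2 by ring.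
  by rewrite ler_pM2r.
have : 0 < d * h ^+ 2 by rewrite mulr_gt0.
lra.
Qed.
End MinimumPrinciple.

(** * Joint concavity of the trace for a pair of maps with complementary sectors *)

Section Core.
Variable R : realType.
Local Notation C := R[i].
Implicit Types (m n k l : nat).

(** What the sector of half-angle [(j / 2^k) pi/2] leaves to a right angle. *)
Definition ang k j : R := (1 - j%:R / (2 ^ k)%:R) * (pi / 2).

(* The properties of [X |-> X^(j / 2^k)], and of its images under positive maps, that enter the
   minimum principle: values in a sector, regularity, homogeneity, self-adjointness. *)
Definition sectorial k j n l (Q : 'M[C]_n -> 'M[C]_l) : Prop :=
  [/\ forall (sg : R) X, `|sg| = 1 -> acc X -> psd (hrm (cis (sg * ang k j) *: Q X)),
      forall F : C -> 'M[C]_n, reg 3 F -> acc (F 0) -> reg 3 (fun z => Q (F z)),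
      forall s z : C, z != 0 ->
        (forall n' (X : 'M[C]_n'), acc X -> acc (s *: X) -> dyroot k (s *: X) = z *: dyroot k X) ->
        forall X, acc X -> acc (s *: X) -> Q (s *: X) = z ^+ j *: Q X &
      forall A, posdef A -> adj (Q A) = Q A].

(** Pair each rotated Hermitian part of [M] with the oppositely rotated one of [N]: both products
    have nonnegative trace. In their sum the mixed terms [M adj N] and [adj M N] carry
    [cis (pi/2) + cis (- pi/2) = 0], and [4 sin (2 th)] times the real trace of [M N] remains. *)
Lemma sector_trace l (M N : 'M[C]_l) (th : R) : 0 < sin (th + th) ->
  psd (hrm (cis th *: M)) -> psd (hrm (cis (- th) *: M)) ->
  psd (hrm (cis (pi / 2 - th) *: N)) -> psd (hrm (cis (- (pi / 2 - th)) *: N)) ->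
  0 <= rtr (M *m N).
Proof.
move=> s0 pP pQ pP' pQ'.
have h1 := psd_trace2 pP pQ'; have h2 := psd_trace2 pQ pP'.
suff e : rtr (hrm (cis th *: M) *m hrm (cis (- (pi / 2 - th)) *: N)) +
    rtr (hrm (cis (- th) *: M) *m hrm (cis (pi / 2 - th) *: N)) =
    (4 * sin (th + th)) * rtr (M *m N).
  have : 0 <= (4 * sin (th + th)) * rtr (M *m N) by rewrite -e; exact: addr_ge0 h1 h2.
  by rewrite pmulr_rge0// mulr_gt0.
rewrite -rtrD !hrmE !adjZ -!cisN !opprK !mulmxDl !mulmxDr -!scalemxAl -!scalemxAr !scalerA -!cisD.
have -> : th + - (pi / 2 - th) = - (pi / 2 - (th + th)) by ring.
have -> : - th + (pi / 2 - th) = pi / 2 - (th + th) by ring.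
have -> : th + (pi / 2 - th) = pi / 2 by ring.
have -> : - th + - (pi / 2 - th) = - (pi / 2) by ring.
have c1 : cis (pi / 2) + cis (- (pi / 2)) = 0 :> C.
  rewrite cisN /cis cos_pihalf sin_pihalf; apply/eqP; rewrite eq_complex /=.
  by apply/andP; split; apply/eqP; ring.
have c2 : cis (- (pi / 2 - (th + th))) + cis (pi / 2 - (th + th)) = (2 * sin (th + th))%:C :> C.
  rewrite cisN /cis -[cos _]cosN opprB cosBpihalf; apply/eqP; rewrite eq_complex /=.
  by apply/andP; split; apply/eqP; ring.
set x := M *m N; have xx : rtr (adj M *m adj N) = rtr x by rewrite rtrC -adjM rtrJ.
move: (M *m adj N) (adj M *m N) (adj M *m adj N) xx => y w v xx.
move: (cis (pi / 2)) (cis (- (pi / 2))) (cis (- (pi / 2 - (th + th)))) (cis (pi / 2 - (th + th))) c1 c2.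
move=> a b c d ab cd.
have -> : c *: x + a *: y + (b *: w + d *: v) + (d *: x + b *: y + (a *: w + c *: v)) =
    (c + d) *: x + (a + b) *: (y + w) + (c + d) *: v.
  by apply/matrixP => i j; rewrite !mxE; ring.
by rewrite ab scale0r addr0 cd rtrD !rtrZ xx; ring.
Qed.

Lemma hrm_skew n (H : 'M[C]_n) : adj H = H -> hrm ((- 'i) *: H) = 0.
Proof.
move=> hH; rewrite hrmE adjZ hH -scalerDl.
have -> : - 'i + conjc (- 'i) = 0 :> C.
  by apply/eqP; rewrite eq_complex /=; apply/andP; split; apply/eqP; ring.
by rewrite scale0r.
Qed.

Lemma pencil_acc n (A H : 'M[C]_n) (s : C) : posdef A -> adj H = H -> 0 < complex.Re s ->
  acc (s *: A + (- 'i) *: H).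
Proof.
move=> pA hH s0; rewrite /acc hrmD (hrm_skew hH) addr0 hrmE adjZ (posdef_herm pA) -scalerDl.
have -> : s + conjc s = (complex.Re s + complex.Re s)%:C.
  by case: (s) => a b; apply/eqP; rewrite eq_complex /=; apply/andP; split; apply/eqP; ring.
by apply: posdefZ pA; rewrite addr_gt0.
Qed.

Lemma sreg_tr l (F : C -> 'M[C]_l) : reg 3 F -> sreg (fun z => \tr (F z)).
Proof.
pose g := fun M : 'M[C]_l => (\tr M)%:M : 'M[C]_1.
have gl : linear g.
  move=> a x y; rewrite /g linearP /=; apply/matrixP => i j; rewrite !mxE.
  by rewrite mulrnDl mulrnAr.
pose gL := GRing.isLinear.Build _ _ _ _ g gl.
pose gg : {linear 'M[C]_l -> 'M[C]_1} := HB.pack g gL.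
exact: (reg_linear (k := 3) gg).
Qed.

Lemma Im_le_nz (x : C) (e : R) : 0 <= e -> nz x <= e ^+ 2 -> `|complex.Im x| <= e.
Proof.
move=> e0 h; rewrite -ler_sqr ?nnegrE// real_normK ?num_real//.
by apply: le_trans h; rewrite lerDr sqr_ge0.
Qed.

Lemma acc_posdef n (X : 'M[C]_n) : adj X = X -> acc X -> posdef X.
Proof.
move=> hX; rewrite /acc hrmE hX => h.
have := posdefZ (_ : 0 < 2^-1) h; rewrite invr_gt0 half_half; apply.
exact: ltr0n.
Qed.

Lemma le0_small (x k d : R) : 0 < k -> 0 < d -> (forall h, 0 < h <= d -> x <= k * h) -> x <= 0.
Proof.
move=> k0 d0 hx; rewrite leNgt; apply/negP => x0.
pose h := Num.min d (x / (2 * k)).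
have h0 : 0 < h by rewrite lt_min d0 divr_gt0// mulr_gt0.
have h1 : h <= d by rewrite ge_min lexx.
have h2 : h <= x / (2 * k) by rewrite ge_min lexx orbT.
have := hx h; rewrite h0 h1 => /(_ isT) => h3.
have : k * h <= x / 2.
  have -> : x / 2 = k * (x / (2 * k)) by field; rewrite gt_eqF.
  by rewrite ler_pM2l.
lra.
Qed.

Section Local.
Variables (k j n m l : nat).
Variables (Q : 'M[C]_n -> 'M[C]_l) (Q' : 'M[C]_m -> 'M[C]_l).
Hypotheses (jk : (0 < j < 2 ^ k)%N) (sQ : sectorial k j Q) (sQ' : sectorial k (2 ^ k - j) Q').
Variables (A H : 'M[C]_n) (B K : 'M[C]_m).
Hypotheses (pA : posdef A) (pB : posdef B) (hH : adj H = H) (hK : adj K = K).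

Let chi (s : C) : C := \tr (Q (s *: A + (- 'i) *: H) *m Q' (s *: B + (- 'i) *: K)).
Let psi (z : C) : C := \tr (Q (A + z *: H) *m Q' (B + z *: K)).

Let chi_reg (s : C) : 0 < complex.Re s -> sreg (fun z => chi (s + z)).
Proof.
move=> s0; apply: sreg_tr; have [_ r _ _] := sQ; have [_ r' _ _] := sQ'.
apply: regM.
  have -> : (fun z => Q ((s + z) *: A + (- 'i) *: H)) =
            (fun z => Q ((s *: A + (- 'i) *: H) + z *: A)).
    by apply/funext => z; rewrite scalerDl addrAC.
  apply: r; first exact: reg_affine.
  by rewrite scale0r addr0; exact: pencil_acc.
have -> : (fun z => Q' ((s + z) *: B + (- 'i) *: K)) =
          (fun z => Q' ((s *: B + (- 'i) *: K) + z *: B)).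
  by apply/funext => z; rewrite scalerDl addrAC.
apply: r'; first exact: reg_affine.
by rewrite scale0r addr0; exact: pencil_acc.
Qed.

Let psi_reg : sreg psi.
Proof.
apply: sreg_tr; have [_ r _ _] := sQ; have [_ r' _ _] := sQ'.
apply: regM; [apply: r | apply: r']; rewrite ?scale0r ?addr0; try exact: reg_affine.
  exact: posdef_acc.
exact: posdef_acc.
Qed.

Let chi_ge0 (s : C) : 0 < complex.Re s -> 0 <= complex.Re (chi s).
Proof.
move=> s0; have [a _ _ _] := sQ; have [a' _ _ _] := sQ'.
have p0 : (2 ^ k)%:R != 0 :> R by rewrite pnatr_eq0 expn_eq0.
have /andP[j0 j1] := jk.
have e : ang k (2 ^ k - j) = pi / 2 - ang k j.
  by rewrite /ang natrB ?(ltnW j1)//; field.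
have n1 : `|1 : R| = 1 by rewrite normr1.
have n2 : `|- 1 : R| = 1 by rewrite normrN normr1.
have aX := pencil_acc pA hH s0; have aY := pencil_acc pB hK s0.
have := a 1 _ n1 aX; have := a (-1) _ n2 aX; have := a' 1 _ n1 aY; have := a' (-1) _ n2 aY.
rewrite !mul1r !mulN1r e => h1 h2 h3 h4; apply: (sector_trace _ h4 h3 h2 h1).
have q0 : 0 < j%:R / (2 ^ k)%:R :> R by rewrite divr_gt0 ?ltr0n ?expn_gt0.
have q1 : j%:R / (2 ^ k)%:R < 1 :> R by rewrite ltr_pdivrMr ?ltr0n ?expn_gt0// mul1r ltr_nat.
apply: sin_gt0_pi; rewrite /ang; move: (j%:R / (2 ^ k)%:R) q0 q1 => q q0 q1.
by have := pi_gt0 R; move: (pi : R) => p p0'; apply/andP; split; nra.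
Qed.

(** Homogeneity: the factors [z^j] and [z^(2^k - j)] of the two maps multiply to [s]. *)
Let chi_psi (s : C) : 0 < complex.Re s -> acc (A + (- 'i / s) *: H) -> acc (B + (- 'i / s) *: K) ->
  chi s = s * psi (- 'i / s).
Proof.
move=> s0 aX aY; have sn0 : s != 0 by apply: contraTneq s0 => ->; rewrite ltxx.
have e1 n' (X Y : 'M[C]_n') : s *: X + (- 'i) *: Y = s *: (X + (- 'i / s) *: Y).
  by rewrite scalerDr scalerA mulrC divfK.
have [z zs [z0 hz]] := dyroot_scale k s0.
have zn0 : z != 0 by apply: contraTneq z0 => ->; rewrite ltxx.
have [_ _ h _] := sQ; have [_ _ h' _] := sQ'.
have aX' := pencil_acc pA hH s0; have aY' := pencil_acc pB hK s0.
rewrite /chi; rewrite !e1 in aX' aY' *.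
rewrite (h _ _ zn0 hz _ aX aX') (h' _ _ zn0 hz _ aY aY') -scalemxAl -scalemxAr scalerA.
have /andP[j0 j1] := jk.
by rewrite -exprD subnKC ?(ltnW j1)// zs mxtraceZ.
Qed.

Let psi_real (h : R) : posdef (A + h%:C *: H) -> posdef (B + h%:C *: K) ->
  complex.Im (psi h%:C) = 0.
Proof.
move=> pa pb; have [_ _ _ d] := sQ; have [_ _ _ d'] := sQ'.
rewrite /psi; move: (d _ pa) (d' _ pb); move: (Q _) (Q' _) => M N hM hN.
have : conjc (\tr (M *m N)) = \tr (M *m N).
  rewrite -[in RHS]hM -[in RHS]hN -adjM mxtrace_mulC /mxtrace rmorph_sum.
  by apply: eq_bigr => i _; rewrite adjE.
by case: (\tr _) => a b [] /eqP; rewrite eq_sym -subr_eq0 opprK -mulr2n mulrn_eq0 => /eqP.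
Qed.

Let near_acc : near0 (fun z => acc (A + z *: H) /\ acc (B + z *: K)).
Proof.
apply: near0_and; apply: acc_near_acc; try exact: reg_affine; rewrite scale0r addr0; exact: posdef_acc.
Qed.

Lemma core_local : exists a b c r : R, [/\ b <= 0, 0 < c, 0 < r &
  forall h : R, `|h| <= r ->
    `|complex.Re (psi h%:C) - complex.Re (psi 0) - a * h - b * h ^+ 2| <= c * `|h| ^+ 3].
Proof.
have [c1 [c2 [E [c0 hE]]]] := sreg_expand psi_reg.
pose c : R := `|c0| + 1; have c00 : 0 < c by rewrite ltr_wpDl.
have cE z : nz (E z) <= c0 -> nz (E z) <= c ^+ 2.
  move=> h; apply: le_trans h _; apply: le_trans (ler_norm c0) _.
  by rewrite /c expr2; have := normr_ge0 c0; nra.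
have [d d0 hd] := near0_and hE near_acc.
have hd1 (h : R) : `|h| <= Num.sqrt d -> h ^+ 2 <= d.
  move=> hh; rewrite -[d]sqr_sqrtr ?(ltW d0)// -[h ^+ 2]real_normK ?num_real//.
  by rewrite ler_sqr ?nnegrE ?sqrtr_ge0.
have r0 : 0 < Num.sqrt d by rewrite sqrtr_gt0.
have p0 : complex.Im (psi 0) = 0.
  by have := @psi_real 0; rewrite !scale0r !addr0; apply.
have hreal (h : R) : `|h| <= Num.sqrt d -> complex.Im (psi h%:C) = 0.
  move=> hh; have [|_ [aX aY]] := hd h%:C; first by rewrite nz_real hd1.
  by apply: psi_real; apply: acc_posdef => //; rewrite adjD adjZ conjc_real ?hH ?hK posdef_herm.
(* [psi] is real on the real axis near 0, hence its first coefficient is real. *)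
have im1 : complex.Im c1 = 0.
  have kk : 0 < `|complex.Im c2| + c by rewrite ltr_wpDl.
  apply/eqP; rewrite -normr_le0; apply: (@le0_small _ _ (Num.min (Num.sqrt d) 1) kk).
    by rewrite lt_min r0 ltr01.
  move=> h /andP[h0]; rewrite le_min => /andP[hr h1].
  have hn : `|h| <= Num.sqrt d by rewrite gtr0_norm.
  have [|[e1 bE] _] := hd h%:C; first by rewrite nz_real hd1.
  have := hreal h hn; rewrite e1; have := Im_le_nz (ltW c00) (cE _ bE).
  move: p0; case: (psi 0) => x1 y1 /= ->; case: (E _) => x2 y2 /=; case: (c1) => x3 y3 /=.
  case: (c2) => x4 y4 /= b2 e2.
  have e3 : h * y3 = - (h * (h * (y4 + h * y2))) by apply/eqP; rewrite -subr_eq0; apply/eqP; rewrite -[RHS]e2; ring.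
  have e4 : y3 = - (h * (y4 + h * y2)) by apply: (mulfI (lt0r_neq0 h0)); rewrite e3 mulrN.
  rewrite e4 normrN normrM (gtr0_norm h0) mulrC ler_pM2r//.
  apply: le_trans (ler_normD _ _) _; rewrite lerD2l normrM (gtr0_norm h0).
  by apply: le_trans b2; rewrite ler_piMl.
have inv_nz (s : C) : 0 < complex.Re s -> nz (- 'i / s) = (nz s)^-1.
  move=> s0; have ns : 0 < nz s by rewrite /nz ltr_wpDr ?sqr_ge0// exprn_gt0.
  have sn0 : s != 0 by apply: contraTneq s0 => ->; rewrite ltxx.
  apply: (mulIf (lt0r_neq0 ns)); rewrite -nzM divfK// mulVf ?gt_eqF//.
  by rewrite /nz /= oppr0 expr0n sqrrN expr1n add0r.
(* For large [s], [chi s = s psi(0) - i c1 + O(1/s)], and [-i c1] is purely imaginary: this is the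
   behaviour at infinity that the minimum principle asks for. *)
have hp : forall s : C, 0 < complex.Re s -> complex.Re (psi 0) * complex.Re s <= complex.Re (chi s).
  apply: (half_plane_minimum chi_reg chi_ge0) => e e0.
  pose W : R := 2 * (nz c2 + c ^+ 2) + 1.
  have n2 := nz_ge0 c2; have n3 : 0 < c ^+ 2 by rewrite exprn_gt0.
  have W0 : 0 < W by rewrite /W; lra.
  pose L : R := Num.min (Num.min d 1) (e ^+ 2 / W).
  have L0 : 0 < L by rewrite !lt_min d0 ltr01 divr_gt0// exprn_gt0.
  exists L^-1 => s s0 sL.
  have ns : 0 < nz s by apply: lt_le_trans sL; rewrite invr_gt0.
  have sn0 : s != 0 by apply: contraTneq s0 => ->; rewrite ltxx.
  pose z : C := - 'i / s.
  have zL : nz z <= L by rewrite inv_nz// -[L]invrK lef_pV2 ?posrE ?invr_gt0.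
  have [z1 z2 z3] : [/\ nz z <= d, nz z <= 1 & nz z <= e ^+ 2 / W].
    by split; apply: le_trans zL _; rewrite !ge_min lexx ?orbT.
  have [[e1 bE] [aX aY]] := hd z z1.
  rewrite chi_psi// -/z e1.
  pose w := z * c2 + z ^+ 2 * E z.
  have -> : s * (psi 0 + z * c1 + z ^+ 2 * c2 + z ^+ 3 * E z) =
      s * psi 0 + (- 'i) * c1 + (- 'i) * w.
    have sz : s * z = - 'i by rewrite /z mulrC divfK.
    by rewrite -sz /w; ring.
  have nw : nz (- 'i * w) <= e ^+ 2.
    have ni : nz (- 'i : C) = 1 by rewrite /nz /= oppr0 expr0n sqrrN expr1n add0r.
    rewrite nzM ni mul1r /w; clearbody z; apply: le_trans (nzD _ _) _.
    rewrite (nzM z c2) (nzM (z ^+ 2)) (_ : nz (z ^+ 2) = nz z * nz z); last by rewrite expr2 nzM.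
    have q1 : nz z * nz z * nz (E z) <= nz z * c ^+ 2.
      rewrite -mulrA ler_wpM2l ?nz_ge0//; apply: le_trans (cE _ bE).
      by rewrite ler_piMl ?nz_ge0.
    apply: (@le_trans _ _ (nz z * W)); last by rewrite -ler_pdivlMr.
    have := nz_ge0 z; rewrite /W; nra.
  have := Re_le_nz (ltW e0) nw; rewrite ler_norml => /andP[h1 _].
  rewrite !ReD; move: h1 p0 im1; case: (psi 0) => x1 y1; case: (c1) => x2 y2 /= h1 -> ->.
  by case: (s) => x3 y3 /=; move: h1; move: (complex.Re _) => r h1; lra.
(* Evaluate at [s = 1/h], that is [z = -i h]: there [z^2 c2] has real part [-h^2 Re c2], and [hp]
   leaves [Re c2 <= c h]. *)
have c2le : complex.Re c2 <= 0.
  apply: (le0_small c00 r0) => h /andP[h0 hr].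
  pose z : C := - 'i * h%:C; have nzz : nz z = h ^+ 2 by rewrite /z /nz /=; ring.
  have hh0 : h%:C != 0 :> C by apply/eqP => -[] /eqP; rewrite gt_eqF.
  have [|[e1 bE] [aX aY]] := hd z; first by rewrite nzz hd1// gtr0_norm.
  pose s : C := (h^-1)%:C; have s0 : 0 < complex.Re s by rewrite /= invr_gt0.
  have zs : - 'i / s = z by rewrite /s fmorphV invrK.
  have := hp s s0; rewrite chi_psi ?zs// /s ReZ /= mulrC ler_pM2l ?invr_gt0// e1.
  have := Im_le_nz (ltW c00) (cE _ bE); rewrite ler_norml => /andP[h1 _].
  move: h1 p0 im1; rewrite /z; case: (psi 0) => x1 y1; case: (c1) => x2 y2 /= h1 -> ->.
  move: h1; case: (c2) => x3 y3 /=; case: (E _) => x4 y4 /= h1 h2.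
  have : h ^+ 2 * x3 <= h ^+ 2 * (c * h).
    have : h ^+ 3 * - y4 <= h ^+ 3 * c by rewrite ler_pM2l ?exprn_gt0//; lra.
    by move: h2; rewrite !exprS expr0; lra.
  by rewrite ler_pM2l ?exprn_gt0.
exists (complex.Re c1), (complex.Re c2), c, (Num.sqrt d); split=> // h hh.
have [|[e1 bE] _] := hd h%:C; first by rewrite nz_real hd1.
have := Re_le_nz (ltW c00) (cE _ bE); rewrite e1.
have -> : complex.Re (psi 0 + h%:C * c1 + h%:C ^+ 2 * c2 + h%:C ^+ 3 * E h%:C) -
    complex.Re (psi 0) - complex.Re c1 * h - complex.Re c2 * h ^+ 2 = complex.Re (E h%:C) * h ^+ 3.
  by rewrite !ReD -!rmorphXn !ReZ; ring.
by move=> hb; rewrite normrM normrX ler_wpM2r// exprn_ge0.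
Qed.
End Local.

Lemma sectorial_concave k j n m l (Q : 'M[C]_n -> 'M[C]_l) (Q' : 'M[C]_m -> 'M[C]_l) :
  (0 < j < 2 ^ k)%N -> sectorial k j Q -> sectorial k (2 ^ k - j) Q' ->
  forall A1 A2 B1 B2 (t : R), posdef A1 -> posdef A2 -> posdef B1 -> posdef B2 -> 0 <= t <= 1 ->
  (1 - t) * rtr (Q A1 *m Q' B1) + t * rtr (Q A2 *m Q' B2) <=
  rtr (Q ((1 - t)%:C *: A1 + t%:C *: A2) *m Q' ((1 - t)%:C *: B1 + t%:C *: B2)).
Proof.
move=> jk sQ sQ' A1 A2 B1 B2 t pA1 pA2 pB1 pB2 t01.
pose g (t : R) : R := complex.Re (\tr (Q ((1 - t)%:C *: A1 + t%:C *: A2) *m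
  Q' ((1 - t)%:C *: B1 + t%:C *: B2))).
have g0 : g 0 = rtr (Q A1 *m Q' B1) by rewrite /g subr0 !scale0r !scale1r !addr0 rtrE.
have g1 : g 1 = rtr (Q A2 *m Q' B2) by rewrite /g subrr !scale0r !scale1r !add0r rtrE.
rewrite -g0 -g1 rtrE; apply: (@concave_of_local _ g _ t t01) => u u01.
have pA := posdef_convex u01 pA1 pA2; have pB := posdef_convex u01 pB1 pB2.
have hA : adj (A2 - A1) = A2 - A1 by rewrite adjB !posdef_herm.
have hB : adj (B2 - B1) = B2 - B1 by rewrite adjB !posdef_herm.
have [a [b [c [r [b0 c0 r0 h]]]]] := core_local jk sQ sQ' pA pB hA hB.
exists a, b, c, r; split; [exact: b0 | exact: c0 | exact: r0 |].
move=> x xr; have := h x xr; rewrite !scale0r !addr0 /g.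
have e n' (X Y : 'M[C]_n') : (1 - (u + x))%:C *: X + (u + x)%:C *: Y =
    (1 - u)%:C *: X + u%:C *: Y + x%:C *: (Y - X).
  by apply/matrixP => i i'; rewrite !mxE !rmorphB !rmorphD rmorph1 /=; ring.
by rewrite !e.
Qed.
End Core.

(** * Positive maps and arbitrary exponents *)

Section PositiveMaps.
Variable R : realType.
Local Notation C := R[i].
Implicit Types (m n k l : nat).

Section OneMap.
Variables (n l : nat) (Phi : {linear 'M[C]_n -> 'M[C]_l}).
Hypothesis sp : strictly_positive Phi.

Lemma pos_psd (P : 'M[C]_n) : psd P -> psd (Phi P).
Proof.
move=> pP; have h e : 0 < e -> posdef (Phi P + e%:C *: Phi 1%:M).
  move=> e0; rewrite -linearZ -linearD; apply: sp; rewrite scalemx1.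
  exact: ((psd_perturb P).1 pP e e0).
split.
  have p1 := posdef_herm (sp (posdef1 R n)).
  have := posdef_herm (h 1 ltr01); rewrite scale1r adjD p1.
  exact: addIr.
move=> x; have q1 := psd_qf x (posdef_psd (sp (posdef1 R n))).
rewrite -oppr_le0; apply: (@le0_small _ _ (qf (Phi 1%:M) x + 1) 1) => //.
  by rewrite ltr_wpDl.
move=> e /andP[e0 _]; have := psd_qf x (posdef_psd (h e e0)); rewrite qfD qfZ.
move: (qf _ _) (qf _ _) q1 => a b b0 hab.
have -> : (b + 1) * e = e * b + e by ring.
lra.
Qed.

Lemma pos_herm0 (H : 'M[C]_n) : adj H = H -> adj (Phi H) = Phi H.
Proof.
(* Young's inequality gives [H >= -c], so [H] is a difference of positive matrices. *)
move=> hH; pose c : R := 2^-1 * (1 + fn H).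
have pc : psd (H + c%:C%:M).
  split; first by rewrite adjD adj_scalar conjc_real hH.
  move=> x; rewrite qfD qf_scalar.
  have := young_rtr x ((- H) *m x) ltr01; rewrite mulNmx fnN mulmxN rtrN mulmxA.
  rewrite -[rtr (adj x *m H *m x)]/(qf H x) divr1 mul1r => h1.
  have h2 := fnM_le H x.
  have -> : c * fn x = 2^-1 * (fn x + fn H * fn x).
    by rewrite /c; move: (fn x) (fn H) => a b; ring.
  move: h1 h2; move: (qf H x) (fn x) (fn (H *m x)) (fn H * fn x) => a b d e; lra.
have e : Phi H = Phi (H + c%:C%:M) - c%:C *: Phi 1%:M.
  by rewrite -linearZ scalemx1 -linearB addrK.
rewrite e adjB adjZ conjc_real (psd_herm (pos_psd pc)).
by rewrite (posdef_herm (sp (posdef1 R n))).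
Qed.

Lemma pos_adj (M : 'M[C]_n) : adj (Phi M) = Phi (adj M).
Proof.
pose u : C := 0 +i* 1.
have u1 : u * - u = 1 by apply/eqP; rewrite eq_complex /=; apply/andP; split; apply/eqP; ring.
have u2 : u * u = - 1 by apply/eqP; rewrite eq_complex /=; apply/andP; split; apply/eqP; ring.
have u3 : conjc (- u) = u by apply/eqP; rewrite eq_complex /=; apply/andP; split; apply/eqP; ring.
have u4 : conjc u = - u by apply/eqP; rewrite eq_complex /=; apply/andP; split; apply/eqP; ring.
pose H1 := hrm M; pose H2 := hrm ((- u) *: M).
have eM : M = 2^-1%:C *: (H1 + u *: H2).
  rewrite /H1 /H2 !hrmE adjZ u3 [u *: (_ + _)]scalerDr ![u *: (_ *: _)]scalerA u1 u2 scale1r scaleN1r.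
  by rewrite addrACA subrr addr0 half_half.
have h1 := pos_herm0 (hrm_herm M); have h2 := pos_herm0 (hrm_herm ((- u) *: M)).
have eA : adj M = 2^-1%:C *: (H1 - u *: H2).
  rewrite {1}eM adjZ conjc_real adjD adjZ u4 scaleNr.
  by rewrite (hrm_herm M) (hrm_herm ((- u) *: M)).
have e1 : Phi M = 2^-1%:C *: (Phi H1 + u *: Phi H2).
  by rewrite {1}eM linearZ linearD linearZ.
by rewrite e1 eA linearZ linearB linearZ adjZ conjc_real adjD adjZ h1 h2 u4 scaleNr.
Qed.

Lemma pos_hrm c (M : 'M[C]_n) : hrm (c *: Phi M) = Phi (hrm (c *: M)).
Proof. by rewrite !hrmE linearD -pos_adj linearZ. Qed.

Lemma pos_acc c (M : 'M[C]_n) : acc (c *: M) -> acc (c *: Phi M).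
Proof. by rewrite /acc pos_hrm; apply: sp. Qed.
End OneMap.

(** The Hermitian part of the inverse is congruent to that of [X]:
    [hrm (X^-1) = X^-1 (hrm X) (adj X)^-1]. *)
Lemma acc_inv n (X : 'M[C]_n) : acc X -> acc (invmx X).
Proof.
move=> aX; have uX := acc_unit aX.
have e : hrm (invmx X) = adj (adj (invmx X)) *m hrm X *m adj (invmx X).
  rewrite !hrmE adjK mulmxDr mulmxDl (mulVmx uX) mul1mx -mulmxA -adjM (mulVmx uX).
  by rewrite adj1 mulmx1 addrC.
rewrite /acc e; apply: posdef_congr_unit; last exact: aX.
by rewrite adj_unit unitmx_inv.
Qed.

Lemma cis_neq0 (a : R) : cis a != 0.
Proof.
apply/eqP => h; have := cisD a (- a); rewrite subrr cis0 h mul0r => /eqP.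
by rewrite oner_eq0.
Qed.

Lemma cisV (a : R) : (cis a)^-1 = cis (- a).
Proof.
by apply: (mulfI (cis_neq0 a)); rewrite mulfV ?cis_neq0// -cisD subrr cis0.
Qed.

Lemma acc_scale_unit n c (M : 'M[C]_n) : c != 0 -> acc (c *: M) -> M \in unitmx.
Proof. by move=> c0 /acc_unit; rewrite unitmxZ// unitfE. Qed.

Lemma acc_cis_inv n (a : R) (M : 'M[C]_n) : acc (cis a *: M) -> acc (cis (- a) *: invmx M).
Proof. by move=> h; have := acc_inv h; rewrite (invmxZ (acc_unit h)) cisV. Qed.

Lemma reg_scale m n k c (F : C -> 'M[C]_(m, n)) : reg k F -> reg k (fun z => c *: F z).
Proof.
move=> r; apply: reg_eq (regM (reg_const k (c%:M)) r).
by apply: near0T => z; rewrite mul_scalar_mx.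
Qed.

Lemma reg_inv_scale n k c (F : C -> 'M[C]_n) : c != 0 -> reg k.+1 F -> acc (c *: F 0) ->
  reg k.+1 (fun z => invmx (F z)).
Proof.
move=> c0 r a; have r1 := reg_scale c r.
have h := acc_near_acc (reg_le (isT : (1 <= k.+1)%N) r1) a.
apply: reg_eq (reg_scale c (reg_inv r1 a)); apply: near0_imp h => z az.
by rewrite (invmxZ (acc_unit az)) scalerA (mulfV c0) scale1r.
Qed.

Definition dypow k j n (X : 'M[C]_n) := mxp (dyroot k X) j.

Lemma dypow_sector n (X : 'M[C]_n) (sg : R) k j : `|sg| = 1 -> acc X -> (0 < j <= 2 ^ k)%N ->
  acc (cis (sg * ang R k j) *: dypow k j X).
Proof. exact: dyroot_sector. Qed.

Lemma dypow_unit n (X : 'M[C]_n) k j : acc X -> (0 < j <= 2 ^ k)%N -> dypow k j X \in unitmx.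
Proof.
move=> aX hj; apply: (acc_scale_unit (cis_neq0 _) (dypow_sector (normr1 R) aX hj)).
Qed.

Lemma reg_dypow n k j (F : C -> 'M[C]_n) : reg 3 F -> acc (F 0) ->
  reg 3 (fun z => dypow k j (F z)).
Proof. by move=> r a; apply/reg_mxp/reg_dyroot. Qed.

Lemma dypow_scale n k j s z (X : 'M[C]_n) : dyroot k (s *: X) = z *: dyroot k X ->
  dypow k j (s *: X) = z ^+ j *: dypow k j X.
Proof. by rewrite /dypow => ->; rewrite mxpZ. Qed.

Lemma dyroot_posdef n k (A : 'M[C]_n) : posdef A ->
  dyroot k A = mx_pow ((2 ^ k)%:R^-1) A.
Proof.
move=> pA; elim: k => [|k ih]; first by rewrite expn0 invr1 (mx_pow1 pA).
rewrite /dyroot iterS -/(dyroot k A) ih; apply: mx_root_eq.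
  exact: posdef_acc (mx_pow_posdef _ pA).
rewrite -(mx_powD _ _ pA).
suff -> : (2 ^ k.+1)%:R^-1 + (2 ^ k.+1)%:R^-1 = (2 ^ k)%:R^-1 :> R by exact: erefl.
by rewrite expnS natrM; have := @pnatr_eq0 R (2 ^ k); rewrite expn_eq0 /= => h; field; rewrite h.
Qed.

Lemma mxp_mx_pow n (A : 'M[C]_n) (p : R) j : posdef A -> mxp (mx_pow p A) j = mx_pow (j%:R * p) A.
Proof.
move=> pA; elim: j => [|j ih]; first by rewrite mul0r (mx_pow0 pA).
rewrite -[mxp _ j.+1]/(mxp _ j *m _) ih -(mx_powD _ _ pA).
suff -> : j%:R * p + p = j.+1%:R * p :> R by exact: erefl.
by rewrite -natr1; ring.
Qed.

Lemma dypow_posdef n k j (A : 'M[C]_n) : posdef A ->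
  dypow k j A = mx_pow (j%:R / (2 ^ k)%:R) A.
Proof. by move=> pA; rewrite /dypow dyroot_posdef// mxp_mx_pow. Qed.

Section Sectorial.
Variables (n l m : nat) (Phi : {linear 'M[C]_n -> 'M[C]_l}) (v : 'M[C]_(l, m)).
Hypothesis sp : strictly_positive Phi.

Lemma hrm_scale_congr c (M : 'M[C]_l) :
  hrm (c *: (adj v *m M *m v)) = adj v *m hrm (c *: M) *m v.
Proof. by rewrite -hrm_congr -scalemxAr -scalemxAl. Qed.

Lemma reg_congr k (F : C -> 'M[C]_l) : reg k F -> reg k (fun z => adj v *m F z *m v).
Proof. by move=> r; exact: (regM (regM (reg_const k _) r) (reg_const k _)). Qed.

Lemma sectorial_map k j : (0 < j <= 2 ^ k)%N ->
  sectorial k j (fun X => adj v *m Phi (dypow k j X) *m v).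
Proof.
move=> hj; split.
- move=> sg X hs aX; rewrite hrm_scale_congr; apply: psd_congr.
  exact: (posdef_psd (pos_acc sp (dypow_sector hs aX hj))).
- by move=> F r a; apply: reg_congr; apply: reg_linear; apply: reg_dypow.
- move=> s z _ h X aX asX; rewrite (dypow_scale _ (h _ _ aX asX)).
  by rewrite linearZ -scalemxAr -scalemxAl.
- move=> A pA; rewrite !adjM adjK mulmxA (dypow_posdef _ _ pA).
  by rewrite (posdef_herm (sp (mx_pow_posdef _ pA))).
Qed.

Lemma dypow_inv_sector (sg : R) (X : 'M[C]_n) k j : `|sg| = 1 -> acc X -> (0 < j <= 2 ^ k)%N ->
  acc (cis (- (sg * ang R k j)) *: Phi (invmx (dypow k j X))).
Proof. by move=> hs aX hj; apply/(pos_acc sp)/acc_cis_inv; exact: (dypow_sector hs aX hj). Qed.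

(** Inversion reverses the rotation, [Phi] keeps it, and the second inversion restores it, so the
    sector is that of [dypow k j X]. *)
Lemma sectorial_map_inv k j : (0 < j <= 2 ^ k)%N ->
  sectorial k j (fun X => adj v *m invmx (Phi (invmx (dypow k j X))) *m v).
Proof.
move=> hj; split.
- move=> sg X hs aX; rewrite hrm_scale_congr; apply: psd_congr.
  have h := acc_cis_inv (dypow_inv_sector hs aX hj).
  by rewrite opprK in h; exact: (posdef_psd h).
- move=> F r a; apply: reg_congr.
  apply: (reg_inv_scale (cis_neq0 _) _ (dypow_inv_sector (normr1 R) a hj)).
  apply: reg_linear.
  exact: (reg_inv_scale (cis_neq0 _) (reg_dypow k j r a) (dypow_sector (normr1 R) a hj)).
- move=> s z z0 h X aX asX; rewrite (dypow_scale _ (h _ _ aX asX)).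
  have zj : z ^+ j \is a GRing.unit by rewrite unitfE expf_neq0.
  have uS := dypow_unit aX hj.
  have uP : Phi (invmx (dypow k j X)) \in unitmx.
    exact: (acc_scale_unit (cis_neq0 _) (dypow_inv_sector (normr1 R) aX hj)).
  have u1 : z ^+ j *: dypow k j X \in unitmx by rewrite unitmxZ.
  have u2 : (z ^+ j)^-1 *: Phi (invmx (dypow k j X)) \in unitmx by rewrite unitmxZ ?unitrV.
  rewrite (invmxZ u1) linearZ (invmxZ u2) invrK.
  by rewrite -scalemxAr -scalemxAl.
- move=> A pA; rewrite !adjM adjK mulmxA (dypow_posdef _ _ pA) (mx_powV _ pA).
  by rewrite (posdef_herm (posdef_inv (sp (mx_pow_posdef _ pA)))).
Qed.
End Sectorial.

Lemma sectorial_dypow m k j : (0 < j <= 2 ^ k)%N -> sectorial k j (@dypow k j m).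
Proof.
move=> hj; split.
- by move=> sg X hs aX; exact: (posdef_psd (dypow_sector hs aX hj)).
- by move=> F r a; apply: reg_dypow.
- by move=> s z _ h X aX asX; rewrite (dypow_scale _ (h _ _ aX asX)).
- by move=> A pA; rewrite (dypow_posdef _ _ pA) (posdef_herm (mx_pow_posdef _ pA)).
Qed.
End PositiveMaps.

(** * Continuity in the exponent and passage from dyadic to real exponents *)

Section Interpolation.
Variable R : realType.
Local Notation C := R[i].
Implicit Types (m n k l : nat).

(** For [D = Q - P] the difference of inverses is [Q^-1 D Q^-1 + adj (D Q^-1) P^-1 (D Q^-1)], a sum
    of two positive congruences. *)
Lemma psd_inv_anti n (P Q : 'M[C]_n) : posdef P -> posdef Q -> psd (Q - P) ->
  psd (invmx P - invmx Q).
Proof.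
move=> pP pQ hD; have hP := posdef_herm pP; have hQ := posdef_herm pQ.
have uP := posdef_unit pP; have uQ := posdef_unit pQ.
have hiQ : adj (invmx Q) = invmx Q by rewrite adj_inv hQ.
set D := Q - P in hD; have hDa := psd_herm hD.
have e1 : invmx P - invmx Q = invmx Q *m D *m invmx P.
  by rewrite /D mulmxBr mulmxBl (mulVmx uQ) mul1mx -mulmxA (mulmxV uP) mulmx1.
have e2 : invmx P = invmx Q + invmx P *m D *m invmx Q.
  by rewrite /D mulmxBr mulmxBl (mulVmx uP) mul1mx -mulmxA (mulmxV uQ) mulmx1 addrC subrK.
have e3 : invmx P - invmx Q =
    adj (invmx Q) *m D *m invmx Q + adj (D *m invmx Q) *m invmx P *m (D *m invmx Q).
  rewrite e1 adjM hDa hiQ.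
  transitivity (invmx Q *m D *m (invmx Q + invmx P *m D *m invmx Q)).
    by rewrite -e2; reflexivity.
  by rewrite mulmxDr !mulmxA; reflexivity.
rewrite e3; apply: psdD; apply: psd_congr; first exact: hD.
exact: posdef_psd (posdef_inv pP).
Qed.

Lemma powR_exp (a x : R) : 0 < a -> a `^ x = expR (x * ln a).
Proof. by move=> a0; rewrite /powR gt_eqF. Qed.

(** On an eigenvalue [x] the claim is [(r' - r) ln x <= s]; the sum of all [|ln x|] serves as
    [B]. *)
Lemma mx_pow_close n (M : 'M[C]_n) : posdef M -> exists2 B : R, 0 <= B &
  forall s r r' : R, B * `|r - r'| <= s ->
    psd ((expR s)%:C *: mx_pow r M - mx_pow r' M).
Proof.
move=> /posdef_spectral[U [d [UU UU' -> d0]]].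
exists (\sum_i `|ln (d 0 i)|); first by apply: sumr_ge0 => i _; exact: normr_ge0.
move=> s r r' hs; rewrite !(mx_pow_spec _ _ UU).
have -> : (expR s)%:C *: (U *m rdiag (map_mx (fun x => x `^ r) d) *m adj U) =
    U *m rdiag (map_mx (fun x => expR s * x `^ r) d) *m adj U.
  rewrite scalemxAl scalemxAr; congr (_ *m _ *m _); apply/matrixP => i j.
  by rewrite mxE !rdiagE !mxE rmorphM mulrnAr.
rewrite conj_rdiagB; apply: psd_conj => i; rewrite !mxE.
rewrite !(powR_exp _ (d0 i)) -expRD subr_ge0 ler_expR.
have hB : `|ln (d 0 i)| <= \sum_i `|ln (d 0 i)|.
  by rewrite (bigD1 i)//= lerDl; apply: sumr_ge0 => ? _; exact: normr_ge0.
have h1 : (r' - r) * ln (d 0 i) <= `|r - r'| * `|ln (d 0 i)|.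
  by rewrite distrC -normrM ler_norm.
have h2 : `|r - r'| * `|ln (d 0 i)| <= (\sum_i `|ln (d 0 i)|) * `|r - r'|.
  by rewrite mulrC ler_wpM2r.
have h3 := le_trans h1 (le_trans h2 hs).
by rewrite mulrBl in h3; rewrite -lerBlDr.
Qed.

Lemma dyadic_dense (p d : R) : 0 <= p <= 1 -> 0 < d ->
  exists k j, (0 < j < 2 ^ k)%N /\ `|j%:R / (2 ^ k)%:R - p| <= d.
Proof.
move=> /andP[p0 p1] d0; pose k := (Num.truncn d^-1).+1.
pose N := (2 ^ k)%N.
have hk : d^-1 <= N%:R :> R.
  apply: ltW; apply: lt_trans (truncnS_gt _) _; rewrite ltr_nat -/k.
  exact: ltn_expl.
have N2 : (2 <= N)%N by rewrite /N expnS leq_pmulr// expn_gt0.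
have N0 : 0 < N%:R :> R by rewrite ltr0n (leq_trans _ N2).
pose x := p * N%:R; pose T := Num.truncn x.
have x0 : 0 <= x by rewrite mulr_ge0// ltW.
have /andP[T1 T2] := truncn_itv x0; rewrite -/T -natr1 in T1 T2.
have xN : x <= N%:R by rewrite /x ler_piMl// ltW.
have TN : (T <= N)%N by rewrite -(ler_nat R) (le_trans T1).
(* The truncation is moved off 0 and [N], so that [p = 0] and [p = 1] too are limits of interior
   dyadics. *)
pose j := (if T == 0 then 1 else if T == N then N.-1 else T)%N.
exists k, j; rewrite -/N; split.
  clear -N2 TN; rewrite /j; case: (eqVneq T 0%N) => [//|T0].
  by case: (eqVneq T N) => h; lia.
have hj : `|j%:R - x| <= 1.
  rewrite ler_norml /j; case: (eqVneq T 0%N) => [T0|T0].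
    by rewrite T0 in T2; lra.
  case: (eqVneq T N) => h; last by lra.
  by move: T1; rewrite h -(@prednK N) ?(leq_trans _ N2)// -natr1 in xN *; lra.
have -> : j%:R / N%:R - p = (j%:R - x) / N%:R by rewrite /x; field; rewrite gt_eqF.
rewrite normrM (gtr0_norm (x := _^-1)) ?invr_gt0// ler_pdivrMr//.
apply: le_trans hj _; rewrite -ler_pdivrMl// mulr1; exact: hk.
Qed.

Lemma le_of_factor (a b : R) : 0 <= b -> (forall s, 0 < s -> a <= expR s * b) -> a <= b.
Proof.
move=> b0 h; rewrite -subr_le0; apply: (@le0_small _ _ (b + 1) 1) => //.
  by rewrite ltr_wpDl.
move=> e /andP[e0 _]; have e1 : 1 < 1 + e by rewrite ltrDl.
have := h (ln (1 + e)) (ln_gt0 e1); rewrite lnK ?posrE; last by rewrite addr_gt0.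
move: a b b0 {h} => a b b0 h; have -> : (b + 1) * e = (1 + e) * b - b + e by ring.
lra.
Qed.

Definition pmean p n l (Q : 'M[C]_n -> 'M[C]_l) m (v : 'M[C]_(l, m)) (A : 'M[C]_n) (Z : 'M[C]_m) :=
  rtr (adj v *m Q A *m v *m mx_pow (1 - p) Z).

Definition pconc p n l (Q : 'M[C]_n -> 'M[C]_l) : Prop :=
  forall m (v : 'M[C]_(l, m)), jointly_concave (pmean p Q v).

(* [Q r A] depends continuously on [r], with multiplicative error in the Loewner order. *)
Definition tame n l (Q : R -> 'M[C]_n -> 'M[C]_l) : Prop :=
  (forall r A, posdef A -> posdef (Q r A)) /\
  (forall A, posdef A -> exists2 B : R, 0 <= B & forall s r r' : R, B * `|r - r'| <= s ->
     psd ((expR s)%:C *: Q r A - Q r' A)).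

Lemma psd_trace_mono m (P P' Z Z' : 'M[C]_m) (e : R) : 0 <= e ->
  psd P -> psd (e%:C *: P' - P) -> psd Z' -> psd (e%:C *: Z' - Z) -> psd Z -> psd P' ->
  rtr (P *m Z) <= e ^+ 2 * rtr (P' *m Z').
Proof.
move=> e0 hP hPP hZ hZZ hZ0 hP'.
have h1 := psd_trace2 hPP hZ0; have h2 := psd_trace2 hP' hZZ.
rewrite mulmxBl rtrB -scalemxAl rtrZ in h1; rewrite mulmxBr rtrB -scalemxAr rtrZ in h2.
move: h1 h2; move: (rtr _) (rtr _) (rtr _) => a b c; rewrite !subr_ge0 => h1 h2.
apply: le_trans h1 _; rewrite expr2 -mulrA; exact: ler_wpM2l.
Qed.

Lemma pmean_close n l (Q : R -> 'M[C]_n -> 'M[C]_l) m (v : 'M[C]_(l, m)) A Z : tame Q ->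
  posdef A -> posdef Z -> exists2 B : R, 0 <= B & forall s r r' : R, B * `|r - r'| <= s ->
    pmean r' (Q r') v A Z <= expR s ^+ 2 * pmean r (Q r) v A Z.
Proof.
move=> [tQ1 tQ2] pA pZ; have [B1 B10 h1] := tQ2 _ pA; have [B2 B20 h2] := mx_pow_close pZ.
exists (B1 + B2) => [|s r r']; first exact: addr_ge0.
rewrite mulrDl => hs.
have n1 : 0 <= B1 * `|r - r'| by rewrite mulr_ge0.
have n2 : 0 <= B2 * `|r - r'| by rewrite mulr_ge0.
have s1 : B1 * `|r - r'| <= s by apply: le_trans hs; rewrite lerDl.
have s2 : B2 * `|(1 - r) - (1 - r')| <= s.
  have -> : (1 - r) - (1 - r') = r' - r by ring.
  by rewrite distrC; apply: le_trans hs; rewrite lerDr.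
apply: psd_trace_mono; first exact: expR_ge0.
- exact: psd_congr (posdef_psd (tQ1 _ _ pA)).
- by have := psd_congr v (h1 _ _ _ s1); rewrite mulmxBr mulmxBl -scalemxAr -scalemxAl; apply.
- exact: posdef_psd (mx_pow_posdef _ pZ).
- exact: h2 s2.
- exact: posdef_psd (mx_pow_posdef _ pZ).
- exact: psd_congr (posdef_psd (tQ1 _ _ pA)).
Qed.

Lemma concave_squeeze (a1 a2 a3 b1 b2 b3 e t : R) : 0 <= e -> 0 <= t <= 1 ->
  a1 <= e ^+ 2 * b1 -> a2 <= e ^+ 2 * b2 -> b3 <= e ^+ 2 * a3 ->
  (1 - t) * b1 + t * b2 <= b3 -> (1 - t) * a1 + t * a2 <= e ^+ 2 * e ^+ 2 * a3.
Proof.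
move=> e0 /andP[t0 t1] h1 h2 h3 h4.
have t1' : 0 <= 1 - t by rewrite subr_ge0.
have g1 := ler_wpM2l t1' h1; have g2 := ler_wpM2l t0 h2.
have g3 := ler_wpM2l (sqr_ge0 e) (le_trans h4 h3).
apply: le_trans (lerD g1 g2) _; rewrite -mulrA; apply: le_trans g3.
by rewrite le_eqVlt; apply/orP; left; apply/eqP; ring.
Qed.

Lemma pconc_dense n l (Q : R -> 'M[C]_n -> 'M[C]_l) (p : R) : tame Q -> 0 <= p <= 1 ->
  (forall k j, (0 < j < 2 ^ k)%N -> pconc (j%:R / (2 ^ k)%:R) (Q (j%:R / (2 ^ k)%:R))) ->
  pconc p (Q p).
Proof.
move=> tQ hp hd m v A1 A2 Z1 Z2 t pA1 pA2 pZ1 pZ2 ht.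
have pAt := posdef_convex ht pA1 pA2; have pZt := posdef_convex ht pZ1 pZ2.
have [B1 B10 h1] := pmean_close v tQ pA1 pZ1.
have [B2 B20 h2] := pmean_close v tQ pA2 pZ2.
have [B3 B30 h3] := pmean_close v tQ pAt pZt.
have g0 : 0 <= pmean p (Q p) v ((1 - t)%:C *: A1 + t%:C *: A2) ((1 - t)%:C *: Z1 + t%:C *: Z2).
  apply: psd_trace2; last exact: posdef_psd (mx_pow_posdef _ pZt).
  exact: psd_congr (posdef_psd (tQ.1 _ _ pAt)).
apply: (le_of_factor g0) => s s0.
pose B := B1 + B2 + B3 + 1.
have B0 : 0 < B by rewrite ltr_wpDl// !addr_ge0.
(* [p] is exchanged for [r] at the two ends and [r] for [p] at the mixed point, each time at the
   cost of a factor [expR (s/4)^2]; together this is [expR s]. *)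
have s40 : 0 < s / 4 by rewrite divr_gt0.
have [k [j [hj hr]]] := dyadic_dense hp (divr_gt0 s40 B0).
set r := j%:R / (2 ^ k)%:R in hr.
have hB : B * `|r - p| <= s / 4 by rewrite -ler_pdivlMl// mulrC.
have n0 : 0 <= `|r - p| by exact: normr_ge0.
have b1 : B1 * `|r - p| <= s / 4.
  by apply: le_trans hB; apply: ler_wpM2r => //; rewrite /B; lra.
have b2 : B2 * `|r - p| <= s / 4.
  by apply: le_trans hB; apply: ler_wpM2r => //; rewrite /B; lra.
have b3 : B3 * `|p - r| <= s / 4.
  by rewrite distrC; apply: le_trans hB; apply: ler_wpM2r => //; rewrite /B; lra.
have c1 := h1 _ _ _ b1; have c2 := h2 _ _ _ b2; have c3 := h3 _ _ _ b3.
have c4 := hd _ _ hj m v A1 A2 Z1 Z2 t pA1 pA2 pZ1 pZ2 ht.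
rewrite -/r in c4.
have -> : expR s = expR (s / 4) ^+ 2 * expR (s / 4) ^+ 2.
  by rewrite !expr2 -!expRD; congr expR; field.
exact: (concave_squeeze (expR_ge0 (s / 4)) ht c1 c2 c3 c4).
Qed.

Lemma tame_map n l (Phi : {linear 'M[C]_n -> 'M[C]_l}) : strictly_positive Phi ->
  tame (fun r A => Phi (mx_pow r A)).
Proof.
move=> sp; split=> [r A pA|A pA]; first exact: sp (mx_pow_posdef _ pA).
have [B B0 h] := mx_pow_close pA; exists B => [//|s r r' hs].
by rewrite -linearZ -linearB; apply: (pos_psd sp); exact: h.
Qed.

Lemma tame_map_inv n l (Phi : {linear 'M[C]_n -> 'M[C]_l}) : strictly_positive Phi ->
  tame (fun r A => invmx (Phi (mx_pow (- r) A))).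
Proof.
move=> sp; split=> [r A pA|A pA]; first exact: posdef_inv (sp _ (mx_pow_posdef _ pA)).
have [B B0 h] := mx_pow_close pA; exists B => [//|s r r' hs].
have hs' : B * `|(- r') - (- r)| <= s by rewrite opprK addrC.
have h1 := pos_psd sp (h _ _ _ hs'); rewrite linearB linearZ in h1.
have pr := sp _ (mx_pow_posdef (- r) pA); have pr' := sp _ (mx_pow_posdef (- r') pA).
have h2 := psd_inv_anti pr (posdefZ (expR_gt0 s) pr') h1.
have e0 : (expR s)%:C != 0 :> C by rewrite eq_complex /= eqxx andbT expR_eq0.
rewrite (invmxZ (posdef_unit (posdefZ (expR_gt0 s) pr'))) in h2.
have h3 := psdZ (expR_ge0 s) h2.
rewrite scalerBr scalerA (mulfV e0) scale1r in h3; exact: h3.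
Qed.

Lemma dyadic_compl k j : (j <= 2 ^ k)%N ->
  (2 ^ k - j)%:R / (2 ^ k)%:R = 1 - j%:R / (2 ^ k)%:R :> R.
Proof.
move=> hj; rewrite natrB// mulrBl divff//.
by rewrite pnatr_eq0 expn_eq0.
Qed.

Lemma pconc_map n l (Phi : {linear 'M[C]_n -> 'M[C]_l}) (p : R) : strictly_positive Phi ->
  0 <= p <= 1 -> pconc p (fun A => Phi (mx_pow p A)).
Proof.
move=> sp hp; apply: (pconc_dense (tame_map sp) hp) => k j hj m v A1 A2 Z1 Z2 t p1 p2 q1 q2 ht.
have hj' : (0 < j <= 2 ^ k)%N by case/andP: hj => -> /ltnW ->.
have hj2 : (0 < 2 ^ k - j <= 2 ^ k)%N by rewrite subn_gt0 leq_subr andbT; case/andP: hj.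
have := sectorial_concave hj (sectorial_map v sp hj') (sectorial_dypow R m hj2) p1 p2 q1 q2 ht.
rewrite /pmean !dypow_posdef ?dyadic_compl; first by apply.
all: by [exact: posdef_convex | case/andP: hj'].
Qed.

Lemma pconc_map_inv n l (Phi : {linear 'M[C]_n -> 'M[C]_l}) (p : R) : strictly_positive Phi ->
  0 <= p <= 1 -> pconc p (fun A => invmx (Phi (mx_pow (- p) A))).
Proof.
move=> sp hp; apply: (pconc_dense (tame_map_inv sp) hp) => k j hj m v A1 A2 Z1 Z2 t p1 p2 q1 q2 ht.
have hj' : (0 < j <= 2 ^ k)%N by case/andP: hj => -> /ltnW ->.
have hj2 : (0 < 2 ^ k - j <= 2 ^ k)%N by rewrite subn_gt0 leq_subr andbT; case/andP: hj.
have := sectorial_concave hj (sectorial_map_inv v sp hj') (sectorial_dypow R m hj2) p1 p2 q1 q2 ht.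
have pA := posdef_convex ht p1 p2; have pZ := posdef_convex ht q1 q2.
have jk : (j <= 2 ^ k)%N by case/andP: hj'.
rewrite /pmean !(dypow_posdef _ _ p1) !(dypow_posdef _ _ p2) !(dypow_posdef _ _ pA).
rewrite !(dypow_posdef _ _ q1) !(dypow_posdef _ _ q2) !(dypow_posdef _ _ pZ).
by rewrite (mx_powV _ p1) (mx_powV _ p2) (mx_powV _ pA) (dyadic_compl jk); apply.
Qed.

Definition opconc n l (Q : 'M[C]_n -> 'M[C]_l) : Prop :=
  forall A1 A2 (t : R), posdef A1 -> posdef A2 -> 0 <= t <= 1 ->
    psd (Q ((1 - t)%:C *: A1 + t%:C *: A2) - ((1 - t)%:C *: Q A1 + t%:C *: Q A2)).

(** Take for [v] a single column and [Z = 1]: the trace becomes the quadratic form of [Q A]. *)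
Lemma pconc_opconc p n l (Q : 'M[C]_n -> 'M[C]_l) : (forall A, posdef A -> posdef (Q A)) ->
  pconc p Q -> opconc Q.
Proof.
move=> pQ h A1 A2 t p1 p2 ht; have pA := posdef_convex ht p1 p2.
have h1 := posdef_herm (pQ _ p1); have h2 := posdef_herm (pQ _ p2); have h3 := posdef_herm (pQ _ pA).
split; first by rewrite adjB adjD !adjZ !conjc_real h1 h2 h3.
move=> x; have q1 := posdef1 R 1.
have := h _ x A1 A2 1%:M 1%:M t p1 p2 q1 q1 ht.
have pow1 (r : R) : mx_pow r 1%:M = 1%:M :> 'M[C]_1.
  by rewrite -[in LHS](mx_pow0 q1) (mx_powM _ _ q1) mul0r (mx_pow0 q1).
have e (B : 'M[C]_n) : pmean p Q x B 1%:M = qf (Q B) x.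
  by rewrite /pmean pow1 mulmx1; reflexivity.
have e1 : (1 - t)%:C *: 1%:M + t%:C *: 1%:M = 1%:M :> 'M[C]_1.
  by rewrite -scalerDl -rmorphD subrK scale1r.
rewrite e1.
rewrite (e A1) (e A2) (e ((1 - t)%:C *: A1 + t%:C *: A2)) => h4.
by rewrite qfB qfD !qfZ subr_ge0.
Qed.
End Interpolation.

Opaque dg.
(** * Partial sums of eigenvalues and weak majorization *)

Section Majorization.
Variable R : realType.
Local Notation C := R[i].
Implicit Types (m n k l : nat).

Lemma exp_mean (th u v : R) : 0 <= th <= 1 ->
  expR (th * u + (1 - th) * v) <= th * expR u + (1 - th) * expR v.
Proof.
move=> /andP[t0 t1]; set m := _ + _ * v.
have h x : expR m * (1 + (x - m)) <= expR x.
  have := ler_wpM2l (expR_ge0 m) (expR_ge1Dx (x - m)).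
  by rewrite -expRD [m + (x - m)]addrC subrK.
have h1 := ler_wpM2l t0 (h u).
have t1' : 0 <= 1 - th by rewrite subr_ge0.
have h2 := ler_wpM2l t1' (h v).
apply: le_trans (lerD h1 h2); rewrite le_eqVlt; apply/orP; left; apply/eqP.
by rewrite /m; move: (expR _) => e; ring.
Qed.

Lemma powR_young (th a b : R) : 0 <= th <= 1 -> 0 < a -> 0 < b ->
  a `^ th * b `^ (1 - th) <= th * a + (1 - th) * b.
Proof.
move=> ht a0 b0; rewrite !powR_exp// -expRD.
by have := exp_mean (ln a) (ln b) ht; rewrite !lnK ?posrE.
Qed.

(** Weighted AM-GM for [a w^(-p)] and [w] with weights [1/(1+p)] and [p/(1+p)], in which the powers
    of [w] cancel. *)
Lemma powR_weighted (p a w : R) : 0 <= p -> 0 < a -> 0 < w ->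
  (1 + p) * a `^ (1 + p)^-1 <= a * w `^ (- p) + p * w.
Proof.
move=> p0 a0 w0; have q0 : 0 < 1 + p by rewrite ltr_wpDr.
have ht : 0 <= (1 + p)^-1 <= 1.
  by rewrite invr_ge0 (ltW q0) /= invf_le1// lerDl.
have := exp_mean (ln a - p * ln w) (ln w) ht.
have -> : (1 + p)^-1 * (ln a - p * ln w) + (1 - (1 + p)^-1) * ln w = (1 + p)^-1 * ln a.
  by field; rewrite gt_eqF.
rewrite expRB !lnK ?posrE// => h; rewrite !powR_exp// mulNr expRN.
move: h; rewrite -(ler_pM2l q0) => h; apply: le_trans h _.
rewrite le_eqVlt; apply/orP; left; apply/eqP.
by field; rewrite !gt_eqF ?expR_gt0.
Qed.

(** Compare [w] with the indicator of the first [k] indices. Both have sum [k], so [mu] may be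
    shifted to vanish at the last of these, and then the difference is nonnegative term by term. *)
Lemma sorted_weights l k (mu : nat -> R) (w : 'I_l -> R) : (k <= l)%N ->
  (forall i j, (i <= j < l)%N -> mu i <= mu j) ->
  (forall i, 0 <= w i <= 1) -> \sum_i w i = k%:R ->
  \sum_(i < k) mu i <= \sum_(i < l) w i * mu i.
Proof.
move=> kl mon hw sw; case: k kl sw => [|k] kl sw.
  rewrite big_ord0; apply: sumr_ge0 => i _.
  have /eqP := sw; rewrite psumr_eq0 => [/allP h|j _]; last by case/andP: (hw j).
  by have := h i (mem_index_enum _) => /= /eqP ->; rewrite mul0r.
have e : \sum_(i < k.+1) mu i = \sum_(i < l) (i < k.+1)%N%:R * mu i.
  rewrite (big_ord_widen l (fun i => mu i) kl) big_mkcond /=; apply: eq_bigr => i _.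
  by case: ifP; rewrite ?mul1r ?mul0r.
have e1 : \sum_(i < l) ((i < k.+1)%N%:R : R) = k.+1%:R.
  transitivity (\sum_(i < k.+1) (1 : R)); last by rewrite sumr_const card_ord.
  rewrite [RHS](big_ord_widen l (fun=> 1 : R) kl) [RHS]big_mkcond /=; apply: eq_bigr => i _.
  by case: ifP.
rewrite e -subr_ge0 -sumrB.
have -> : \sum_(i < l) (w i * mu i - (i < k.+1)%N%:R * mu i) =
    \sum_(i < l) (w i - (i < k.+1)%N%:R) * (mu i - mu k).
  have z : \sum_(i < l) (w i - (i < k.+1)%N%:R) * mu k = 0.
    by rewrite -mulr_suml sumrB sw e1 subrr mul0r.
  rewrite -[LHS]subr0 -[X in _ - X]z -sumrB; apply: eq_bigr => i _.
  by ring.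
apply: sumr_ge0 => i _; have /andP[w0 w1] := hw i.
case: (ltnP i k.+1) => h.
  rewrite -mulrNN mulr_ge0 ?opprB ?subr_ge0//; apply: mon.
  by rewrite -ltnS h.
by rewrite subr0 mulr_ge0// subr_ge0; apply: mon; rewrite (ltnW h) ltn_ord.
Qed.

Lemma powR_oneB (w p : R) : 0 < w -> w `^ (1 - p) = w * w `^ (- p).
Proof.
move=> w0; rewrite !powR_exp// mulrBl mul1r mulNr expRD lnK ?posrE//.
Qed.

Lemma gram_rdiag l k (a : 'M[C]_(l, k)) (W E : 'M[C]_k) (om : 'rV[R]_k) :
  E *m adj E = 1%:M -> adj E *m E = 1%:M -> W = E *m rdiag om *m adj E -> W \in unitmx ->
  adj a *m a = invmx W -> adj (a *m E) *m (a *m E) *m rdiag om = 1%:M.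
Proof.
move=> EE EE' eW uW ea.
have e1 : E *m rdiag om = W *m E by rewrite eW -mulmxA EE' mulmx1.
rewrite adjM !mulmxA -[adj E *m adj a *m a]mulmxA ea -mulmxA e1 !mulmxA.
by rewrite -[adj E *m invmx W *m W]mulmxA (mulVmx uW) mulmx1.
Qed.

(** [a W adj a] is the orthogonal projection onto the range of [a]. Its complement being a Gram
    matrix yields Bessel's inequality in [key_lower]. *)
Lemma gram_proj l k (a : 'M[C]_(l, k)) (W : 'M[C]_k) : adj W = W -> W \in unitmx ->
  adj a *m a = invmx W ->
  adj (1%:M - a *m W *m adj a) *m (1%:M - a *m W *m adj a) = 1%:M - a *m W *m adj a.
Proof.
move=> hW uW ea; rewrite adjB adj1 !adjM adjK hW mulmxA mulmxBr mulmx1.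
have e : a *m W *m adj a *m (a *m W *m adj a) = a *m W *m adj a.
  rewrite !mulmxA -[a *m W *m adj a *m a]mulmxA ea -[a *m W *m invmx W]mulmxA.
  by rewrite (mulmxV uW) mulmx1.
by rewrite mulmxBl mul1mx e subrr subr0.
Qed.

Section KeyLower.
Variables (l k : nat) (a : 'M[C]_(l, k)) (W : 'M[C]_k) (lam : nat -> R) (p : R).
Hypotheses (kl : (k <= l)%N) (p0 : 0 <= p) (pW : posdef W) (ea : adj a *m a = invmx W).
Hypotheses (lam0 : forall i, 0 < lam i)
  (mon : forall i j, (i <= j < l)%N -> lam i <= lam j).

(* The columns of [a W^(1/2)] are orthonormal. In an eigenbasis of [W] the right-hand side is an
   average of terms [x w^(-p) + p w >= (1 + p) x^(1/(1+p))], with weights at most 1 by Bessel. *)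
Lemma key_lower : (1 + p) * \sum_(i < k) lam i `^ (1 + p)^-1 <=
  rtr (adj a *m dg l lam *m a *m mx_pow (1 - p) W) + p * rtr W.
Proof.
have q0 : 0 < 1 + p by rewrite ltr_wpDr.
have [E [om [EE EE' eW om0]]] := posdef_spectral pW.
pose r := a *m E; pose g i c := nz (r i c) * om 0 c.
have uW := posdef_unit pW.
have e1 : rtr (adj a *m dg l lam *m a *m mx_pow (1 - p) W) =
    \sum_c \sum_(i < l) g i c * (lam i * om 0 c `^ (- p)).
  rewrite eW (mx_pow_spec _ _ EE) mulmxA rtrC !mulmxA -adjM -[_ *m a *m E]mulmxA rtr_weights.
  apply: eq_bigr => c _; apply: eq_bigr => i _; rewrite [map_mx _ _ _ _]mxE (powR_oneB _ (om0 c)) /g /r.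
  by ring.
have e3 c : \sum_(i < l) g i c = 1.
  have := congr1 (fun M : 'M[C]_k => complex.Re (M c c)) (gram_rdiag EE EE' eW uW ea).
  rewrite mul_rdiagE mulrC ReZ Re_gram mxE eqxx /= => <-.
  by rewrite mulr_sumr; apply: eq_bigr => i _; rewrite mulrC.
have e2 : p * rtr W = \sum_c \sum_(i < l) g i c * (p * om 0 c).
  rewrite eW -mulmxA rtrC -mulmxA EE' mulmx1 rtr_rdiag mulr_sumr; apply: eq_bigr => c _.
  by rewrite -mulr_suml e3 mul1r.
have g0 i c : 0 <= g i c by rewrite mulr_ge0 ?nz_ge0// ltW.
have e4 i : 0 <= \sum_c g i c <= 1.
  apply/andP; split; first exact: sumr_ge0.
  have e : r *m rdiag om *m adj r = a *m W *m adj a by rewrite /r adjM eW !mulmxA.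
  have := Re_gram (1%:M - a *m W *m adj a) i; rewrite (gram_proj (posdef_herm pW) uW ea) -e.
  rewrite mxE [X in _ + X]mxE [X in X + _]mxE eqxx ReD ReN Re_cogram /= => h.
  by rewrite -subr_ge0 h; apply: sumr_ge0 => c _; exact: nz_ge0.
have e5 : \sum_i \sum_c g i c = k%:R.
  by rewrite exchange_big /= (eq_bigr _ (fun c _ => e3 c)) sumr_const card_ord.
have mon' i j : (i <= j < l)%N -> lam i `^ (1 + p)^-1 <= lam j `^ (1 + p)^-1.
  move=> h; apply: ge0_ler_powR; rewrite ?nnegrE ?invr_ge0 ?(ltW q0) ?(ltW (lam0 _))//.
  exact: mon.
have h := sorted_weights kl mon' e4 e5.
apply: le_trans (ler_wpM2l (ltW q0) h) _; rewrite e1 e2 -big_split /= mulr_sumr.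
have -> : \sum_(i < l) (1 + p) * ((\sum_c g i c) * lam i `^ (1 + p)^-1) =
    \sum_c \sum_(i < l) g i c * ((1 + p) * lam i `^ (1 + p)^-1).
  by rewrite exchange_big /=; apply: eq_bigr => i _; rewrite -mulr_suml mulrCA.
apply: ler_sum => c _; rewrite -big_split /=; apply: ler_sum => i _.
rewrite -mulrDr; apply: ler_wpM2l; first exact: g0.
exact: powR_weighted.
Qed.
End KeyLower.

(** In an eigenbasis of [W] the squared moduli of a unitary matrix are doubly stochastic weights;
    the scalar Young inequality is averaged with them. *)
Lemma trace_young k (d : nat -> R) (W : 'M[C]_k) (p : R) : 0 <= p <= 1 -> (forall i, 0 < d i) ->
  posdef W -> rtr (dg k (fun i => d i `^ p) *m mx_pow (1 - p) W) <=
    p * \sum_(i < k) d i + (1 - p) * rtr W.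
Proof.
move=> hp d0 pW; have [E [om [EE EE' eW om0]]] := posdef_spectral pW.
have s1 c : \sum_(i < k) nz (E i c) = 1.
  by rewrite -Re_gram EE' mxE eqxx.
have s2 i : \sum_c nz (E i c) = 1.
  have := Re_cogram E (const_mx 1) i; rewrite rdiag_const mulmx1 EE mxE eqxx => h.
  transitivity (\sum_c nz (E i c) * (const_mx 1 : 'rV[R]_k) 0 c); last by rewrite -h.
  by apply: eq_bigr => c _; rewrite mxE mulr1.
have e1 : rtr (dg k (fun i => d i `^ p) *m mx_pow (1 - p) W) =
    \sum_c \sum_(i < k) nz (E i c) * (d i `^ p * om 0 c `^ (1 - p)).
  rewrite eW (mx_pow_spec _ _ EE) mulmxA rtrC !mulmxA rtr_weights.
  by apply: eq_bigr => c _; apply: eq_bigr => i _; rewrite [map_mx _ _ _ _]mxE -mulrA.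
have e2 : (1 - p) * rtr W = \sum_c \sum_(i < k) nz (E i c) * ((1 - p) * om 0 c).
  rewrite eW -mulmxA rtrC -mulmxA EE' mulmx1 rtr_rdiag mulr_sumr; apply: eq_bigr => c _.
  by rewrite -mulr_suml s1 mul1r.
have e3 : p * \sum_(i < k) d i = \sum_c \sum_(i < k) nz (E i c) * (p * d i).
  rewrite exchange_big /= mulr_sumr; apply: eq_bigr => i _.
  by rewrite -mulr_suml s2 mul1r.
rewrite e1 e2 e3 -big_split /=; apply: ler_sum => c _; rewrite -big_split /=; apply: ler_sum => i _.
rewrite -mulrDr; apply: ler_wpM2l; first exact: nz_ge0.
exact: powR_young.
Qed.

End Majorization.

(** * Simultaneous diagonalization, Tomic-Weyl theorem and concavity of the partial sums *)

Section Concavity.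
Variable R : realType.
Local Notation C := R[i].
Implicit Types (m n k l : nat).

(* Congruence diagonalizing [X] and [Y^(-1)] together; [lam] is the sorted spectrum of [X Y]. *)
Definition simd l (X Y T : 'M[C]_l) (lam : nat -> R) : Prop :=
  [/\ T \in unitmx, adj T *m X *m T = dg l lam, Y = T *m adj T, (forall i, 0 < lam i) &
      forall i j, (i <= j < l)%N -> lam i <= lam j].

(** [T = X^(-1/2) U L^(1/2)], built from the spectral decomposition [U L adj U] of the sandwiched
    product. *)
Lemma simd_algebra l (S X Y U L r : 'M[C]_l) : S \in unitmx -> adj S = S -> S *m S = X ->
  S *m Y *m S = U *m L *m adj U -> adj U *m U = 1%:M -> r *m r = L -> adj r = r ->
  let T := invmx S *m U *m r in T *m adj T = Y /\ adj T *m X *m T = L.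
Proof.
move=> uS hS eX eM UU rr hr T.
have hT : adj T = r *m adj U *m invmx S by rewrite /T !adjM hr adj_inv hS mulmxA.
have e : invmx S *m (S *m Y *m S) *m invmx S = Y.
  by rewrite !mulmxA (mulVmx uS) mul1mx -mulmxA (mulmxV uS) mulmx1.
split.
  by rewrite -[RHS]e eM -rr hT !mulmxA; reflexivity.
rewrite hT -eX /T !mulmxA -[r *m adj U *m invmx S *m S]mulmxA (mulVmx uS) mulmx1.
rewrite -[r *m adj U *m S *m invmx S]mulmxA (mulmxV uS) mulmx1.
by rewrite -[r *m adj U *m U]mulmxA UU mulmx1 rr; reflexivity.
Qed.

Lemma gram_defect l k (a b : 'M[C]_(l, k)) (W : 'M[C]_k) : adj W = W ->
  adj b *m a = 1%:M -> adj a *m b = 1%:M -> W *m (adj a *m a) = 1%:M ->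
  adj b *m b - W = adj (b - a *m W) *m (b - a *m W).
Proof.
move=> hW ba ab aa; rewrite adjB adjM hW mulmxBr !mulmxBl -[W *m adj a *m b]mulmxA ab mulmx1.
rewrite [adj b *m (a *m W)]mulmxA ba mul1mx [W *m adj a *m (a *m W)]mulmxA.
by rewrite -[W *m adj a *m a]mulmxA aa mul1mx subrr subr0; reflexivity.
Qed.

Lemma simd_exists l (X Y : 'M[C]_l) : posdef X -> posdef Y ->
  exists T, exists2 lam, simd X Y T lam & forall f : R -> R,
    trf f (mx_pow 2^-1 X *m Y *m mx_pow 2^-1 X) = \sum_(i < l) f (lam i).
Proof.
move=> pX pY; set S := mx_pow _ X.
have pS : posdef S := mx_pow_posdef _ pX.
have hS := posdef_herm pS; have uS := posdef_unit pS.
have eS : S *m S = X := mx_sqrt_sq pX.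
have pM : posdef (S *m Y *m S) by rewrite -{1}hS; apply: posdef_congr_unit.
have [U [lam [UU eM l0 mon]]] := sorted_spectral pM.
have UU' : adj U *m U = 1%:M := mulmx1C UU.
pose r i := Num.sqrt (lam i).
have rr : dg l r *m dg l r = dg l lam.
  by rewrite dgM; apply: eq_dg => i; rewrite -expr2 sqr_sqrtr// ltW.
have ru : dg l r *m dg l (fun i => (r i)^-1) = 1%:M.
  rewrite dgM -dg1; apply: eq_dg => i; rewrite divff// gt_eqF// sqrtr_gt0.
  exact: l0.
have [eT eL] := simd_algebra uS hS eS eM UU' rr (adj_dg l r).
exists (invmx S *m U *m dg l r), lam; first split.
- by rewrite !unitmx_mul unitmx_inv uS (mulmx1_unit UU).1 (mulmx1_unit ru).1.
- exact: eL.
- exact: esym eT.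
- exact: l0.
- exact: mon.
move=> f; rewrite (trfE f UU eM).
by apply: eq_bigr => i _; rewrite mxE.
Qed.

Section PartialSums.
Variables (l k : nat) (X Y T : 'M[C]_l) (lam : nat -> R) (p : R).
Hypotheses (kl : (k <= l)%N) (p0 : 0 <= p) (hs : simd X Y T lam).

Lemma simd_lower (v w : 'M[C]_(l, k)) : adj w *m v = 1%:M -> exists W : 'M[C]_k,
  [/\ posdef W, psd (adj w *m Y *m w - W) &
  (1 + p) * \sum_(i < k) lam i `^ (1 + p)^-1 <=
    rtr (adj v *m X *m v *m mx_pow (1 - p) W) + p * rtr W].
Proof.
case: hs => uT eX eY l0 mon wv.
pose a := invmx T *m v; pose b := adj T *m w.
have ba : adj b *m a = 1%:M.
  by rewrite /a /b adjM adjK !mulmxA -[adj w *m T *m invmx T]mulmxA (mulmxV uT) mulmx1.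
have ab : adj a *m b = 1%:M by rewrite -[adj a *m b]adjK adjM adjK ba adj1.
have paa : posdef (adj a *m a).
  by rewrite -[adj a]mulmx1; apply: (posdef_congr ba); exact: posdef1.
have uaa := posdef_unit paa.
pose W := invmx (adj a *m a).
have pW : posdef W := posdef_inv paa.
have hW := posdef_herm pW.
have eb : adj w *m Y *m w = adj b *m b by rewrite /b adjM adjK eY !mulmxA.
have eaa : adj a *m a = invmx W by rewrite /W invmxK.
have ex : adj v *m X *m v = adj a *m dg l lam *m a.
  have ev : v = T *m a by rewrite /a mulmxA (mulmxV uT) mul1mx.
  by rewrite {1 2}ev adjM -eX !mulmxA.
exists W; split; first exact: pW.
- by rewrite eb (gram_defect hW ba ab (mulVmx uaa)); exact: psd_gram.
rewrite ex; exact: key_lower.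
Qed.

(* The case of equality in [simd_lower]: with [D = lam^(1/(1+p))] and [V = T D^(-1/2)] one has
   [V^* X V = D^p] and [V^-1 Y V^-* = D]; take the first [k] vectors. *)
Lemma simd_mid : exists v w : 'M[C]_(l, k), [/\ adj w *m v = 1%:M,
  adj v *m X *m v = dg k (fun i => (lam i `^ (1 + p)^-1) `^ p) &
  adj w *m Y *m w = dg k (fun i => lam i `^ (1 + p)^-1)].
Proof.
case: hs => uT eX eY l0 mon.
have q0 : 0 < 1 + p by rewrite ltr_wpDr.
pose mu i := lam i `^ (1 + p)^-1.
have mu0 i : 0 < mu i by exact: powR_gt0.
pose s i := Num.sqrt (mu i).
have s0 i : 0 < s i by rewrite sqrtr_gt0.
have ss i : s i * s i = mu i by rewrite -expr2 sqr_sqrtr// ltW.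
have uaT : adj T \in unitmx by rewrite adj_unit.
exists (T *m dg l (fun i => (s i)^-1) *m sel R l k), (invmx (adj T) *m dg l s *m sel R l k).
split.
- rewrite !adjM adj_dg adj_inv adjK !mulmxA -[_ *m invmx T *m T]mulmxA (mulVmx uT) mulmx1.
  rewrite -[adj (sel R l k) *m dg l s *m _]mulmxA dgM.
  have -> : dg l (fun i => s i * (s i)^-1) = dg l (fun=> 1).
    by apply: eq_dg => i; rewrite divff// gt_eqF.
  by rewrite sel_dg// dg1.
- rewrite !adjM adj_dg !mulmxA -[_ *m adj T *m X]mulmxA -[_ *m (adj T *m X) *m T]mulmxA eX.
  rewrite -[_ *m dg l _ *m dg l lam]mulmxA dgM -[_ *m dg l _ *m dg l _]mulmxA dgM sel_dg//.
  apply: eq_dg => i; have e : lam i = mu i * mu i `^ p.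
    rewrite /mu !powR_exp// ?powR_gt0// ?expR_gt0// expRK -expRD -[LHS]lnK ?posrE//.
    by congr expR; field; rewrite gt_eqF.
  rewrite {1}e -/(mu i); move: (mu i `^ p) => z; rewrite -ss.
  by field; rewrite gt_eqF.
- rewrite eY !adjM adj_dg adj_inv adjK !mulmxA.
  rewrite -[_ *m invmx T *m T]mulmxA (mulVmx uT) mulmx1.
  rewrite -[_ *m adj T *m invmx (adj T)]mulmxA (mulmxV uaT) mulmx1.
  rewrite -[adj (sel R l k) *m dg l s *m _]mulmxA dgM sel_dg//.
  by apply: eq_dg => i; rewrite ss.
Qed.
End PartialSums.

Lemma concave_chord (g : R -> R) (z x y : R) : concave_pos g -> 0 < z -> z < x -> x < y ->
  (y - x) * g z + (x - z) * g y <= (y - z) * g x.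
Proof.
move=> cg z0 zx xy; have yz : 0 < y - z by rewrite subr_gt0 (lt_trans zx).
have ht : 0 <= (x - z) / (y - z) <= 1.
  rewrite divr_ge0 ?(ltW yz) ?subr_ge0 ?(ltW zx)//= ler_pdivrMr// mul1r lerD2r.
  exact: ltW.
have := cg z y _ z0 (lt_trans z0 (lt_trans zx xy)) ht.
have -> : (1 - (x - z) / (y - z)) * z + (x - z) / (y - z) * y = x by field; rewrite gt_eqF.
rewrite -(ler_pM2l yz); apply: le_trans; rewrite le_eqVlt; apply/orP; left; apply/eqP.
by field; rewrite gt_eqF.
Qed.

(** Take the supremum of the slopes to the right of [x]: the slopes to the left bound it by
    [concave_chord], and monotonicity makes it nonnegative. *)
Lemma supergradient (g : R -> R) (x : R) : concave_pos g -> nondecreasing_pos g -> 0 < x ->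
  exists2 s : R, 0 <= s & forall y, 0 < y -> g y <= g x + s * (y - x).
Proof.
move=> cg ng x0; pose E := [set e | exists2 y, x < y & e = (g y - g x) / (y - x)].
have ubE z : 0 < z -> z < x -> ubound E ((g x - g z) / (x - z)).
  move=> z0 zx _ [y xy ->]; have := concave_chord cg z0 zx xy.
  have y0 : 0 < y - x by rewrite subr_gt0.
  have w0 : 0 < x - z by rewrite subr_gt0.
  rewrite ler_pdivrMr// mulrAC ler_pdivlMr// => h.
  by rewrite -subr_ge0; rewrite -subr_ge0 in h; apply: le_trans h _; rewrite le_eqVlt; apply/orP; left; apply/eqP; ring.
have E0 : E ((g (x + 1) - g x) / (x + 1 - x)) by exists (x + 1); rewrite ?ltrDl.
have hub : has_ubound E.
  by exists ((g x - g (x / 2)) / (x - x / 2)); apply: ubE; lra.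
have sR y : x < y -> g y <= g x + sup E * (y - x).
  move=> xy; have : (g y - g x) / (y - x) <= sup E by apply: ub_le_sup => //; exists y.
  by rewrite ler_pdivrMr ?subr_gt0// lerBlDl.
exists (sup E).
  have h := sR (x + 1); rewrite ltrDl ltr01 in h; have {}h := h isT.
  have h2 := ng x (x + 1) x0; rewrite lerDl ler01 in h2; have {}h2 := h2 isT.
  move: (le_trans h2 h); have -> : x + 1 - x = 1 by ring.
  by rewrite mulr1 lerDl.
move=> y y0; case: (ltgtP x y) => [|yx|->]; first exact: sR; last by rewrite subrr mulr0 addr0.
have : sup E <= (g x - g y) / (x - y) by apply: ge_sup (ubE y y0 yx); exists ((g (x + 1) - g x) / (x + 1 - x)).
rewrite ler_pdivlMr ?subr_gt0// => h.
have -> : g x + sup E * (y - x) = g x - sup E * (x - y) by ring.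
by rewrite lerBrDr addrC -lerBrDr.
Qed.

Lemma abel_ge0 l (s d : nat -> R) : (forall i, 0 <= s i) ->
  (forall i, (i.+1 < l)%N -> s i.+1 <= s i) ->
  (forall k, (k <= l)%N -> 0 <= \sum_(i < k) d i) -> 0 <= \sum_(i < l) s i * d i.
Proof.
move=> s0 ms hd; case: l ms hd => [|l] ms hd; first by rewrite big_ord0.
have h k : (k < l.+1)%N -> s k * \sum_(i < k.+1) d i <= \sum_(i < k.+1) s i * d i.
  elim: k => [|k ih] hk; first by rewrite !big_ord1.
  rewrite big_ord_recr [in leRHS]big_ord_recr /= mulrDr lerD2r.
  apply: le_trans (ih (ltnW hk)); apply: ler_wpM2r; last exact: ms.
  exact: hd (ltnW hk).
apply: le_trans (h l (ltnSn l)); apply: mulr_ge0; first exact: s0.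
exact: hd.
Qed.

(* Tomic-Weyl: Abel summation against the nonincreasing supergradients of g at mu. *)
Lemma weak_majorization l (g : R -> R) (mu nu : nat -> R) :
  concave_pos g -> nondecreasing_pos g -> (forall i, 0 < mu i) -> (forall i, 0 < nu i) ->
  (forall i j, (i <= j < l)%N -> mu i <= mu j) ->
  (forall k, (k <= l)%N -> \sum_(i < k) nu i <= \sum_(i < k) mu i) ->
  \sum_(i < l) g (nu i) <= \sum_(i < l) g (mu i).
Proof.
move=> cg ng mu0 nu0 mon hs.
have /boolp.choice[s sP] : forall x : R, exists s : R, 0 < x ->
    0 <= s /\ forall y, 0 < y -> g y <= g x + s * (y - x).
  move=> x; case: (ltP 0 x) => [x0|x0]; last by exists 0.
  by have [s s0 h] := supergradient cg ng x0; exists s.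
have anti x y : 0 < x -> x <= y -> s y <= s x.
  move=> x0; rewrite le_eqVlt => /orP[/eqP->//|xy].
  have y0 := lt_trans x0 xy.
  have h1 := (sP _ x0).2 _ y0; have h2 := (sP _ y0).2 _ x0.
  have yx : 0 < y - x by rewrite subr_gt0.
  rewrite -(ler_pM2r yx).
  have e : s y * (x - y) = - (s y * (y - x)) by ring.
  by rewrite e in h2; move: h1 h2; move: (s y * _) (s x * _) (g x) (g y) => a b c d; lra.
have h := @abel_ge0 l (fun i => s (mu i)) (fun i => mu i - nu i).
rewrite -subr_ge0 -sumrB; apply: le_trans (h _ _ _) _.
- by move=> i; exact: (sP _ (mu0 i)).1.
- by move=> i hi; apply: anti => //; apply: mon; rewrite leqnSn.
- by move=> k hk; rewrite sumrB subr_ge0 hs.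
apply: ler_sum => i _; have := (sP _ (mu0 i)).2 _ (nu0 i).
have -> : s (mu i) * (mu i - nu i) = - (s (mu i) * (nu i - mu i)) by ring.
by move: (s _ * _) (g _) (g _) => a b c; lra.
Qed.

Lemma qfE n' k (A : 'M[C]_n') (x : 'M[C]_(n', k)) : qf A x = rtr (adj x *m A *m x).
Proof. by []. Qed.

Lemma qf_mx1 k (A : 'M[C]_k) : qf A 1%:M = rtr A.
Proof. by rewrite qfE adj1 mul1mx mulmx1. Qed.

(** The two lower bounds, joint concavity and Young's inequality combine to [(1 + p) S <= p d + w],
    with [S] the mixed partial sum and [w] the mixed trace of the two [W]; the remaining bounds give
    [w <= d]. *)
Lemma partial_sums_arith (p t s1 s2 x0 x1 x2 w1 w2 y1 y2 d : R) : 0 <= p -> 0 <= t <= 1 ->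
  (1 + p) * s1 <= x1 + p * w1 -> (1 + p) * s2 <= x2 + p * w2 ->
  (1 - t) * x1 + t * x2 <= x0 -> x0 <= p * d + (1 - p) * ((1 - t) * w1 + t * w2) ->
  0 <= y1 - w1 -> 0 <= y2 - w2 -> 0 <= d - ((1 - t) * y1 + t * y2) ->
  (1 - t) * s1 + t * s2 <= d.
Proof.
move=> p0 /andP[t0 t1] h1 h2 h3 h4 h5 h6 h7.
have q0 : 0 < 1 + p by rewrite ltr_wpDr.
have t1' : 0 <= 1 - t by rewrite subr_ge0.
have g1 := ler_wpM2l t1' h1; have g2 := ler_wpM2l t0 h2.
have g5 := mulr_ge0 t1' h5; have g6 := mulr_ge0 t0 h6.
rewrite -(ler_pM2l q0).
have -> : (1 + p) * ((1 - t) * s1 + t * s2) =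
  (1 - t) * ((1 + p) * s1) + t * ((1 + p) * s2) by ring.
apply: le_trans (lerD g1 g2) _.
have -> : (1 - t) * (x1 + p * w1) + t * (x2 + p * w2) =
  ((1 - t) * x1 + t * x2) + p * ((1 - t) * w1 + t * w2) by ring.
apply: le_trans (lerD (le_trans h3 h4) (lexx _)) _.
have -> : p * d + (1 - p) * ((1 - t) * w1 + t * w2) + p * ((1 - t) * w1 + t * w2) =
  p * d + ((1 - t) * w1 + t * w2) by ring.
have -> : (1 + p) * d = p * d + d by ring.
rewrite lerD2l.
by move: g5 g6 h7; rewrite !mulrBr; move: (_ * w1) (_ * w2) (_ * y1) (_ * y2); clear=> *; lra.
Qed.

Definition sandwich n m l (QA : 'M[C]_n -> 'M[C]_l) (QB : 'M[C]_m -> 'M[C]_l) (f : R -> R) A B :=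
  trf f (mx_pow 2^-1 (QA A) *m QB B *m mx_pow 2^-1 (QA A)).

Section Main.
Variables (n m l : nat) (QA : 'M[C]_n -> 'M[C]_l) (QB : 'M[C]_m -> 'M[C]_l) (p : R).
Hypotheses (hp : 0 <= p <= 1) (pA : forall A, posdef A -> posdef (QA A))
  (pB : forall B, posdef B -> posdef (QB B)) (cA : pconc p QA) (cB : opconc QB).

(** The frames [v], [w] that attain equality at the mixed point serve as trial frames at both
    ends. *)
Lemma partial_sums_concave A1 A2 B1 B2 (t : R) T0 T1 T2 lam0 lam1 lam2 k :
  posdef A1 -> posdef A2 -> posdef B1 -> posdef B2 -> 0 <= t <= 1 -> (k <= l)%N ->
  simd (QA ((1 - t)%:C *: A1 + t%:C *: A2)) (QB ((1 - t)%:C *: B1 + t%:C *: B2)) T0 lam0 ->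
  simd (QA A1) (QB B1) T1 lam1 -> simd (QA A2) (QB B2) T2 lam2 ->
  (1 - t) * (\sum_(i < k) lam1 i `^ (1 + p)^-1) + t * (\sum_(i < k) lam2 i `^ (1 + p)^-1) <=
  \sum_(i < k) lam0 i `^ (1 + p)^-1.
Proof.
move=> pA1 pA2 pB1 pB2 ht kl s0 s1 s2; have /andP[p0 p1] := hp; have /andP[t0 t1] := ht.
have q0 : 0 < 1 + p by rewrite ltr_wpDr.
have [v [w [wv eX eY]]] := simd_mid kl p0 s0.
have [W1 [pW1 hW1 g1]] := simd_lower kl p0 s1 wv.
have [W2 [pW2 hW2 g2]] := simd_lower kl p0 s2 wv.
have g3 := cA v pA1 pA2 pW1 pW2 ht.
have pWt := posdef_convex ht pW1 pW2.
have t1' : 0 <= 1 - t by rewrite subr_ge0.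
rewrite /pmean eX in g3.
have l0 i : 0 < lam0 i `^ (1 + p)^-1 by apply: powR_gt0; case: s0.
have g4 := trace_young hp l0 pWt.
have r1 := psd_qf 1%:M hW1; have r2 := psd_qf 1%:M hW2.
have r3 := psd_qf w (cB pB1 pB2 ht).
have eD : \sum_(i < k) lam0 i `^ (1 + p)^-1 = qf (QB ((1 - t)%:C *: B1 + t%:C *: B2)) w.
  by rewrite qfE eY rtr_dg.
rewrite qfB qfM mulmx1 qf_mx1 in r1; rewrite qfB qfM mulmx1 qf_mx1 in r2.
rewrite qfB qfD !qfZ -eD in r3; rewrite rtrD !rtrZ in g4.
exact: (partial_sums_arith p0 ht g1 g2 g3 g4 r1 r2 r3).
Qed.

Lemma sandwich_concave_left (f : R -> R) : nondecreasing_pos f ->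
  concave_pos (fun x => f (x `^ (1 + p))) ->
  jointly_concave (sandwich QA QB f).
Proof.
move=> nf cf A1 A2 B1 B2 t pA1 pA2 pB1 pB2 ht.
have pAt := posdef_convex ht pA1 pA2; have pBt := posdef_convex ht pB1 pB2.
have sd A B : posdef A -> posdef B -> exists T, exists2 lam, simd (QA A) (QB B) T lam &
    sandwich QA QB f A B = \sum_(i < l) f (lam i).
  move=> hA hB; have [T [lam h e]] := simd_exists (pA hA) (pB hB).
  by exists T, lam; [exact: h | exact: e].
have [T0 [lam0 s0 e0]] := sd _ _ pAt pBt.
have [T1 [lam1 s1 e1]] := sd _ _ pA1 pB1.
have [T2 [lam2 s2 e2]] := sd _ _ pA2 pB2.
rewrite e0 e1 e2.
have /andP[p0 p1] := hp; have q0 : 0 < 1 + p by rewrite ltr_wpDr.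
have [_ _ _ l0 mon0] := s0; have [_ _ _ l1 _] := s1; have [_ _ _ l2 _] := s2.
pose g x := f (x `^ (1 + p)).
have ng : nondecreasing_pos g.
  move=> x y x0 xy; apply: nf; first exact: powR_gt0.
  by apply: ge0_ler_powR; rewrite ?nnegrE ?(ltW q0) ?(ltW x0) ?(le_trans (ltW x0)).
have fg x : 0 < x -> f x = g (x `^ (1 + p)^-1).
  by move=> x0; rewrite /g -powRrM mulVf ?gt_eqF// powRr1// ltW.
pose mu (lam : nat -> R) i := lam i `^ (1 + p)^-1.
have mu0 lam i : (forall i, 0 < lam i) -> 0 < mu lam i by move=> h; exact: powR_gt0.
have h0 := mu0 _ ^~ l0; have h1 := mu0 _ ^~ l1; have h2 := mu0 _ ^~ l2.
pose nu i := (1 - t) * mu lam1 i + t * mu lam2 i.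
have nu0 i : 0 < nu i.
  have := h1 i; have := h2 i; rewrite /nu; case/andP: (ht) => t0 t1.
  move: (mu _ _) (mu _ _) => a b a0 b0.
  have [->|tn] := eqVneq t 0; first by rewrite subr0 mul1r mul0r addr0.
  by rewrite ltr_wpDl ?mulr_ge0 ?subr_ge0 ?(ltW b0)// mulr_gt0// lt_def tn.
have mon i j : (i <= j < l)%N -> mu lam0 i <= mu lam0 j.
  move=> h; apply: ge0_ler_powR; rewrite ?nnegrE ?invr_ge0 ?(ltW q0) ?(ltW (l0 _))//.
  exact: mon0.
have hs k : (k <= l)%N -> \sum_(i < k) nu i <= \sum_(i < k) mu lam0 i.
  move=> kl; have := partial_sums_concave pA1 pA2 pB1 pB2 ht kl s0 s1 s2.
  by rewrite !mulr_sumr -big_split.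
have hw := @weak_majorization l g _ _ cf ng h0 nu0 mon hs.
have ef : \sum_(i < l) f (lam0 i) = \sum_(i < l) g (mu lam0 i).
  by apply: eq_bigr => i _; rewrite fg.
(* Concavity of [g] passes from the average of its values to its values at [nu]; majorization passes
   from these to the values at [mu lam0]. *)
rewrite ef; apply: le_trans hw; rewrite !mulr_sumr -big_split /=; apply: ler_sum => i _.
rewrite (fg _ (l1 i)) (fg _ (l2 i)); apply: cf => //; [exact: h1 | exact: h2].
Qed.
End Main.
End Concavity.

(** * Exchange of the two factors, inverses and the convex case *)

Section Assembly.
Variable R : realType.
Local Notation C := R[i].
Implicit Types (m n k l : nat).

(** [V = M U lam^(-1/2)], the unitary polar factor of [M] times [U], diagonalizes [M adj M] with the
    same eigenvalues. *)
Lemma trf_gram_swap l (f : R -> R) (M : 'M[C]_l) : M \in unitmx ->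
  trf f (adj M *m M) = trf f (M *m adj M).
Proof.
move=> uM; have pM : posdef (adj M *m M).
  by rewrite -[adj M]mulmx1; apply: (posdef_congr_unit uM); exact: posdef1.
have [U [lam [UU eM l0 _]]] := sorted_spectral pM.
have UU' : adj U *m U = 1%:M := mulmx1C UU.
pose r i := (Num.sqrt (lam i))^-1.
have rl : dg l r *m dg l lam *m dg l r = 1%:M.
  rewrite !dgM -dg1; apply: eq_dg => i.
  have h : Num.sqrt (lam i) * Num.sqrt (lam i) = lam i by rewrite -expr2 sqr_sqrtr// ltW.
  have s0 : 0 < Num.sqrt (lam i) by rewrite sqrtr_gt0 l0.
  rewrite /r -[X in _ * X / _]h; field; rewrite gt_eqF//.
pose V := M *m U *m dg l r.
have VV' : adj V *m V = 1%:M.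
  rewrite /V !adjM adj_dg !mulmxA -[dg l r *m adj U *m adj M *m M]mulmxA eM !mulmxA.
  rewrite -[dg l r *m adj U *m U]mulmxA UU' mulmx1.
  by rewrite -[dg l r *m dg l lam *m adj U *m U]mulmxA UU' mulmx1 rl.
have VV : V *m adj V = 1%:M := mulmx1C VV'.
have eV : M *m adj M = V *m dg l lam *m adj V.
  rewrite /V !adjM adj_dg !mulmxA -[M *m U *m dg l r *m dg l lam]mulmxA.
  rewrite -[M *m U *m (dg l r *m dg l lam) *m dg l r]mulmxA rl mulmx1.
  by rewrite -[M *m U *m adj U]mulmxA UU mulmx1.
by rewrite (trfE f UU eM) (trfE f VV eV).
Qed.

Lemma trf_swap l (f : R -> R) (X Y : 'M[C]_l) : posdef X -> posdef Y ->
  trf f (mx_pow 2^-1 X *m Y *m mx_pow 2^-1 X) = trf f (mx_pow 2^-1 Y *m X *m mx_pow 2^-1 Y).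
Proof.
move=> pX pY; rewrite -{1}(mx_sqrt_sq pY) -{3}(mx_sqrt_sq pX).
have pS := mx_pow_posdef 2^-1 pX; have pT := mx_pow_posdef 2^-1 pY.
move: (mx_pow _ X) (mx_pow _ Y) pS pT => S T pS pT.
have u : T *m S \in unitmx by rewrite unitmx_mul (posdef_unit pT) (posdef_unit pS).
have := trf_gram_swap f u.
by rewrite adjM (posdef_herm pS) (posdef_herm pT) !mulmxA.
Qed.

Lemma invmx_eq l (A B : 'M[C]_l) : A *m B = 1%:M -> invmx A = B.
Proof.
by move=> e; have [uA _] := mulmx1_unit e; rewrite -[LHS]mulmx1 -e mulmxA (mulVmx uA) mul1mx.
Qed.

Lemma inv_sandwich l (X Y : 'M[C]_l) : posdef X -> posdef Y ->
  invmx (mx_pow 2^-1 X *m Y *m mx_pow 2^-1 X) =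
  mx_pow 2^-1 (invmx X) *m invmx Y *m mx_pow 2^-1 (invmx X).
Proof.
move=> pX pY; rewrite (mx_pow_inv _ pX) -(mx_powV _ pX).
have uS := posdef_unit (mx_pow_posdef 2^-1 pX); have uY := posdef_unit pY.
move: (mx_pow _ X) uS => S uS; apply: invmx_eq.
rewrite !mulmxA -[S *m Y *m S *m invmx S]mulmxA (mulmxV uS) mulmx1.
by rewrite -[S *m Y *m invmx Y]mulmxA (mulmxV uY) mulmx1 (mulmxV uS).
Qed.

Lemma trfN l (f : R -> R) (M : 'M[C]_l) : posdef M -> trf (fun x => - f x) M = - trf f M.
Proof.
move=> pM; have [U [d [UU _ e _]]] := posdef_spectral pM.
by rewrite !(trfE _ UU e) sumrN.
Qed.

Lemma sandwich_posdef l (X Y : 'M[C]_l) : posdef X -> posdef Y ->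
  posdef (mx_pow 2^-1 X *m Y *m mx_pow 2^-1 X).
Proof.
move=> pX pY; have pS := mx_pow_posdef 2^-1 pX.
by rewrite -{1}(posdef_herm pS); apply: posdef_congr_unit => //; exact: posdef_unit.
Qed.

Lemma sandwich_swap n m l (QA : 'M[C]_n -> 'M[C]_l) (QB : 'M[C]_m -> 'M[C]_l) (f : R -> R) A B :
  posdef (QA A) -> posdef (QB B) -> sandwich QA QB f A B = sandwich QB QA f B A.
Proof. exact: trf_swap. Qed.

Lemma sandwichN n m l (QA : 'M[C]_n -> 'M[C]_l) (QB : 'M[C]_m -> 'M[C]_l) (f : R -> R) A B :
  posdef (QA A) -> posdef (QB B) -> sandwich QA QB (fun x => - f x) A B = - sandwich QA QB f A B.
Proof. by move=> pX pY; exact: (trfN f (sandwich_posdef pX pY)). Qed.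

Section Sandwich.
Variables (n m l : nat) (QA : 'M[C]_n -> 'M[C]_l) (QB : 'M[C]_m -> 'M[C]_l) (p q : R).
Hypotheses (hp : 0 <= p <= 1) (hq : 0 <= q <= 1)
  (pA : forall A, posdef A -> posdef (QA A)) (pB : forall B, posdef B -> posdef (QB B))
  (cA : pconc p QA) (cB : pconc q QB).

Lemma sandwich_concave (f : R -> R) : nondecreasing_pos f ->
  concave_pos (fun x => f (x `^ (1 + p))) \/ concave_pos (fun x => f (x `^ (1 + q))) ->
  jointly_concave (sandwich QA QB f).
Proof.
move=> nf [cf|cf]; first exact: (sandwich_concave_left hp pA pB cA (pconc_opconc pB cB) nf cf).
move=> A1 A2 B1 B2 t pA1 pA2 pB1 pB2 ht.
have := sandwich_concave_left hq pB pA cB (pconc_opconc pA cA) nf cf pB1 pB2 pA1 pA2 ht.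
have pAt := posdef_convex ht pA1 pA2; have pBt := posdef_convex ht pB1 pB2.
rewrite (sandwich_swap f (pA pA1) (pB pB1)) (sandwich_swap f (pA pA2) (pB pB2)).
rewrite (sandwich_swap f (pA pAt) (pB pBt)); exact.
Qed.

Lemma sandwich_convex (f : R -> R) : nonincreasing_pos f ->
  convex_pos (fun x => f (x `^ (1 + p))) \/ convex_pos (fun x => f (x `^ (1 + q))) ->
  jointly_convex (sandwich QA QB f).
Proof.
move=> nf cf; have nf' : nondecreasing_pos (fun x => - f x).
  by move=> x y x0 xy; rewrite lerN2; exact: nf.
have cN (g : R -> R) : convex_pos g -> concave_pos (fun x => - g x).
  by move=> h x y t x0 y0 ht; rewrite !mulrN -opprD lerN2; exact: h.
have cf' : concave_pos (fun x => - f (x `^ (1 + p))) \/ concave_pos (fun x => - f (x `^ (1 + q))).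
  by case: cf => h; [left | right]; exact: (cN _ h).
move=> A1 A2 B1 B2 t pA1 pA2 pB1 pB2 ht.
have pAt := posdef_convex ht pA1 pA2; have pBt := posdef_convex ht pB1 pB2.
have := sandwich_concave nf' cf' pA1 pA2 pB1 pB2 ht.
rewrite (sandwichN f (pA pA1) (pB pB1)) (sandwichN f (pA pA2) (pB pB2)).
rewrite (sandwichN f (pA pAt) (pB pBt)).
by rewrite !mulrN -opprD lerN2.
Qed.
End Sandwich.

(** Inverting the product inverts both factors, which brings the second function to the form of the
    first. *)
Lemma F2E n m l (Phi : {linear 'M[C]_n -> 'M[C]_l}) (Psi : {linear 'M[C]_m -> 'M[C]_l})
  (p q : R) (f : R -> R) A B : strictly_positive Phi -> strictly_positive Psi ->
  posdef A -> posdef B ->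
  F2 Phi Psi p q f A B = sandwich (fun A => invmx (Phi (mx_pow (- p) A)))
    (fun B => invmx (Psi (mx_pow (- q) B))) f A B.
Proof.
move=> sPhi sPsi pA pB; rewrite /F2 /sandwich.
by rewrite (inv_sandwich (sPhi _ (mx_pow_posdef _ pA)) (sPsi _ (mx_pow_posdef _ pB))).
Qed.
End Assembly.

Theorem theorem5p2 (R : realType) (n m l : nat)
  (Phi : {linear 'M[R[i]]_n -> 'M[R[i]]_l})
  (Psi : {linear 'M[R[i]]_m -> 'M[R[i]]_l})
  (p q : R) (f : R -> R) :
  strictly_positive Phi -> strictly_positive Psi ->
  0 <= p <= 1 -> 0 <= q <= 1 -> (p, q) != (0, 0) ->
  ((nondecreasing_pos f ->
    concave_pos (fun x => f (x `^ (1 + p))) \/ concave_pos (fun x => f (x `^ (1 + q))) ->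
    jointly_concave (F1 Phi Psi p q f) /\ jointly_concave (F2 Phi Psi p q f))
  /\
  (nonincreasing_pos f ->
    convex_pos (fun x => f (x `^ (1 + p))) \/ convex_pos (fun x => f (x `^ (1 + q))) ->
    jointly_convex (F1 Phi Psi p q f) /\ jointly_convex (F2 Phi Psi p q f))).
Proof.
move=> sPhi sPsi hp hq _.
have [pA _] := tame_map sPhi; have [pB _] := tame_map sPsi.
have [pA' _] := tame_map_inv sPhi; have [pB' _] := tame_map_inv sPsi.
have cA := pconc_map sPhi hp; have cB := pconc_map sPsi hq.
have cA' := pconc_map_inv sPhi hp; have cB' := pconc_map_inv sPsi hq.
split=> nf cf; split.
- exact: (sandwich_concave hp hq (pA p) (pB q) cA cB nf cf).
- move=> A1 A2 B1 B2 t pA1 pA2 pB1 pB2 ht.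
  have pAt := posdef_convex ht pA1 pA2; have pBt := posdef_convex ht pB1 pB2.
  rewrite (F2E p q f sPhi sPsi pA1 pB1) (F2E p q f sPhi sPsi pA2 pB2) (F2E p q f sPhi sPsi pAt pBt).
  exact: (sandwich_concave hp hq (pA' p) (pB' q) cA' cB' nf cf).
- exact: (sandwich_convex hp hq (pA p) (pB q) cA cB nf cf).
- move=> A1 A2 B1 B2 t pA1 pA2 pB1 pB2 ht.
  have pAt := posdef_convex ht pA1 pA2; have pBt := posdef_convex ht pB1 pB2.
  rewrite (F2E p q f sPhi sPsi pA1 pB1) (F2E p q f sPhi sPsi pA2 pB2) (F2E p q f sPhi sPsi pAt pBt).
  exact: (sandwich_convex hp hq (pA' p) (pB' q) cA' cB' nf cf).
Qed.
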